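(* Suppose $p\ge 1$, $q\ge 1$ and $d+1\le p+q\le n-r$, and let $0\le\kappa<n-r-d$. Let $(\kappa_0,\kappa_1,\dots,\kappa_r)\in\mathbb{R}_{>0}^{r+1}$ be such that $\kappa_0+\kappa_1+\cdots+\kappa_r=\kappa$. Then for any $\xi=(\xi_0,\xi_1,\dots,\xi_r)\in\mathbb{R}^{r+1}$ and for almost every $(F,M)\in\mathcal{Y}^{(F_0,M_0)}$, writing $M=(l_1,\dots,l_r)$, the system of inequalities $$|F(v)-\xi_0|<t^{-\kappa_0},\qquad |l_i(v)-\xi_i|<t^{-\kappa_i}\ (1\le i\le r),\qquad \|v\|\le t$$ has a solution $v\in\mathbb{Z}^n$ for all sufficiently large $t$.
   Context: Let $p,q,m,s\ge 0$ be integers, $n=p+q+2m+s$ and $r=m+s$, with $1\le r<n$ (so $m=n-r-(p+q)$). Elements of $\mathbb{R}^n$ are row vectors $(x_1,\dots,x_{p+q},y_1,\dots,y_{2m},z_1,\dots,z_s)$. Let $d\ge 2$ be an even integer. Let $P_1(y_1,\dots,y_{2m})$ be a real polynomial for which there is a positive integer $d'<d$ with $P_1(Ty_1,\dots,Ty_m,y_{m+1},\dots,y_{2m})=O(T^{d'})$ as $T\to\infty$, and let $P_2(z_1,\dots,z_s)$ be any real polynomial. Define $$F_0(x,y,z)=x_1^d+\cdots+x_p^d-x_{p+1}^d-\cdots-x_{p+q}^d+P_1(y_1,\dots,y_{2m})+P_2(z_1,\dots,z_s),$$ $$M_0(x,y,z)=(y_{m+1},\dots,y_{2m},z_1,\dots,z_s)\in\mathbb{R}^r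 .$$ Linear maps $\mathbb{R}^n\to\mathbb{R}^r$ are regarded as $n\times r$ matrices acting on row vectors from the right. For $g\in \mathrm{SL}_n(\mathbb{R})$ put $F_0^g(v)=F_0(vg)$. Set $$\mathcal{Y}^{(F_0,M_0)}=\{(\lambda F_0^{g_1},\,g_1M_0g_2) : (\lambda,g_1,g_2)\in(\mathbb{R}\setminus\{0\})\times \mathrm{SL}_n(\mathbb{R})\times \mathrm{GL}_r(\mathbb{R})\},$$ so that $(g_1M_0g_2)(v)=vg_1M_0g_2$. It is identified with the quotient of $(\mathbb{R}\setminus\{0\})\times \mathrm{SL}_n(\mathbb{R})\times \mathrm{GL}_r(\mathbb{R})$ by the isotropy group of $(F_0,M_0)$ and carries the corresponding invariant measure; a subset is null exactly when its preimage under $(\lambda,g_1,g_2)\mapsto(\lambda F_0^{g_1},g_1M_0g_2)$ is null for the product of Haar measures. For $M:\mathbb{R}^n\to\mathbb{R}^r$ linear, $M=(l_1,\dots,l_r)$ denotes its component linear forms. $\|\cdot\|$ is an arbitrary fixed norm on $\mathbb{R}^n$. *)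

(* Defs.v *)
From HB Require Import structures.
From mathcomp Require Import all_boot all_order all_algebra.
From mathcomp Require Import all_classical all_reals all_analysis.
(* Not imported: the notations of mpoly clash with those of all_analysis. *)
From mathcomp Require mpoly.

Set Implicit Arguments.
Unset Strict Implicit.
Unset Printing Implicit Defensive.

Import Order.TTheory GRing.Theory Num.Theory.
Import numFieldNormedType.Exports.

Local Open Scope classical_set_scope.
Local Open Scope ring_scope.

Definition is_norm (R : realType) (V : lmodType R) (N : V -> R) : Prop :=
  [/\ forall u v, N (u + v) <= N u + N v,
      forall a v, N (a *: v) = `|a| * N v
    & forall v, N v = 0 -> v = 0].

Definition borel (T : ptopologicalType) := g_sigma_algebraType (@open T).

(* The groups involved are realized as locally closed subsets G of a matrix
   space or of R, so a Borel measure on G is a Borel measure on the ambient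
   space T that is carried by G. Compactness of K `<=` G does not depend on
   whether it is taken in G or in T. Regularity and sigma-finiteness are
   automatic, since G is locally compact and second countable. *)
Definition is_haar (R : realType) (T : ptopologicalType) (G : set T)
    (mul : T -> T -> T)
    (mu : {sigma_finite_measure set (borel T) -> \bar R}) : Prop :=
  [/\ mu (~` G) = 0%E,
      mu G <> 0%E,
      forall K : set T, compact K -> K `<=` G -> (mu K < +oo)%E
    & forall (g : T) (A : set (borel T)),
        G g -> measurable A -> mu (mul g @^-1` A) = mu A].

Definition Runits (R : realType) : set R := [set a | a != 0].

Definition SL (R : realType) (n : nat) : set 'M[R]_n := [set g | \det g = 1].

Definition GL (R : realType) (n : nat) : set 'M[R]_n := [set g | g \in unitmx].

Definition dim_n (p q m s : nat) : nat := (p + q + (m + m) + s)%N.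

Definition dim_r (m s : nat) : nat := (m + s)%N.

Definition at_pinfty (R : realType) : filter_on R :=
  FilterType (pinfty_nbhs R) (filter_filter (F := pinfty_nbhs R)).

Section pairs.
Variables (R : realType) (p q m s : nat).
Local Notation n := (dim_n p q m s).
Local Notation r := (dim_r m s).

Definition xpart (v : 'rV[R]_n) : 'rV[R]_(p + q) :=
  @lsubmx R 1 (p + q) (m + m) (@lsubmx R 1 (p + q + (m + m)) s v).

Definition ypart (v : 'rV[R]_n) : 'rV[R]_(m + m) :=
  @rsubmx R 1 (p + q) (m + m) (@lsubmx R 1 (p + q + (m + m)) s v).

Definition zpart (v : 'rV[R]_n) : 'rV[R]_s :=
  @rsubmx R 1 (p + q + (m + m)) s v.

Definition peval (k : nat) (P : mpoly.mpoly k R) (u : 'rV[R]_k) : R :=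
  mpoly.meval (fun i => u 0 i) P.

(* P1(T y_1, ..., T y_m, y_{m+1}, ..., y_{2m}) = O(T^e), for every fixed y. *)
Definition first_half_growth (P1 : mpoly.mpoly (m + m) R) (e : nat) : Prop :=
  forall y1 y2 : 'rV[R]_m,
    (fun T : R => peval P1 (row_mx (T *: y1) y2) : R^o)
      =O_ (at_pinfty R) (fun T : R => T ^+ e : R^o).

Definition F0 (d : nat) (P1 : mpoly.mpoly (m + m) R) (P2 : mpoly.mpoly s R)
    (v : 'rV[R]_n) : R :=
  \sum_(i < p) xpart v 0 (lshift q i) ^+ d
  - \sum_(j < q) xpart v 0 (rshift p j) ^+ d
  + peval P1 (ypart v) + peval P2 (zpart v).

Definition M0 : 'M[R]_(n, r) :=
  col_mx (col_mx (0 : 'M[R]_(p + q, m + s))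
                 (col_mx (0 : 'M[R]_(m, m + s)) (row_mx (1%:M : 'M[R]_m) 0)))
         (row_mx 0 (1%:M : 'M[R]_s)).

Lemma M0E (v : 'rV[R]_n) : v *m M0 = row_mx (rsubmx (ypart v)) (zpart v).
Proof.
rewrite /M0 /ypart /zpart.
rewrite -[v in LHS](@hsubmxK _ 1 (p + q + (m + m)) s) mul_row_col.
set w := lsubmx v; rewrite -[w in LHS]hsubmxK mul_row_col mulmx0 add0r.
rewrite -[rsubmx w in LHS]hsubmxK mul_row_col mulmx0 add0r !mul_mx_row.
by rewrite !mulmx1 !mulmx0 add_row_mx addr0 add0r.
Qed.

Definition group_param : set (borel R * borel 'M[R]_n * borel 'M[R]_r) :=
  [set x | [/\ Runits x.1.1, SL x.1.2 & GL x.2]].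

Definition orbit_map (F : 'rV[R]_n -> R) (M : 'M[R]_(n, r))
    (x : borel R * borel 'M[R]_n * borel 'M[R]_r) :
    ('rV[R]_n -> R) * 'M[R]_(n, r) :=
  (fun v => (x.1.1 : R) * F (v *m (x.1.2 : 'M[R]_n)),
   (x.1.2 : 'M[R]_n) *m M *m (x.2 : 'M[R]_r)).

Definition orbit (F : 'rV[R]_n -> R) (M : 'M[R]_(n, r)) :
    set (('rV[R]_n -> R) * 'M[R]_(n, r)) :=
  orbit_map F M @` group_param.

(* Haar measures are unique up to scaling, so that quantifying over all of
   them does not depend on a choice. *)
Definition null_in_orbit (F : 'rV[R]_n -> R) (M : 'M[R]_(n, r))
    (B : set (('rV[R]_n -> R) * 'M[R]_(n, r))) : Prop :=
  forall (mu0 : {sigma_finite_measure set (borel R) -> \bar R})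
    (mu1 : {sigma_finite_measure set (borel 'M[R]_n) -> \bar R})
    (mu2 : {sigma_finite_measure set (borel 'M[R]_r) -> \bar R}),
    is_haar (@Runits R) *%R mu0 ->
    is_haar (@SL R n) mulmx mu1 ->
    is_haar (@GL R r) mulmx mu2 ->
    ((mu0 \x mu1) \x mu2)%E.-negligible
      (group_param `&` orbit_map F M @^-1` B).

Definition ae_in_orbit (F : 'rV[R]_n -> R) (M : 'M[R]_(n, r))
    (P : ('rV[R]_n -> R) -> 'M[R]_(n, r) -> Prop) : Prop :=
  null_in_orbit F M (orbit F M `&` [set FM | ~ P FM.1 FM.2]).

Definition solves (N : 'rV[R]_n -> R) (kap xi : 'I_r.+1 -> R)
    (F : 'rV[R]_n -> R) (M : 'M[R]_(n, r)) (t : R) (v : 'rV[R]_n) : Prop :=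
  [/\ `|F v - xi ord0| < t `^ (- kap ord0),
      forall i : 'I_r,
        `|(v *m M) 0 i - xi (lift ord0 i)| < t `^ (- kap (lift ord0 i))
    & N v <= t].

End pairs.

Arguments M0 R p q m s : clear implicits.

(* Main.v *)
(* By Fubini, lambda and g_2 may be fixed. Passing to t = 2^j, the set of
   exceptional g in SL_n(R) is covered by countably many limsup sets, one for
   each integer matrix s and each set K of those g for which s g is close to a
   diagonal matrix. The measure of the set of g in K that fail at level j is
   estimated by left invariance, averaging over the translations by
   s^-1 u_B s, where u_B is unipotent and its only off-diagonal block is B / q,
   with q a large prime and B running through all matrices over F_q; this block
   adds multiples of the rows of s g belonging to x_1, y_(m+1), ..., z_s to the
   other ones. The integer vectors are parametrized by a part k in a narrow cone
   around the axis of x_(p+1) and a part w attached to the rows x_1, y_(m+1),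
   ..., z_s. For given k, the vector w + k B / q ranges over a coset of the
   integer lattice, whose class k B mod q is uniformly distributed, and those
   of two vectors k which are not parallel are independent. The thin conditions
   and the monotonicity of x_1^d - x_(p+1)^d + ... in x_1 show that the classes
   which lead to a solution have proportion about
   2^(-j kappa) / 2^(j (d - 1)), while there are about 2^(j (n - r - 1)) vectors
   k, few pairs of which are parallel. By Chebyshev's inequality the proportion
   of bad B is O(j 2^(-j (n - r - d - kappa))), which is summable, and the
   Borel-Cantelli lemma applies. *)
Require Import Defs.
From HB Require Import structures.
From mathcomp Require Import all_boot all_order all_algebra.
From mathcomp Require Import all_classical all_reals all_analysis.
From mathcomp Require Import measurable_realfun.
From mathcomp Require mpoly.
From mathcomp Require Import zify ring lra.
Import Order.TTheory GRing.Theory Num.Theory.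
Import numFieldNormedType.Exports.
Local Open Scope classical_set_scope.
Local Open Scope ring_scope.
Set Implicit Arguments.
Unset Strict Implicit.
Unset Printing Implicit Defensive.

(** * Second moments over finite fields *)

(** The r + 1 entries of w answer r + 1 conditions: the r linear ones and the one on F, which is
    steered through x_1 alone. The axis of x_(p+1) is distinguished because x_(p+1)^d has the sign
    opposite to x_1^d and outweighs the remaining terms in the cone, so F passes through any fixed
    value as x_1 grows. Once y_(m+1), ..., z_s are bounded, P_2 is bounded and P_1 grows with degree
    below d, so neither disturbs this.

    Translates by B / q replace an integral over the unipotent group: uniformity and pairwise
    independence become exact counts over F_q. The prime is chosen last. It exceeds the products in
    the 2 by 2 minors of the vectors k, so that linear independence survives reduction mod q, and it
    makes the rounding of w to a multiple of 1 / q harmless.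

    The integer matrix s need not be unimodular. Solutions for s g are carried to solutions for g by
    v |-> v s, which preserves integrality, while s is inverted over R only inside s^-1 u_B s, which
    has determinant 1 and so acts by left translation on SL_n(R). *)

Lemma sum_mulmx (F : finFieldType) (c n m : nat) (A : 'M[F]_(c, n))
    (g : 'M[F]_(c, m) -> nat) : row_free A ->
  (#|F| ^ (c * m) * \sum_(B : 'M[F]_(n, m)) g (A *m B)
   = (\sum_Y g Y) * #|F| ^ (n * m))%N.
Proof.
move=> /row_freeP[X AX].
pose fib Z := #|[set B : 'M[F]_(n, m) | A *m B == Z]%SET|.
(* Adding [X *m (Y - Z)], with [X] a right inverse of [A], maps the fibre over [Z] onto the fibre
   over [Y], so all fibres have the same size. *)
have fibE Z Y : fib Z = fib Y.
  rewrite /fib -(card_imset _ (@addrI _ (X *m (Y - Z)))).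
  apply: eq_card => B; rewrite !inE; apply/imsetP/eqP => [[C]|AB].
    by rewrite inE => /eqP CZ ->; rewrite mulmxDr mulmxA AX mul1mx CZ subrK.
  exists (B - X *m (Y - Z)); last by rewrite addrC subrK.
  by rewrite inE mulmxBr mulmxA AX mul1mx AB opprB addrC subrK.
have sumE (f : 'M[F]_(c, m) -> nat) :
    (\sum_(B : 'M[F]_(n, m)) f (A *m B) = (\sum_Y f Y) * fib 0%R)%N.
  rewrite (partition_big (mulmx A) predT) //= big_distrl /=.
  apply: eq_bigr => Y _; rewrite (eq_bigr (fun=> f Y)) => [|B /eqP-> //].
  by rewrite sum_nat_const mulnC (fibE 0 Y) /fib -cardsE.
(* The constant function 1 yields the common size of the fibres. *)
rewrite sumE; have := sumE (fun=> 1%N).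
by rewrite !sum1_card !card_mx => ->; rewrite mulnCA mulnA.
Qed.

(* Second moment method: [kk i *m B] is uniform, and two of these vectors are
   independent as soon as [i] and [j] are not related by [par]. *)
Lemma card_avoid_le (F : finFieldType) (I : finType) (n m s : nat)
    (kk : I -> 'rV[F]_n) (S : I -> {set 'rV[F]_m}) (par : rel I) :
  (forall i, kk i != 0) ->
  (forall i j, ~~ par i j -> row_free (col_mx (kk i) (kk j))) ->
  (forall i, #|S i| = s) ->
  (#|[set B : 'M[F]_(n, m) | [forall i, kk i *m B \notin S i]]%SET|
     * (#|I| ^ 2 * s)
   <= #|[set ij : I * I | par ij.1 ij.2]%SET| * (#|F| ^ m * #|F| ^ (n * m)))%N.
Proof.
move=> kk0 indep Ss; set q := #|F|.
set bad := [set B : 'M[F]_(n, m) | _]%SET; set M := #|[set ij : I * I | _]%SET|.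
(* Over the [N] matrices, [Z] has mean [E / P]; multiplying by powers of [P] avoids fractions. *)
set P := (q ^ m)%N; set N := (q ^ (n * m))%N; pose E := (#|I| * s)%N.
pose Z (B : 'M[F]_(n, m)) := (\sum_i (kk i *m B \in S i))%N.
have one i : (P * \sum_(B : 'M[F]_(n, m)) (kk i *m B \in S i) = s * N)%N.
  have fr : row_free (kk i) by rewrite /row_free rank_rV kk0.
  have := sum_mulmx (fun Y : 'rV_m => (Y \in S i) : nat) fr.
  rewrite mul1n => ->; rewrite -(Ss i) -sum1_card; congr (_ * _)%N.
  by rewrite [RHS]big_mkcond; apply: eq_bigr => Y _; case: ifP.
have two i j : ~~ par i j ->
    (P * P * \sum_(B : 'M[F]_(n, m)) (kk i *m B \in S i) * (kk j *m B \in S j)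
     = s * s * N)%N.
  move=> /indep fr.
  have := sum_mulmx (fun Y : 'M[F]_(1 + 1, m) =>
    ((usubmx Y \in S i) * (dsubmx Y \in S j))%N) fr.
  rewrite mulnDl mul1n expnD -/P -/N => H.
  rewrite (eq_bigr (fun B => (usubmx (col_mx (kk i) (kk j) *m B) \in S i)
      * (dsubmx (col_mx (kk i) (kk j) *m B) \in S j))%N); last first.
    by move=> B _; rewrite mul_col_mx col_mxKu col_mxKd.
  rewrite {}H; congr (_ * _)%N; have -> : (s * s = #|S i| * #|S j|)%N by rewrite !Ss.
  rewrite -!sum1_card.
  rewrite big_distrlr /= [in RHS]big_mkcond /=.
  rewrite [RHS](eq_bigr (fun a => \sum_b (a \in S i) * (b \in S j))%N); last first.
    move=> a _; case: (a \in S i); last by apply/esym/big1.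
    by rewrite [LHS]big_mkcond; apply: eq_bigr => b _; case: (b \in S j).
  rewrite pair_bigA /= (reindex (fun p : 'rV_m * 'rV_m => col_mx p.1 p.2)) /=; last first.
    exists (fun Y => (usubmx Y, dsubmx Y)) => [[a b]|Y] _ /=.
      by rewrite col_mxKu col_mxKd.
    by rewrite vsubmxK.
  by apply: eq_bigr => -[a b] _ /=; rewrite col_mxKu col_mxKd.
have sum1 : (P * \sum_B Z B = E * N)%N.
  rewrite exchange_big /= big_distrr /= (eq_bigr _ (fun i _ => one i)).
  by rewrite sum_nat_const mulnA.
(* Pairs outside [par] contribute at most the square of the mean; for the others one of the two
   indicators is bounded by 1. *)
have sum2 : (P * P * \sum_B Z B * Z B <= E * E * N + M * (s * N * P))%N.
  rewrite (eq_bigr (fun B => \sum_(ij : I * I)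
      (kk ij.1 *m B \in S ij.1) * (kk ij.2 *m B \in S ij.2))%N); last first.
    by move=> B _; rewrite /Z big_distrlr /= pair_bigA.
  rewrite exchange_big /= big_distrr /=.
  rewrite (bigID (fun ij : I * I => par ij.1 ij.2)) /= addnC; apply: leq_add.
    rewrite (eq_bigr (fun=> s * s * N)%N) => [|ij /two //].
    rewrite sum_nat_const.
    have -> : (E * E * N = (#|I| * #|I|) * (s * s * N))%N by rewrite /E; lia.
    by rewrite leq_mul2r -card_prod max_card orbT.
  rewrite /M -sum1dep_card big_distrl /=; apply: leq_sum => ij _.
  rewrite mul1n -(one ij.1) -mulnA [X in (_ <= X)%N]mulnC leq_mul2l.
  rewrite leq_mul2l; apply/orP; right; apply/orP; right.
  by apply: leq_sum => B _; case: (_ \in S ij.2); rewrite ?muln1 ?muln0.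
(* Chebyshev's inequality at the value 0: a bad [B] has [Z B = 0], hence contributes [E * E] to the
   sum of the squared deviations of [P * Z] from [E]. *)
have key : (#|bad| * (E * E) <= M * (s * N * P))%N.
  have cheb : (#|bad| * (E * E))%:Z <= \sum_B ((P * Z B)%:Z - E%:Z) ^+ 2.
    rewrite -sum1_card big_distrl /= big_mkcond /=.
    rewrite -natz natr_sum; apply: ler_sum => B _; case: ifP => [|_]; last first.
      exact: sqr_ge0.
    rewrite inE => /forallP badB.
    rewrite (_ : Z B = 0)%N; first by rewrite muln0 mul1n natz sub0r sqrrN.
    by apply: big1 => i _; rewrite (negPf (badB i)).
  have exp : \sum_B ((P * Z B)%:Z - E%:Z) ^+ 2 =
      (P * P * \sum_B Z B * Z B)%:Z - (2 * E * (P * \sum_B Z B))%:Z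
      + (E * E * N)%:Z.
    rewrite !big_distrr /= -!natz !natr_sum -sumrB.
    have -> : (E * E * N = \sum_(B : 'M[F]_(n, m)) (E * E))%N.
      by rewrite sum_nat_const mulnC card_mx.
    rewrite natr_sum -big_split /=; apply: eq_bigr => B _.
    by rewrite !natz; lia.
  rewrite sum1 in exp; lia.
have [->|s0] := posnP s; first by rewrite !muln0.
rewrite -(leq_pmul2r s0); move: key; rewrite /E.
rewrite !(mulnA, expnS, expn0, muln1); lia.
Qed.

(** Within one residue class mod [h], a number below [T] is determined by its quotient by [h], which
    is below [g]. *)
Lemma card_dvdn_shift (T h g c : nat) : (T <= h * g)%N ->
  (#|[set b : 'I_T | h %| b + c]%SET| <= g)%N.
Proof.
move=> Thg; have [h0|h0] := posnP h.
  rewrite (eq_card0 (A := _)) // => -[b bT]; exfalso.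
  by move: (leq_trans bT Thg); rewrite h0.
have lt (b : 'I_T) : (b %/ h < g)%N.
  by rewrite ltn_divLR // mulnC (leq_trans (ltn_ord b)).
rewrite -[leqRHS]card_ord -(card_in_imset (f := fun b => Ordinal (lt b))).
  exact: max_card.
move=> b b'; rewrite !inE => hb hb' [eqd]; apply/val_inj => /=.
rewrite (divn_eq b h) (divn_eq b' h) eqd; congr (_ + _)%N.
have : (b + c = b' + c %[mod h])%N by rewrite (eqP hb) (eqP hb').
by move/eqP; rewrite eqn_modDr => /eqP.
Qed.

(** Dyadic blocks: the 2^i values of [g] in (2^i, 2^(i+1)] contribute at most [N] together. This
    harmonic sum is the source of the factor j in the final estimate. *)
Lemma sum_divn_le (i N : nat) :
  (\sum_(1 <= g < (2 ^ i).+1) N %/ g <= i.+1 * N)%N.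
Proof.
elim: i => [|i IH]; first by rewrite big_nat1 divn1 mul1n.
have le2 : (2 ^ i <= 2 ^ i.+1)%N by rewrite leq_exp2l.
rewrite (big_cat_nat (n := (2 ^ i).+1)) //= mulSn addnC; apply: leq_add => //.
apply: (@leq_trans (\sum_((2 ^ i).+1 <= g < (2 ^ i.+1).+1) N %/ 2 ^ i)).
  rewrite !big_nat; apply: leq_sum => g /andP[g1 _].
  by rewrite leq_div2l ?expn_gt0 // ltnW.
rewrite sum_nat_const_nat subSS expnS mul2n -addnn addnK mulnC.
exact: leq_trunc_div.
Qed.

(** * Counting parallel pairs in the cone *)

Section ParallelPairs.
Local Open Scope nat_scope.
Variables (l i K : nat).
Local Notation L := l.+2.
Local Notation T := (2 ^ i)%N.

(* Shifting coordinate 0 keeps these vectors in a narrow cone around the first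
   axis; shifting coordinate 1 keeps that coordinate nonzero. *)
Definition kvec (a : {ffun 'I_L -> 'I_T}) (e : 'I_L) : nat :=
  (a e + (e == ord0) * (K * T) + (e == lift ord0 ord0))%N.

Definition parallel (a a' : {ffun 'I_L -> 'I_T}) : bool :=
  [forall e, forall e', kvec a e * kvec a' e' == kvec a e' * kvec a' e]%N.

Lemma kvec_inj a a' : (forall e, kvec a e = kvec a' e) -> a = a'.
Proof.
move=> eqk; apply/ffunP => e; apply/val_inj => /=.
by have := eqk e; rewrite /kvec -!addnA => /eqP; rewrite eqn_add2r => /eqP.
Qed.

Lemma kvec1_gt0 a : (0 < kvec a (lift ord0 ord0))%N.
Proof. by rewrite /kvec eqxx addn1. Qed.

Lemma kvec_le a e : (kvec a e <= T + (e == ord0) * (K * T))%N.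
Proof.
have := ltn_ord (a e); rewrite /kvec; case: (e =P ord0) => [->|] /=.
  by lia.
by case: (e =P lift ord0 ord0) => _ /=; lia.
Qed.

Hypothesis K0 : (0 < K)%N.

Lemma kvec0_ge a : (T <= kvec a ord0)%N.
Proof.
by rewrite /kvec eqxx mul1n; apply: leq_trans (leq_addr _ _);
  apply: leq_trans (leq_addl _ _); rewrite leq_pmull.
Qed.

(** With u, v the first two coordinates of [a] and g their gcd, a vector parallel to [a] has its
    first coordinate divisible by u / g. This coordinate ranges over [T] consecutive integers and
    [T <= u], which leaves at most g values; it determines the whole vector. *)
Lemma card_parallel_fiber a :
  (#|[set a' | parallel a a']%SET|
   <= gcdn (kvec a ord0) (kvec a (lift ord0 ord0)))%N.
Proof.
set u := kvec a ord0; set v := kvec a _; set g := gcdn u v.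
have u0 : (0 < u)%N by rewrite (leq_trans _ (kvec0_ge a)) // expn_gt0.
have g0 : (0 < g)%N by rewrite gcdn_gt0 u0.
have ug : (T <= (u %/ g) * g)%N by rewrite divnK ?dvdn_gcdl // kvec0_ge.
apply: leq_trans (card_dvdn_shift (K * T) ug).
rewrite -(card_in_imset (f := fun a' : {ffun 'I_L -> 'I_T} => a' ord0)).
  apply/subset_leq_card/fintype.subsetP => b /imsetP[a']; rewrite inE => par ->.
  rewrite inE; have := forallP par ord0 => /forallP/(_ (lift ord0 ord0))/eqP.
  rewrite -/u -/v {2}/kvec eqxx mul1n addn0 => uv.
  rewrite -(@Gauss_dvdr _ (v %/ g)); last first.
    have: coprime (u %/ g) (v %/ g).
      rewrite /coprime -(eqn_pmul2r g0) mul1n muln_gcdl.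
      by rewrite !divnK ?dvdn_gcdl ?dvdn_gcdr.
    by [].
  rewrite -(@dvdn_pmul2r g) // divnK ?dvdn_gcdl // mulnAC divnK ?dvdn_gcdr //.
  by rewrite -uv dvdn_mulr.
move=> a' a''; rewrite !inE => p1 p2 eq0; apply: kvec_inj => e.
apply/eqP; rewrite -(eqn_pmul2l u0).
have /forallP/(_ e)/eqP -> := forallP p1 ord0.
have /forallP/(_ e)/eqP -> := forallP p2 ord0.
by rewrite {2 4}/kvec eq0.
Qed.

(** Each of the two divisibility conditions leaves at most [T %/ g + 1 <= 2 * (T %/ g)] values,
    whence the 4; the weight [g] cancels one of the two quotients. *)
Lemma card_dvd_coords g : (0 < g <= T)%N ->
  (g * #|[set a : {ffun 'I_L -> 'I_T} |
     (g %| kvec a ord0) && (g %| kvec a (lift ord0 ord0))]%SET|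
   <= 4 * T ^ L.-1 * (T %/ g))%N.
Proof.
move=> /andP[g0 gT].
pose Fe (e : 'I_L) : {pred 'I_T} := [pred x : 'I_T |
  g %| x + ((e == ord0) * (K * T) + (e == lift ord0 ord0)) ]%N.
pose Ge (e : 'I_L) : {pred 'I_T} :=
  if (e == ord0) || (e == lift ord0 ord0) then Fe e else predT.
have GeE (e : 'I_L) (x : 'I_T) :
    (x \in Ge e) = ((e == ord0) || (e == lift ord0 ord0) ==> (x \in Fe e)).
  by rewrite /Ge; case: (_ || _).
have -> : #|[set a : {ffun 'I_L -> 'I_T} |
     (g %| kvec a ord0) && (g %| kvec a (lift ord0 ord0))]%SET|
     = #|(family Ge : pred {ffun 'I_L -> 'I_T})|.
  apply: eq_card => a; rewrite !inE; apply/andP/forallP => [[h0 h1] e|h].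
    rewrite GeE; apply/implyP => /orP[]/eqP->.
      by rewrite inE; move: h0; rewrite /kvec addnA.
    by rewrite inE; move: h1; rewrite /kvec addnA.
  split.
    by have := h ord0; rewrite GeE eqxx /= inE /kvec addnA.
  by have := h (lift ord0 ord0); rewrite GeE eqxx orbT inE /kvec addnA.
rewrite card_family foldrE big_map big_enum /= 2!big_ord_recl /=.
have cF e : (#|Fe e| <= 2 * (T %/ g))%N.
  rewrite (@leq_trans (T %/ g).+1) //; last first.
    by rewrite mul2n -addnn -addn1 leq_add2l divn_gt0.
  have Tg : (T <= g * (T %/ g).+1)%N.
    by rewrite mulnC ltnW // ltn_ceil.
  have := card_dvdn_shift ((e == ord0) * (K * T) + (e == lift ord0 ord0)) Tg.
  by apply: leq_trans; rewrite cardsE; apply/subset_leq_card/fintype.subsetP => x; rewrite !inE.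
rewrite [\prod_(_ < _) _](_ : _ = T ^ l)%N; last first.
  rewrite (eq_bigr (fun=> T)) => [|e _]; last by rewrite /Ge /= card_ord.
  by rewrite prod_nat_const card_ord.
apply: (@leq_trans (g * (2 * (T %/ g) * (2 * (T %/ g) * T ^ l)))).
  rewrite leq_mul2l; apply/orP; right.
  by apply: leq_mul; [apply: cF|rewrite leq_mul2r cF orbT].
have gTg : (g * (T %/ g) <= T)%N by rewrite mulnC leq_trunc_div.
have -> : (g * (2 * (T %/ g) * (2 * (T %/ g) * T ^ l)) =
  (g * (T %/ g)) * (4 * T ^ l * (T %/ g)))%N by lia.
rewrite /= expnS; have := leq_mul gTg (leqnn (4 * T ^ l * (T %/ g))).
by move/leq_trans; apply; lia.
Qed.

(** The gcd bounding a fibre is replaced by the sum of all common divisors of the two coordinates.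
    They are at most [T], since the second coordinate is positive and at most [T]. Exchanging the
    summations leaves a harmonic sum. *)
Lemma card_parallel_le :
  (#|[set p : {ffun 'I_L -> 'I_T} * {ffun 'I_L -> 'I_T} |
      parallel p.1 p.2]%SET| <= 4 * i.+1 * T ^ L)%N.
Proof.
have -> : #|[set p : {ffun 'I_L -> 'I_T} * {ffun 'I_L -> 'I_T} |
      parallel p.1 p.2]%SET| = (\sum_a #|[set a' | parallel a a']%SET|)%N.
  rewrite -sum1dep_card; rewrite -(pair_big_dep predT parallel (fun _ _ => 1%N)) /=.
  by apply: eq_bigr => a _; rewrite sum1dep_card.
apply: (@leq_trans (\sum_(a : {ffun 'I_L -> 'I_T}) \sum_(1 <= g < T.+1)
   g * ((g %| kvec a ord0) && (g %| kvec a (lift ord0 ord0))))).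
  apply: leq_sum => a _; apply: leq_trans (card_parallel_fiber a) _.
  set g := gcdn _ _.
  have gT : (0 < g <= T)%N.
    rewrite gcdn_gt0 kvec1_gt0 orbT /=.
    rewrite (leq_trans (dvdn_leq (kvec1_gt0 a) (dvdn_gcdr _ _))) //.
    by rewrite (leq_trans (kvec_le _ _)) // addn0.
  rewrite (bigD1_seq g) /= ?iota_uniq ?mem_index_iota ?ltnS //.
  by rewrite dvdn_gcdl dvdn_gcdr muln1 leq_addr.
rewrite exchange_big /=.
apply: (@leq_trans (\sum_(1 <= g < T.+1) 4 * T ^ L.-1 * (T %/ g))).
  rewrite !big_nat; apply: leq_sum => g gT.
  rewrite -big_distrr /= (leq_trans _ (card_dvd_coords gT)) //.
  rewrite leq_mul2l -sum1dep_card [leqRHS]big_mkcond /=; apply/orP; right.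
  by apply: leq_sum => a _; case: ifP.
rewrite -big_distrr /=; apply: leq_trans (leq_mul (leqnn _) (sum_divn_le i T)) _.
by rewrite [T ^ L]expnS; lia.
Qed.

End ParallelPairs.

(** * Reduction of the cone vectors modulo q *)

Lemma natrF_inj (q a b : nat) : prime q -> (a < q)%N -> (b < q)%N ->
  (a%:R == b%:R :> 'F_q) = (a == b).
Proof.
move=> pq aq bq; apply/eqP/eqP => [|->] // /(congr1 val) /=.
by rewrite !val_Fp_nat // !modn_small.
Qed.

Definition kvecF (q l i K : nat) (a : {ffun 'I_l.+2 -> 'I_(2 ^ i)}) : 'rV['F_q]_l.+2 :=
  \row_e (kvec K a e)%:R.

(** Coordinates are at most (K + 1) 2^i, so both products in a 2 by 2 minor lie below q; a minor
    that is nonzero over the integers stays nonzero mod q. *)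
Lemma row_free_kvecF (q l i K : nat) (a a' : {ffun 'I_l.+2 -> 'I_(2 ^ i)}) :
  prime q -> ((K.+1 * 2 ^ i) ^ 2 < q)%N -> ~~ parallel K a a' ->
  row_free (col_mx (kvecF q K a) (kvecF q K a')).
Proof.
move=> pq Kq /forallPn[e /forallPn[e' ne]].
have kle (b : {ffun 'I_l.+2 -> 'I_(2 ^ i)}) f : (kvec K b f <= K.+1 * 2 ^ i)%N.
  apply: leq_trans (kvec_le K b f) _.
  by rewrite mulSn leq_add2l; case: (f == ord0); rewrite ?mul1n.
have kkq (b b' : {ffun 'I_l.+2 -> 'I_(2 ^ i)}) f f' :
    (kvec K b f * kvec K b' f' < q)%N.
  by apply: leq_ltn_trans Kq; rewrite -mulnn; apply: leq_mul; exact: kle.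
have minor0 : (kvec K a e)%:R * (kvec K a' e')%:R
    != (kvec K a e')%:R * (kvec K a' e)%:R :> 'F_q.
  by rewrite -!natrM natrF_inj.
suff inj (y : 'rV['F_q]_(1 + 1)) : y *m col_mx (kvecF q K a) (kvecF q K a') = 0 -> y = 0.
  rewrite -kermx_eq0; apply/eqP/row_matrixP => f; rewrite row0; apply: inj.
  by apply/sub_kermxP; rewrite row_sub.
rewrite -[y]hsubmxK mul_row_col [lsubmx y]mx11_scalar [rsubmx y]mx11_scalar.
move: (lsubmx y 0 0) (rsubmx y 0 0) => al be; rewrite !mul_scalar_mx => /rowP yk.
have E1 := yk e; have E2 := yk e'; rewrite !mxE in E1 E2.
have al0 : al = 0.
  apply/eqP; have : al * ((kvec K a e)%:R * (kvec K a' e')%:R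
      - (kvec K a e')%:R * (kvec K a' e)%:R) = 0 :> 'F_q.
    rewrite mulrBr !mulrA; move/eqP: E1; rewrite addr_eq0 => /eqP ->.
    by move/eqP: E2; rewrite addr_eq0 => /eqP ->; rewrite !mulNr mulrAC subrr.
  by move/eqP; rewrite mulf_eq0 subr_eq0 (negPf minor0) orbF.
have be0 : be = 0.
  apply/eqP; move: E1 E2; rewrite al0 !mul0r !add0r => /eqP + /eqP.
  rewrite !mulf_eq0; case: (be == 0) => //= /eqP k0 /eqP k0'.
  by move: minor0; rewrite k0 k0' !mulr0 eqxx.
by rewrite al0 be0 raddf0 row_mx0.
Qed.

Lemma card_avoid_kvec_le (q l i K m s : nat)
    (S : {ffun 'I_l.+2 -> 'I_(2 ^ i)} -> {set 'rV['F_q]_m}) :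
  (0 < K)%N -> prime q -> ((K.+1 * 2 ^ i) ^ 2 < q)%N -> (forall a, #|S a| = s) ->
  (#|[set B : 'M['F_q]_(l.+2, m) | [forall a, kvecF q K a *m B \notin S a]]%SET|
     * ((2 ^ i) ^ l.+2 * s)
   <= 4 * i.+1 * q ^ m * q ^ (l.+2 * m))%N.
Proof.
move=> K0 pq Kq Ss.
have kk0 (a : {ffun 'I_l.+2 -> 'I_(2 ^ i)}) : kvecF q K a != 0.
  apply/eqP => /rowP/(_ ord0); rewrite !mxE => /eqP.
  have kle : (kvec K a ord0 <= K.+1 * 2 ^ i)%N.
    by have := kvec_le K a ord0; rewrite eqxx mul1n mulSn.
  have k0 : (0 < kvec K a ord0)%N by rewrite (leq_trans _ (kvec0_ge K0 a)) ?expn_gt0.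
  have kq : (kvec K a ord0 < q)%N.
    by apply: leq_ltn_trans Kq; rewrite (leq_trans kle) // -mulnn leq_pmulr // (leq_trans k0).
  rewrite -[X in _ == X]/(0%:R) natrF_inj ?prime_gt0 // => /eqP k00.
  by rewrite k00 in k0.
have := card_avoid_le kk0 (fun a a' => @row_free_kvecF q l i K a a' pq Kq) Ss.
rewrite card_Fp // card_ffun !card_ord => H.
have T0 : (0 < (2 ^ i) ^ l.+2)%N by rewrite !expn_gt0.
rewrite -(leq_pmul2r T0); have {}H := leq_trans H (leq_mul (card_parallel_le l i K0) (leqnn _)).
set X := ((2 ^ i) ^ _)%N in H *; set b := #|_| in H *.
by apply: leq_trans (leq_trans H _); [apply: eq_leq; ring|apply: eq_leq; ring].
Qed.

(** * Solutions attached to a nearly diagonal matrix *)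

Lemma ler_norm_sum_const (R : numDomainType) (m : nat) (f : 'I_m -> R) (b : R) :
  (forall i, `|f i| <= b) -> `|\sum_i f i| <= m%:R * b.
Proof.
move=> fb; rewrite (le_trans (ler_norm_sum _ _ _)) //.
rewrite (le_trans (ler_sum _ (fun i _ => fb i))) //.
by rewrite sumr_const card_ord mulr_natl.
Qed.

Lemma rowBE (R : zmodType) (m : nat) (u v : 'rV[R]_m) i :
  (u - v) 0 i = u 0 i - v 0 i.
Proof. by rewrite !mxE. Qed.

Lemma mulmx_norm_le (R : realDomainType) (m k : nat) (A : 'M[R]_(m, k)) :
  exists2 C : R, 0 <= C & forall (u : 'rV[R]_m) b, (forall a, `|u 0 a| <= b) ->
    forall i, `|(u *m A) 0 i| <= C * b.
Proof.
exists (\sum_a \sum_i `|A a i|).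
  by apply: sumr_ge0 => a _; apply: sumr_ge0 => i _; exact: normr_ge0.
move=> u b ub i; rewrite mxE (le_trans (ler_norm_sum _ _ _)) // mulr_suml.
apply: ler_sum => a _; rewrite normrM mulrC ler_pM //.
by rewrite (bigD1 i) //= lerDl sumr_ge0.
Qed.

Lemma ler_norm_exprB (R : realDomainType) (d : nat) (x y b : R) :
  `|x| <= b -> `|y| <= b -> `|x ^+ d - y ^+ d| <= d%:R * b ^+ d.-1 * `|x - y|.
Proof.
case: d => [|d] xb yb; first by rewrite !expr0 subrr normr0 !mul0r.
rewrite subrXX normrM mulrC ler_wpM2r //.
apply: ler_norm_sum_const => i; rewrite normrM !normrX /=.
have -> : b ^+ d = b ^+ (d - i) * b ^+ i by rewrite -exprD subnK // -ltnS.
by apply: ler_pM; rewrite ?exprn_ge0 // lerXn2r // ?nnegrE // (le_trans _ xb).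
Qed.

(** Only the summand x^(d-1) of the factorization is kept. This steepness of x_1^d lets the value of
    F determine x_1. *)
Lemma exprB_ge (R : realDomainType) (d : nat) (x y t : R) : (0 < d)%N ->
  0 <= t -> t <= y -> y <= x -> t ^+ d.-1 * (x - y) <= x ^+ d - y ^+ d.
Proof.
case: d => [//|d] _ t0 ty yx; rewrite subrXX mulrC ler_wpM2l ?subr_ge0 //.
have y0 := le_trans t0 ty; have x0 := le_trans y0 yx.
rewrite (bigD1 ord0) //= subn0 expr0 mulr1 -[leLHS]addr0 lerD //.
  by rewrite lerXn2r ?nnegrE // (le_trans ty).
by apply: sumr_ge0 => i _; rewrite mulr_ge0 // exprn_ge0.
Qed.

(** A discrete intermediate value theorem; the size of the jump is controlled separately by a
    Lipschitz bound. *)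
Lemma exists_crossing (R : realDomainType) (f : nat -> R) (c : R) (N : nat) :
  f 0%N <= c -> c < f N -> exists i, [/\ (i < N)%N, f i <= c & c < f i.+1].
Proof.
elim: N => [|N IH] f0 fN; first by move: (le_lt_trans f0 fN); rewrite ltxx.
have [fc|cf] := leP (f N) c; first by exists N.
by have [i [iN ? ?]] := IH f0 cf; exists i; split => //; exact: ltnW.
Qed.

Lemma intr_norm_lt1 (R : numDomainType) (z : int) : `|z%:~R : R| < 1 -> z = 0.
Proof. by rewrite -intr_norm ltrz1; lia. Qed.

Lemma natr_dist_lt1 (R : numDomainType) (x y : nat) :
  `|x%:R - y%:R : R| < 1 -> x = y.
Proof. by rewrite !pmulrn -intrB => /intr_norm_lt1; lia. Qed.

Section Points.
Variables (R : realType) (n r l : nat).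
Variables (iota : 'I_r.+1 -> 'I_n) (phi : 'I_l.+2 -> 'I_n).
Hypotheses (iotaI : injective iota) (phiI : injective phi).
Hypothesis phi_iota : forall e a, phi e != iota a.

(* [A] and [Bm] consist of the rows of a square matrix with indices in [phi] and
   in [iota]; row 0 of [A] belongs to x_(p+1), row 0 of [Bm] to x_1. *)
Definition pos (A : 'M[R]_(l.+2, n)) (Bm : 'M[R]_(r.+1, n)) k w : 'rV[R]_n :=
  k *m A + w *m Bm.

Definition near_diag (e N1 N2 : R) (A : 'M[R]_(l.+2, n)) (Bm : 'M[R]_(r.+1, n)) :=
  (forall j i, `|A j i - N1 *+ (phi j == i)| <= e * N1) /\
  (forall a i, `|Bm a i - N2 *+ (iota a == i)| <= e * N2).

Definition thin (v : 'rV[R]_n) : 'rV[R]_r := \row_a v 0 (iota (lift ord0 a)).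

(** The coordinates have size O(T), and the thin ones stay bounded independently of T. The lower
    order terms of F are controlled on such sets. *)
Definition region (K2 Z T : R) (v : 'rV[R]_n) :=
  (forall i, `|v 0 i| <= K2 * T) /\ (forall a, `|thin v 0 a| <= Z).

Local Notation dim := (l.+2 + r.+1)%:R.

Section Fixed.
Variables (e N1 N2 : R) (A : 'M[R]_(l.+2, n)) (Bm : 'M[R]_(r.+1, n)).
Hypotheses (e0 : 0 < e) (N10 : 0 < N1) (N20 : 0 < N2).
Hypothesis nd : near_diag e N1 N2 A Bm.
Hypothesis e2 : e * dim <= 1 / 2.

Lemma pos_err (k : 'rV[R]_l.+2) (w : 'rV[R]_r.+1) kb wb i :
  (forall j, `|k 0 j| * N1 <= kb) -> (forall a, `|w 0 a| * N2 <= wb) ->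
  `|pos A Bm k w 0 i - (\sum_j k 0 j * N1 *+ (phi j == i)
                        + \sum_a w 0 a * N2 *+ (iota a == i))|
    <= e * (l.+2%:R * kb + r.+1%:R * wb).
Proof.
move=> kkb wwb; rewrite /pos !mxE opprD addrACA -!sumrB mulrDr.
rewrite (le_trans (ler_normD _ _)) // lerD // mulrCA.
  apply: ler_norm_sum_const => j; rewrite -mulrnAr -mulrBr normrM mulrC.
  rewrite (le_trans (ler_wpM2r _ (nd.1 j i))) // -mulrA [N1 * _]mulrC.
  by rewrite ler_wpM2l // ltW.
apply: ler_norm_sum_const => j; rewrite -mulrnAr -mulrBr normrM mulrC.
rewrite (le_trans (ler_wpM2r _ (nd.2 j i))) // -mulrA [N2 * _]mulrC.
by rewrite ler_wpM2l // ltW.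
Qed.

Lemma sum_iota (f : 'I_r.+1 -> R) a : \sum_b f b *+ (iota b == iota a) = f a.
Proof.
rewrite (bigD1 a) //= eqxx mulr1n big1 ?addr0 // => b ba.
by rewrite (inj_eq iotaI) (negPf ba).
Qed.

Lemma sum_phi (f : 'I_l.+2 -> R) j : \sum_b f b *+ (phi b == phi j) = f j.
Proof.
rewrite (bigD1 j) //= eqxx mulr1n big1 ?addr0 // => b ba.
by rewrite (inj_eq phiI) (negPf ba).
Qed.

Lemma sum_phi_iota (f : 'I_l.+2 -> R) a : \sum_b f b *+ (phi b == iota a) = 0.
Proof. by rewrite big1 // => b _; rewrite (negPf (phi_iota b a)). Qed.

Lemma sum_iota_notin (f : 'I_r.+1 -> R) i : (forall a, iota a != i) ->
  \sum_b f b *+ (iota b == i) = 0.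
Proof. by move=> ni; rewrite big1 // => b _; rewrite (negPf (ni b)). Qed.

(** Diagonal dominance: at the index where [w] is largest, with value [W] after scaling, the
    off-diagonal error is at most [(kb + W) / 2] because [e * dim <= 1 / 2], so [W] can be
    absorbed. *)
Lemma pos_iota_bound (k : 'rV[R]_l.+2) (w : 'rV[R]_r.+1) kb sb :
  (forall j, `|k 0 j| * N1 <= kb) ->
  (forall a, `|pos A Bm k w 0 (iota a)| <= sb) ->
  forall a, `|w 0 a| * N2 <= 2 * sb + kb.
Proof.
move=> kkb psb.
pose am := [arg max_(a > ord0) `|w 0 a|]%O.
have wm a : `|w 0 a| <= `|w 0 am|.
  by rewrite /am; case: arg_maxP => // b _ /(_ a); exact.
pose W := `|w 0 am| * N2.
have wW a : `|w 0 a| * N2 <= W by rewrite ler_pM2r.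
have kb0 : 0 <= kb by rewrite (le_trans _ (kkb ord0)) // mulr_ge0 // ltW.
have W0 : 0 <= W by rewrite mulr_ge0 // ltW.
have := pos_err (iota am) kkb wW.
rewrite sum_phi_iota add0r (sum_iota (fun a => w 0 a * N2)) => err.
have le2 : e * (l.+2%:R * kb + r.+1%:R * W) <= (kb + W) / 2.
  apply: (@le_trans _ _ (e * (dim * (kb + W)))).
    rewrite ler_pM2l //; have -> : dim = l.+2%:R + r.+1%:R :> R by rewrite -natrD.
    have : 0 <= (l.+2%:R : R) by []; have : 0 <= (r.+1%:R : R) by [].
    move: (l.+2%:R : R) (r.+1%:R : R) => x y x0 y0.
    by have := mulr_ge0 x0 kb0; have := mulr_ge0 y0 W0; nra.
  by rewrite mulrA; have := ler_wpM2r (addr_ge0 kb0 W0) e2; lra.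
have : W <= sb + (kb + W) / 2.
  have -> : W = `|w 0 am * N2| by rewrite normrM (gtr0_norm N20).
  move: (psb am) err; set p := pos _ _ _ _ _ _; set x := w 0 am * N2 => psb' err.
  have : `|x| <= `|p| + `|p - x|.
    by rewrite -[x in leLHS](subKr p) (le_trans (ler_normB _ _)).
  have Wx : W = `|x| by rewrite /x normrM (gtr0_norm N20).
  rewrite -Wx; lra.
by move=> HW a; have := wW a; lra.
Qed.

Definition Wmx : 'M[R]_r.+1 := \matrix_(a, b) Bm a (iota b).

Lemma pos0E w a : pos A Bm 0 w 0 (iota a) = (w *m Wmx) 0 a.
Proof.
by rewrite /pos mul0mx add0r !mxE; apply: eq_bigr => b _; rewrite mxE.
Qed.

Lemma Wmx_unit : Wmx \in unitmx.
Proof.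
rewrite -row_free_unit -kermx_eq0; apply/eqP/row_matrixP => f; rewrite row0.
suff inj (y : 'rV[R]_r.+1) : y *m Wmx = 0 -> y = 0.
  by apply: inj; apply/sub_kermxP; rewrite row_sub.
move=> y0; have : forall a, `|pos A Bm 0 y 0 (iota a)| <= 0.
  by move=> a; rewrite pos0E y0 mxE normr0.
move/pos_iota_bound => /(_ 0); rewrite mulr0 addr0 => yb.
apply/rowP => a; rewrite mxE; apply/eqP; rewrite -normr_le0.
by rewrite -(pmulr_lle0 _ N20) yb // => j; rewrite mxE normr0 mul0r.
Qed.

Lemma pos_solve k (s : 'rV[R]_r.+1) :
  exists w, forall a, pos A Bm k w 0 (iota a) = s 0 a.
Proof.
pose s' : 'rV[R]_r.+1 := \row_a (s 0 a - (k *m A) 0 (iota a)).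
exists (s' *m invmx Wmx) => a; rewrite /pos mxE.
have -> : (s' *m invmx Wmx *m Bm) 0 (iota a) = (s' *m invmx Wmx *m Wmx) 0 a.
  by rewrite [LHS]mxE [RHS]mxE; apply: eq_bigr => b _; rewrite [Wmx _ _]mxE.
by rewrite mulmxKV ?Wmx_unit // [s' _ _]mxE addrC subrK.
Qed.

Lemma posB k w w' : pos A Bm k w - pos A Bm k w' = pos A Bm 0 (w - w').
Proof. by rewrite /pos mul0mx add0r mulmxBl opprD addrACA subrr add0r. Qed.

Lemma pos_diff_w k w w' (dl : R) :
  (forall a, `|pos A Bm k w 0 (iota a) - pos A Bm k w' 0 (iota a)| <= dl) ->
  forall a, `|w 0 a - w' 0 a| * N2 <= 2 * dl.
Proof.
move=> H a; have := @pos_iota_bound 0 (w - w') 0 dl.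
rewrite addr0 => /(_ _ _ a); rewrite rowBE; apply => [j|b].
  by rewrite mxE normr0 mul0r.
by have := H b; rewrite -(posB k) rowBE.
Qed.

Lemma pos_diff_free k w w' (dl : R) i : (forall a, iota a != i) ->
  (forall a, `|pos A Bm k w 0 (iota a) - pos A Bm k w' 0 (iota a)| <= dl) ->
  `|pos A Bm k w 0 i - pos A Bm k w' 0 i| <= 2 * (e * dim) * dl.
Proof.
move=> ni H; have wb := pos_diff_w H.
have wb' a : `|(w - w') 0 a| * N2 <= 2 * dl by rewrite rowBE.
have k0 (j : 'I_l.+2) : `|(0 : 'rV[R]_l.+2) 0 j| * N1 <= 0.
  by rewrite mxE normr0 mul0r.
have := pos_err i k0 wb'; rewrite -(posB k).
rewrite (sum_iota_notin (fun a => (w - w') 0 a * N2) ni).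
rewrite big1 => [|j _]; last by rewrite mxE mul0r mul0rn.
have dl0 : 0 <= dl by rewrite (le_trans _ (H ord0)).
rewrite rowBE !addr0 subr0 mulr0 add0r => /le_trans; apply.
rewrite [leRHS](_ : _ = e * (dim * (2 * dl))); last by ring.
by rewrite ler_pM2l // ler_wpM2r ?mulr_ge0 // ler_nat leq_addl.
Qed.

Lemma pos_round (k : 'rV[R]_l.+2) (w w' : 'rV[R]_r.+1) b i : (forall a, `|w 0 a - w' 0 a| <= b) ->
  `|pos A Bm k w 0 i - pos A Bm k w' 0 i| <= r.+1%:R * (2 * N2 * b).
Proof.
move=> wb; rewrite -rowBE posB /pos mul0mx add0r mxE.
apply: ler_norm_sum_const => a; rewrite rowBE normrM mulrC ler_pM //.
  have e1 : e <= 1 / 2.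
    apply: le_trans e2; rewrite ler_pMr // ler1n addn_gt0 //.
have := ler_wpM2r (ltW N20) e1; have := nd.2 a i.
have : `|N2 *+ (iota a == i)| <= N2.
  by case: eqP => _; rewrite ?mulr1n ?mulr0n ?normr0 ?gtr0_norm // ltW.
move: (Bm a i) (N2 *+ _) => x y yN xy eN.
have : `|x| <= e * N2 + N2.
  by rewrite -[x in leLHS](subrK y) (le_trans (ler_normD _ _)) // lerD.
by have := N20; lra.
Qed.

Variables (F : 'rV[R]_n -> R) (d c : nat) (K f0 T LG Z : R) (k : 'rV[R]_l.+2).
Hypotheses (d0 : (0 < d)%N) (KE : K = 4 * c%:R + 5).
Hypotheses (T1 : 1 <= T) (fT : `|f0| < T) (ZT : Z <= T) (LG0 : 0 <= LG).
Hypothesis k0 : K * T <= k 0 ord0 * N1 <= (K + 1) * T.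
Hypothesis kj : forall j, j != ord0 -> 0 <= k 0 j * N1 <= T.
Hypothesis eK : e * dim * (9 * (K + 2)) <= 1.
Hypothesis HL : forall v v' (dl : R),
  region (4 * (K + 2)) Z T v -> region (4 * (K + 2)) Z T v' ->
  (forall i, i != iota ord0 -> `|v 0 i - v' 0 i| <= dl) ->
  `|(F v - v 0 (iota ord0) ^+ d) - (F v' - v' 0 (iota ord0) ^+ d)|
    <= LG * T ^+ d.-1 * dl.
Hypothesis HG : forall v, region (4 * (K + 2)) Z T v ->
  (forall i, i != iota ord0 -> i != phi ord0 -> `|v 0 i| <= 2 * T) ->
  `|F v - v 0 (iota ord0) ^+ d + v 0 (phi ord0) ^+ d| <= c%:R * (2 * T) ^+ d.

Local Notation p := (pos A Bm k).

Lemma K_ge5 : 5 <= K.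
Proof. by rewrite KE lerDr mulr_ge0. Qed.

(** Bounds on the [iota] coordinates bound [w], and then [eK] makes every off-diagonal error at most
    [T]. Hence the free coordinates follow [k]: only the one of x_(p+1) is large, and it is known up
    to [T]. *)
Lemma pos_region w :
  (forall a, `|p w 0 (iota a)| <= 4 * (K + 2) * T) ->
  (forall a, `|thin (p w) 0 a| <= Z) ->
  [/\ region (4 * (K + 2)) Z T (p w),
      forall i, i != iota ord0 -> i != phi ord0 -> `|p w 0 i| <= 2 * T,
      `|p w 0 (phi ord0) - k 0 ord0 * N1| <= T &
      forall a, `|w 0 a| * N2 <= 9 * (K + 2) * T].
Proof.
move=> piota peta; have K5 := K_ge5.
have KT : 5 * T <= K * T by rewrite ler_pM2r // (lt_le_trans _ T1).
have kb j : `|k 0 j| * N1 <= (K + 1) * T.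
  rewrite -[N1](gtr0_norm N10) -normrM.
  have [->|/kj] := eqVneq j ord0.
    by rewrite ger0_norm; case/andP: k0 => ? ?; have := T1; lra.
  by move=> /andP[? ?]; rewrite ger0_norm //; have := T1; lra.
have wb := pos_iota_bound kb piota.
(* The constant comes from 2 * 4 (K + 2) + (K + 1) <= 9 (K + 2). *)
have wb' a : `|w 0 a| * N2 <= 9 * (K + 2) * T by have := wb a; have := T1; lra.
have kb' j : `|k 0 j| * N1 <= 9 * (K + 2) * T by have := kb j; have := T1; lra.
have err i : `|p w 0 i - (\sum_j k 0 j * N1 *+ (phi j == i)
                        + \sum_a w 0 a * N2 *+ (iota a == i))| <= T.
  apply: le_trans (pos_err i kb' wb') _.
  rewrite -mulrDl -(natrD _ l.+2 r.+1) !mulrA -[leRHS]mul1r.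
  by rewrite ler_wpM2r ?(le_trans ler01) // -!mulrA mulrA.
have perr j : `|p w 0 (phi j) - k 0 j * N1| <= T.
  have := err (phi j); rewrite (sum_phi (fun j => k 0 j * N1)).
  rewrite (sum_iota_notin (fun a => w 0 a * N2)) ?addr0 // => a.
  by rewrite eq_sym.
have pphi j : j != ord0 -> `|p w 0 (phi j)| <= 2 * T.
  move=> /kj /andP[? ?]; have := perr j; rewrite ler_distl ler_norml; lra.
have pother i : i != iota ord0 -> i != phi ord0 -> `|p w 0 i| <= 2 * T.
  move=> i0 i1; have [a /eqP ai|ni] := pickP (fun a => iota a == i).
    have [b ab|a0] := unliftP ord0 a; last by rewrite -ai a0 eqxx in i0.
    by have := peta b; rewrite mxE -ab ai; have := T1; have := ZT; lra.
  have [j /eqP ji|nj] := pickP (fun j => phi j == i).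
    by rewrite -ji pphi //; apply: contraNneq i1 => <-; rewrite ji.
  have := err i; rewrite !big1 => [|a _|j _]; rewrite ?ni ?nj //.
  by rewrite addr0 subr0; have := T1; lra.
split => //; split => // i.
have [->|i0] := eqVneq i (iota ord0); first exact: piota.
have [->|i1] := eqVneq i (phi ord0).
  have := perr ord0; rewrite ler_distl ler_norml => /andP[? ?].
  by case/andP: k0 => ? ?; have := T1; lra.
by have := pother i i0 i1; have := T1; lra.
Qed.

(** The value K = 4 c + 5 is made for this. With u = 2 T, the bounds read x_1 <= (c + 1) u and
    x_(p+1) >= 2 (c + 1) u, so x_(p+1)^d is at least twice ((c + 1) u)^d and beats x_1^d together
    with the c u^d of the other terms; the remaining u^d exceeds |f0|. *)
Lemma F_low v : region (4 * (K + 2)) Z T v ->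
  (forall i, i != iota ord0 -> i != phi ord0 -> `|v 0 i| <= 2 * T) ->
  `|v 0 (phi ord0) - k 0 ord0 * N1| <= T ->
  0 <= v 0 (iota ord0) <= (K - 1) / 2 * T -> F v < f0.
Proof.
move=> vreg vT vphi /andP[x0 xT]; have := HG vreg vT; have K5 := K_ge5.
move: vphi; rewrite ler_distl => /andP[yT _].
set x := v 0 (iota ord0) in x0 xT *; set y := v 0 (phi ord0) in yT *.
have /andP[kT _] := k0; have T0 : 0 < T by exact: lt_le_trans T1.
set u := 2 * T; have u0 : 0 < u by rewrite mulr_gt0.
have xu : x <= (c%:R + 1) * u by rewrite /u; move: xT; rewrite KE; lra.
have yu : 2 * ((c%:R + 1) * u) <= y.
  by rewrite /u; move: kT yT; rewrite KE; lra.
have c1 : 1 <= c%:R + 1 :> R by rewrite lerDr.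
have cu0 : 0 <= (c%:R + 1) * u by rewrite mulr_ge0 ?ltW // (lt_le_trans _ c1).
have xd : x ^+ d <= ((c%:R + 1) * u) ^+ d by rewrite lerXn2r // nnegrE.
have yd : 2 ^+ d * ((c%:R + 1) * u) ^+ d <= y ^+ d.
  have y0 : 0 <= y by apply: le_trans yu; rewrite mulr_ge0.
  by rewrite -exprMn lerXn2r ?nnegrE // mulr_ge0.
have d2 : 2 <= 2 ^+ d :> R by rewrite ler_eXnr // ler1n.
have ud : u <= u ^+ d.
  by rewrite ler_eXnr //; have := T1; rewrite /u; lra.
have cd : (c%:R + 1) * u ^+ d <= ((c%:R + 1) * u) ^+ d.
  by rewrite (exprMn _ (c%:R + 1)) ler_wpM2r ?exprn_ge0 ?(ltW u0) // ler_eXnr.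
have cdp : 0 <= ((c%:R + 1) * u) ^+ d by rewrite exprn_ge0.
have := ler_wpM2r cdp d2.
move: cd cdp xd yd ud; move: (((c%:R + 1) * u) ^+ d) (u ^+ d) (x ^+ d) (y ^+ d).
move=> C U X Y; rewrite /u => cd cdp xd yd ud CC; rewrite ler_norml => /andP[_].
by move: fT; rewrite ltr_norml => /andP[fT' _]; lra.
Qed.

(** Here x_(p+1) <= (K + 2) T is at most half of x_1, so x_1^d wins by at least ((K + 2) T)^d >= (c
    + 1) u^d, where u = 2 T. *)
Lemma F_high v : region (4 * (K + 2)) Z T v ->
  (forall i, i != iota ord0 -> i != phi ord0 -> `|v 0 i| <= 2 * T) ->
  `|v 0 (phi ord0) - k 0 ord0 * N1| <= T ->
  2 * (K + 2) * T <= v 0 (iota ord0) -> f0 < F v.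
Proof.
move=> vreg vT vphi xT; have := HG vreg vT; have K5 := K_ge5.
move: vphi; rewrite ler_distl => /andP[yT yT'].
set x := v 0 (iota ord0) in xT *; set y := v 0 (phi ord0) in yT yT' *.
have /andP[kT kT'] := k0; have T0 : 0 < T by exact: lt_le_trans T1.
have y0 : 0 <= y by have := ler_wpM2r (ltW T0) K5; lra.
set u := 2 * T; have u0 : 0 < u by rewrite mulr_gt0.
have yu : y <= (K + 2) * T by lra.
have c1 : 1 <= c%:R + 1 :> R by rewrite lerDr.
have cu0 : 0 <= (c%:R + 1) * u by rewrite mulr_ge0 ?ltW // (lt_le_trans _ c1).
have Ku : (c%:R + 1) * u <= (K + 2) * T.
  have cT : 0 <= c%:R * T by rewrite mulr_ge0 // ltW.
  by rewrite KE /u; lra.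
have Ku0 := le_trans cu0 Ku.
have yd : y ^+ d <= ((K + 2) * T) ^+ d by rewrite lerXn2r // nnegrE.
have xd : 2 ^+ d * ((K + 2) * T) ^+ d <= x ^+ d.
  have x0 : 0 <= x by apply: le_trans xT; rewrite -mulrA mulr_ge0.
  by rewrite -exprMn mulrA lerXn2r // nnegrE // -mulrA mulr_ge0.
have d2 : 2 <= 2 ^+ d :> R by rewrite ler_eXnr // ler1n.
have ud : u <= u ^+ d.
  by rewrite ler_eXnr //; have := T1; rewrite /u; lra.
have cd : (c%:R + 1) * u ^+ d <= ((K + 2) * T) ^+ d.
  apply: (@le_trans _ _ (((c%:R + 1) * u) ^+ d)); last by rewrite lerXn2r // nnegrE.
  by rewrite (exprMn _ (c%:R + 1)) ler_wpM2r ?exprn_ge0 ?(ltW u0) // ler_eXnr.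
have cdp : 0 <= ((K + 2) * T) ^+ d by rewrite exprn_ge0.
have := ler_wpM2r cdp d2.
move: cd cdp xd yd ud; move: (((K + 2) * T) ^+ d) (u ^+ d) (x ^+ d) (y ^+ d).
move=> C U X Y; rewrite /u => cd cdp xd yd ud CC; rewrite ler_norml => /andP[+ _].
by move: fT; rewrite ltr_norml => /andP[_ fT']; lra.
Qed.

Definition lipF : R := LG + d%:R * (4 * (K + 2)) ^+ d.-1.

Lemma F_lip v v' (dl : R) :
  region (4 * (K + 2)) Z T v -> region (4 * (K + 2)) Z T v' ->
  (forall i, `|v 0 i - v' 0 i| <= dl) ->
  `|F v - F v'| <= lipF * T ^+ d.-1 * dl.
Proof.
move=> vr vr' vv; have := HL vr vr' (fun i _ => vv i).
have := ler_norm_exprB d (vr.1 (iota ord0)) (vr'.1 (iota ord0)).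
have KT0 : 0 <= d%:R * (4 * (K + 2) * T) ^+ d.-1.
  rewrite mulr_ge0 // exprn_ge0 // mulr_ge0 ?(le_trans ler01) //.
  by have := K_ge5; lra.
move=> /le_trans /(_ (ler_wpM2l KT0 (vv (iota ord0)))).
rewrite exprMn /lipF; set X := _ ^+ d; set Y := _ ^+ d.
move=> XY FXY; rewrite (_ : F v - F v' = (F v - X - (F v' - Y)) + (X - Y)); last by ring.
rewrite (le_trans (ler_normD _ _)) //; lra.
Qed.

Variables (g2 ig2 : 'M[R]_r) (xi : 'rV[R]_r) (Gm Gi : R).
Hypotheses (g2K : g2 *m ig2 = 1%:M) (g2V : ig2 *m g2 = 1%:M) (Gm0 : 0 <= Gm) (Gi0 : 0 <= Gi).
Hypothesis Hgm : forall (u : 'rV[R]_r) b, (forall a, `|u 0 a| <= b) ->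
  forall i, `|(u *m g2) 0 i| <= Gm * b.
Hypothesis Hgi : forall (u : 'rV[R]_r) b, (forall a, `|u 0 a| <= b) ->
  forall i, `|(u *m ig2) 0 i| <= Gi * b.
Hypothesis HZ : forall u : 'rV[R]_r,
  (forall i, `|(u *m g2) 0 i - xi 0 i| <= 1) -> forall a, `|u 0 a| <= Z.

Variables (t0 tm : R) (t : 'I_r -> R).
Hypotheses (t00 : 0 < t0) (tt : forall i, t i <= tm) (tm1 : tm <= 1) (tm0 : 0 <= tm).
Hypothesis eLG : LG * (2 * (e * dim)) <= 1 / 2.
Hypothesis tsmall : 2 * (4 * t0 + (4 * LG + 1) * (Gi * (2 * tm))) < N2.

(** The lower bound [T] on x_1 keeps x_1^d steep, which is needed for uniqueness; the upper bounds
    keep the point inside [region]. *)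
Definition solution w :=
  [/\ forall a, `|p w 0 (iota a)| <= 4 * (K + 2) * T, T <= p w 0 (iota ord0),
      `|F (p w) - f0| < t0
    & forall i, `|(thin (p w) *m g2) 0 i - xi 0 i| < t i].

Lemma thinB u v a : thin u 0 a - thin v 0 a = (u - v) 0 (iota (lift ord0 a)).
Proof. by rewrite rowBE !mxE. Qed.

Lemma solution_thin w : solution w -> forall a, `|thin (p w) 0 a| <= Z.
Proof.
move=> [_ _ _ H]; apply: HZ => i; apply/ltW/(lt_le_trans (H i)).
exact: le_trans (tt i) tm1.
Qed.

Lemma solution_region w : solution w -> region (4 * (K + 2)) Z T (p w).
Proof.
by move=> sw; have [pb _ _ _] := sw; have [] := pos_region pb (solution_thin sw).
Qed.

Lemma iota_cases (a : 'I_r.+1) : a = ord0 \/ exists b, a = lift ord0 b.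
Proof. by have [b ->|->] := unliftP ord0 a; [right; exists b|left]. Qed.

(** Uniqueness within a coset of the integer lattice. The thin parts of two solutions differ by
    O(tm). By steepness, T^(d-1) times the difference [D] of their x_1 is bounded by the variation
    of F and of its remaining terms; the share of that variation due to [D] itself is at most half
    of the left side by [eLG], and [tsmall] makes the resulting bound on [w] smaller than 1. *)
Lemma solution_close w w' : solution w -> solution w' ->
  forall a, `|w 0 a - w' 0 a| < 1.
Proof.
move=> sw sw'.
wlog le : w w' sw sw' / p w' 0 (iota ord0) <= p w 0 (iota ord0).
  move=> H a; have [le|/ltW le] := leP (p w' 0 (iota ord0)) (p w 0 (iota ord0)).
    exact: H.
  by rewrite distrC; exact: H.
have [_ _ Fw tw] := sw; have [_ wT' Fw' tw'] := sw'.
set D := p w 0 (iota ord0) - p w' 0 (iota ord0).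
have D0 : 0 <= D by rewrite subr_ge0.
set m := Gi * (2 * tm); have m0 : 0 <= m by rewrite !mulr_ge0.
have thin_close a : `|thin (p w) 0 a - thin (p w') 0 a| <= m.
  have -> : thin (p w) 0 a - thin (p w') 0 a =
      ((thin (p w) *m g2 - thin (p w') *m g2) *m ig2) 0 a.
    by rewrite -mulmxBl -mulmxA g2K mulmx1 rowBE.
  apply: Hgi => i; rewrite rowBE.
  have := tw i; have := tw' i; have := tt i; rewrite !ltr_norml ler_norml; lra.
have diff a : `|p w 0 (iota a) - p w' 0 (iota a)| <= D + m.
  have [->|[b ->]] := iota_cases a; first by rewrite ger0_norm // lerDl.
  by rewrite -rowBE -thinB (le_trans (thin_close b)) // lerDr.
have ed0 : 0 <= 2 * (e * dim) by rewrite !mulr_ge0 // ltW.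
have ed1 : 2 * (e * dim) <= 1 by have := e2; lra.
have rest i : i != iota ord0 ->
    `|p w 0 i - p w' 0 i| <= 2 * m + 2 * (e * dim) * D.
  move=> i0; have eD : 0 <= 2 * (e * dim) * D by rewrite mulr_ge0.
  have [a /eqP ai|ni] := pickP (fun a => iota a == i).
    have [a0|[b ab]] := iota_cases a; first by rewrite -ai a0 eqxx in i0.
    by rewrite -ai ab -rowBE -thinB (le_trans (thin_close b)) //; lra.
  have /le_trans := pos_diff_free (i := i) (fun a => negbT (ni a)) diff; apply.
  have := ler_wpM2r m0 ed1; lra.
have := HL (solution_region sw) (solution_region sw') rest.
have T0 : 0 <= T by rewrite (le_trans ler01).
have := exprB_ge d0 T0 wT' le; rewrite -/D.
set X := p w _ _ ^+ d; set Y := p w' _ _ ^+ d; set Td := T ^+ d.-1 => XY GG.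
have Td1 : 1 <= Td by rewrite exprn_ege1.
have key : Td * D <= 2 * t0 + LG * Td * (2 * m + 2 * (e * dim) * D).
  move: XY Fw Fw' GG; rewrite !ltr_norml ler_norml; lra.
have half : LG * Td * (2 * (e * dim) * D) <= Td * D / 2.
  have TD : 0 <= Td * D by rewrite mulr_ge0 // (le_trans ler01).
  by have := ler_wpM2r TD eLG; lra.
have tT : t0 <= Td * t0 by rewrite ler_peMl // ltW.
have Db : D <= 4 * t0 + 4 * LG * m.
  rewrite -(ler_pM2l (lt_le_trans ltr01 Td1)); lra.
move=> a; have := pos_diff_w diff a; rewrite -(ltr_pM2r N20) mul1r => /le_lt_trans; apply.
by move: tsmall; rewrite -/m; lra.
Qed.

Variables (rho : R) (q M : nat) (mm : 'I_r.+1 -> nat).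
Local Notation dl := (r.+1%:R * (2 * N2 * (q%:R)^-1)).
Hypotheses (q0 : (0 < q)%N) (rho0 : 0 < rho) (rhoT : rho <= T).
Hypotheses (Hm0 : lipF * T ^+ d.-1 * (rho * (mm ord0)%:R) <= t0 / 2).
Hypothesis (Hmi : forall i, rho * (mm (lift ord0 i))%:R <= t i / 2).
Hypothesis (HmT : rho * (mm ord0)%:R <= T).
Hypotheses (Hd0 : lipF * T ^+ d.-1 * dl < t0 / 2) (HdT : dl <= T).
Hypothesis (Hdi : forall i, Gm * dl < t i / 2).
Hypotheses (Hr1 : 2 * dl < rho) (Hr2 : Gm * (2 * dl) < rho).

Local Notation X0 := ((K - 1) / 2 * T).

Lemma wsol_ex (x : R) (u : 'rV[R]_r) :
  exists w, p w 0 (iota ord0) = x /\ thin (p w) = u.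
Proof.
have [w pw] := pos_solve k (\row_a if unlift ord0 a is Some b then u 0 b else x).
exists w; rewrite pw mxE unlift_none; split=> //.
by apply/rowP => a; rewrite mxE pw mxE liftK.
Qed.

Lemma p_bound w : `|p w 0 (iota ord0)| <= 4 * (K + 2) * T ->
  (forall a, `|thin (p w) 0 a| <= Z) ->
  forall a, `|p w 0 (iota a)| <= 4 * (K + 2) * T.
Proof.
move=> H0 H a; have [-> //|[b ->]] := iota_cases a.
have := H b; rewrite mxE => /le_trans; apply; apply: (le_trans ZT).
by rewrite ler_peMl ?(le_trans ler01) //; have := K_ge5; lra.
Qed.

Lemma F_lip_x w w' : thin (p w) = thin (p w') -> (forall a, `|thin (p w) 0 a| <= Z) ->
  `|p w 0 (iota ord0)| <= 4 * (K + 2) * T ->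
  `|p w' 0 (iota ord0)| <= 4 * (K + 2) * T ->
  `|F (p w) - F (p w')| <=
    lipF * T ^+ d.-1 * `|p w 0 (iota ord0) - p w' 0 (iota ord0)|.
Proof.
move=> ee ew pw pw'; have ew' := ew; rewrite ee in ew'.
have [vr _ _ _] := pos_region (p_bound pw ew) ew.
have [vr' _ _ _] := pos_region (p_bound pw' ew') ew'.
set D := `|p w 0 _ - _|; apply: F_lip => // i.
have diff a : `|p w 0 (iota a) - p w' 0 (iota a)| <= D.
  have [->|[b ->]] := iota_cases a; first exact: lexx.
  by rewrite -rowBE -thinB ee subrr normr0 /D normr_ge0.
have [a /eqP <-|ni] := pickP (fun a => iota a == i); first exact: diff.
have /le_trans := pos_diff_free (i := i) (fun a => negbT (ni a)) diff; apply.
by rewrite -[leRHS]mul1r ler_wpM2r ?/D ?normr_ge0 //; have := e2; lra.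
Qed.

(** With the thin part fixed, x_1 moves up in steps [rho] from (K - 1) / 2 T, where F is below f0,
    to beyond 2 (K + 2) T, where it is above. From a crossing step [j] on, [mm ord0] consecutive
    steps change F by at most t0 / 2. *)
Lemma crossing_ex (u : 'rV[R]_r) : (forall a, `|u 0 a| <= Z) ->
  exists j : nat, forall (al : nat), (al < mm ord0)%N ->
    forall w, p w 0 (iota ord0) = X0 + rho * (j + al)%:R -> thin (p w) = u ->
    [/\ T <= p w 0 (iota ord0) - T, p w 0 (iota ord0) <= 3 * (K + 2) * T
      & `|F (p w) - f0| <= t0 / 2].
Proof.
move=> uZ; have [wf wfP] := choice (fun x => wsol_ex x u).
have T0 : 0 < T by exact: lt_le_trans T1.
have K5 := K_ge5; have KT := ler_wpM2r (ltW T0) K5.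
pose f j := F (p (wf (X0 + rho * j%:R))).
pose y := (2 * (K + 2) * T - X0) / rho.
have y0 : 0 <= y by apply: divr_ge0; [lra|exact: ltW].
pose N := (Num.truncn y).+1.
have /andP[Ny yN] := truncn_itv y0; rewrite -/N in yN.
have XN : X0 + rho * N%:R <= 2 * (K + 2) * T + rho.
  have : (Num.truncn y)%:R * rho <= 2 * (K + 2) * T - X0 by rewrite -ler_pdivlMr.
  by rewrite /N -natr1; lra.
have XN' : 2 * (K + 2) * T <= X0 + rho * N%:R.
  have : 2 * (K + 2) * T - X0 <= N%:R * rho by rewrite -ler_pdivrMr // ltW.
  by lra.
have bound x : 0 <= x -> x <= 4 * (K + 2) * T ->
    `|p (wf x) 0 (iota ord0)| <= 4 * (K + 2) * T.
  by move=> x0 xb; rewrite (wfP x).1 ger0_norm.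
have etab x a : `|thin (p (wf x)) 0 a| <= Z by rewrite (wfP x).2.
have X00 : 0 <= X0 by lra.
have f00 : f 0%N <= f0.
  rewrite /f mulr0 addr0; have X0b : X0 <= 4 * (K + 2) * T by lra.
  have [vr vT vp _] := pos_region (p_bound (bound _ X00 X0b) (etab _)) (etab _).
  by apply/ltW/F_low => //; rewrite (wfP X0).1; lra.
have fN : f0 < f N.
  have XN0 : 0 <= X0 + rho * N%:R by lra.
  have XNb : X0 + rho * N%:R <= 4 * (K + 2) * T by move: rhoT; lra.
  have [vr vT vp _] := pos_region (p_bound (bound _ XN0 XNb) (etab _)) (etab _).
  by apply: F_high => //; rewrite (wfP _).1.
have [j [jN fj fj1]] := exists_crossing f00 fN.
exists j => al alm w pw ew; rewrite pw.
have nb x B : 0 <= x -> x <= B -> `|x| <= B :> R by move=> ?; rewrite ger0_norm.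
have XX (i i' : nat) : (i <= i')%N -> X0 + rho * i%:R <= X0 + rho * i'%:R.
  by move=> ii; rewrite lerD2l ler_pM2l // ler_nat.
have jb : X0 + rho * (j + al)%:R <= 2 * (K + 2) * T + rho + rho * (mm ord0)%:R.
  rewrite natrD mulrDr addrA lerD // ?(le_trans (XX _ _ (ltnW jN))) //.
  by rewrite ler_pM2l // ler_nat ltnW.
have xb : 0 <= X0 + rho * (j + al)%:R <= 3 * (K + 2) * T.
  have := XX 0%N (j + al)%N isT; rewrite mulr0 addr0.
  by move: rhoT HmT; lra.
case/andP: (xb) => x0 x3; split => //.
  by have := XX 0%N (j + al)%N isT; rewrite mulr0 addr0; lra.
have x4 : X0 + rho * (j + al)%:R <= 4 * (K + 2) * T by lra.
have lip (i : nat) : (i <= (j + al).+1)%N -> (i <= N)%N ->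
    `|F (p w) - f i| <= lipF * T ^+ d.-1 * (rho * `|(j + al)%:R - i%:R|).
  move=> _ iN; have i0 : 0 <= X0 + rho * i%:R.
    by have := XX 0%N i isT; rewrite mulr0 addr0; lra.
  have ib : X0 + rho * i%:R <= 4 * (K + 2) * T.
    by have := XX i N iN; move: rhoT; lra.
  have := @F_lip_x w (wf (X0 + rho * i%:R)); rewrite ew (wfP _).2 (wfP _).1 pw.
  move=> /(_ erefl uZ (nb _ _ x0 x4) (nb _ _ i0 ib)) /le_trans; apply.
  by rewrite opprD addrACA subrr add0r -mulrBr normrM (gtr0_norm rho0).
have L0 : 0 <= lipF * T ^+ d.-1.
  rewrite mulr_ge0 ?exprn_ge0 ?(ltW T0) // addr_ge0 // mulr_ge0 // exprn_ge0 //.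
  lra.
have h0 := lip j (leqW (leq_addr _ _)) (ltnW jN).
have {h0} : `|F (p w) - f j| <= lipF * T ^+ d.-1 * (rho * al%:R).
  by move: h0; rewrite natrD addrAC subrr add0r normr_nat.
have f1 : `|f j.+1 - f j| <= lipF * T ^+ d.-1 * rho.
  have XN4 : X0 + rho * N%:R <= 4 * (K + 2) * T by move: rhoT; lra.
  have i0 i : 0 <= X0 + rho * i%:R.
    by have := XX 0%N i isT; rewrite mulr0 addr0; lra.
  have := @F_lip_x (wf (X0 + rho * j.+1%:R)) (wf (X0 + rho * j%:R)).
  rewrite !(wfP _).2 !(wfP _).1 => /(_ erefl uZ
    (nb _ _ (i0 _) (le_trans (XX _ _ jN) XN4))
    (nb _ _ (i0 _) (le_trans (XX _ _ (ltnW jN)) XN4))) /le_trans; apply.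
  by rewrite opprD addrACA subrr add0r -mulrBr -natr1 addrAC subrr add0r mulr1 gtr0_norm.
have : lipF * T ^+ d.-1 * (rho * al.+1%:R) <= t0 / 2.
  by apply: le_trans Hm0; rewrite ler_wpM2l // ler_pM2l // ler_nat.
rewrite -natr1; move: f1 fj fj1; rewrite !ler_norml; lra.
Qed.

(** A box with sides [mm a], cut out of a cube of side [M] since finite functions have a single
    codomain. *)
Definition cap (al : {ffun 'I_r.+1 -> 'I_M}) := [forall a, (al a < mm a)%N].

Definition fracv (cc : 'rV[int]_r.+1) : 'rV[R]_r.+1 := \row_a ((cc 0 a)%:~R / q%:R).

(** Each point of the box prescribes x_1 and the thin part along grids of step [rho]; solving for
    [w] and rounding down to multiples of 1 / q gives the numerators [C al]. The step exceeds twice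
    the rounding errors, so distinct indices give distinct numerators, and [solution_close] keeps
    these distinct mod q. *)
Lemma many_solutions : exists C : {ffun 'I_r.+1 -> 'I_M} -> 'rV[int]_r.+1,
  (forall al, cap al -> solution (fracv (C al))) /\
  (forall al be, cap al -> cap be ->
     (forall a, exists z : int, C al 0 a - C be 0 a = z * q) -> al = be).
Proof.
have T0 : 0 < T by exact: lt_le_trans T1.
have qR0 : 0 < q%:R :> R by rewrite ltr0n.
pose th (al : {ffun 'I_r.+1 -> 'I_M}) : 'rV[R]_r :=
  \row_i (xi 0 i + rho * (al (lift ord0 i))%:R).
have etaZ al : cap al -> forall a, `|(th al *m ig2) 0 a| <= Z.
  move=> /forallP cal; apply: HZ => i; rewrite -mulmxA g2V mulmx1 mxE addrAC subrr add0r.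
  have r0 : 0 <= rho * (al (lift ord0 i))%:R by rewrite mulr_ge0 // ltW.
  rewrite ger0_norm //; apply: (@le_trans _ _ (rho * (mm (lift ord0 i))%:R)).
    by rewrite ler_pM2l // ler_nat ltnW.
  have : 0 <= rho * (mm (lift ord0 i))%:R by rewrite mulr_ge0 // ltW.
  by move: (Hmi i) (tt i) tm1; lra.
pose crossP (u : 'rV[R]_r) (j : nat) := (forall a, `|u 0 a| <= Z) ->
    forall (al : nat), (al < mm ord0)%N ->
    forall w, p w 0 (iota ord0) = X0 + rho * (j + al)%:R -> thin (p w) = u ->
    [/\ T <= p w 0 (iota ord0) - T, p w 0 (iota ord0) <= 3 * (K + 2) * T
      & `|F (p w) - f0| <= t0 / 2].
have cross_ex u : exists j, crossP u j.
  have [uZ|nuZ] := pselect (forall a, `|u 0 a| <= Z); last by exists 0%N => /nuZ.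
  have [j jP] := crossing_ex uZ; exists j => _; exact: jP.
(* The crossing step is a function of the thin part alone, so indices with the same thin part share
   it and [al ord0] can be read off from x_1. *)
have [jf jfP] := choice cross_ex.
pose et al := th al *m ig2.
pose xx al := X0 + rho * (jf (et al) + al ord0)%:R.
have [wf wfP] := choice (fun al => wsol_ex (xx al) (et al)).
pose C al : 'rV[int]_r.+1 := \row_a Num.floor (wf al 0 a * q%:R).
have Cw al a : `|fracv (C al) 0 a - wf al 0 a| <= q%:R^-1.
  rewrite !mxE -{2}[wf al 0 a](mulfK (lt0r_neq0 qR0)) -mulrBl normrM.
  rewrite [`|q%:R^-1|]ger0_norm ?invr_ge0 // -[leRHS]mul1r ler_wpM2r ?invr_ge0 //.
  have := floor_itv (wf al 0 a * q%:R); rewrite intrD => /andP[? ?].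
  by rewrite ler_norml; lra.
have pC al i : `|p (fracv (C al)) 0 i - p (wf al) 0 i| <= dl.
  by apply: pos_round => a; exact: Cw.
have dl0 : 0 <= dl by rewrite !mulr_ge0 ?invr_ge0 // ltW.
have thC al : cap al -> forall i, `|(thin (p (fracv (C al))) *m g2) 0 i - th al 0 i| <= Gm * dl.
  move=> cal i; have -> : th al = thin (p (wf al)) *m g2.
    by rewrite (wfP al).2 -mulmxA g2V mulmx1.
  by rewrite -rowBE -mulmxBl; apply: Hgm => a; rewrite rowBE thinB rowBE.
have Csol al : cap al -> solution (fracv (C al)).
  move=> cal.
  have cal0 : (al ord0 < mm ord0)%N by move/forallP: cal; exact.
  have [xl xh Fw] := jfP _ (etaZ al cal) _ cal0 _ (wfP al).1 (wfP al).2.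
  have xd := pC al (iota ord0); have K5 := ler_wpM2r (ltW T0) K_ge5.
  have etC a : `|thin (p (fracv (C al))) 0 a| <= Z.
    apply: HZ => i; have := thC al cal i; rewrite [th al 0 i]mxE.
    have := Hmi i; have := Hdi i; have := tt i; have := tm1.
    have : rho * (al (lift ord0 i))%:R <= rho * (mm (lift ord0 i))%:R.
      by rewrite ler_pM2l // ler_nat ltnW //; move/forallP: cal; exact.
    have : 0 <= rho * (al (lift ord0 i))%:R by rewrite mulr_ge0 // ltW.
    by rewrite !ler_norml; lra.
  have xb : `|p (fracv (C al)) 0 (iota ord0)| <= 4 * (K + 2) * T.
    by move: xd HdT; rewrite !ler_norml; lra.
  have pb := p_bound xb etC.
  split => //.
  - by move: xd HdT; rewrite ler_norml; lra.
  - have xb' : `|p (wf al) 0 (iota ord0)| <= 4 * (K + 2) * T.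
      by rewrite ler_norml; lra.
    have etw a : `|thin (p (wf al)) 0 a| <= Z by rewrite (wfP al).2; exact: etaZ.
    have [vr _ _ _] := pos_region pb etC.
    have [vr' _ _ _] := pos_region (p_bound xb' etw) etw.
    have := F_lip vr vr' (pC al); move: Fw Hd0.
    by rewrite !ler_norml ltr_norml; lra.
  move=> i; have := thC al cal i; rewrite [th al 0 i]mxE.
  have := Hmi i; have := Hdi i.
  have : rho * (al (lift ord0 i))%:R <= rho * (mm (lift ord0 i))%:R.
    by rewrite ler_pM2l // ler_nat ltnW //; move/forallP: cal; exact.
  have : 0 <= rho * (al (lift ord0 i))%:R by rewrite mulr_ge0 // ltW.
  by rewrite ler_norml ltr_norml; lra.
exists C; split => // al be cal cbe CC.
(* Numerators congruent mod q give vectors [w] differing by integers, which are smaller than 1 in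
   absolute value. *)
have Ceq : C al = C be.
  apply/rowP => a; have [z zq] := CC a.
  have := solution_close (Csol al cal) (Csol be cbe) a.
  have fE cc : fracv cc 0 a = (cc 0 a)%:~R / q%:R by rewrite mxE.
  rewrite !fE -mulrBl -intrB zq intrM mulfK ?lt0r_neq0 // => /intr_norm_lt1 z0.
  by apply/eqP; rewrite -subr_eq0 zq z0 mul0r.
have pwf i : `|p (wf al) 0 i - p (wf be) 0 i| <= 2 * dl.
  have := pC al i; have := pC be i; rewrite Ceq !ler_norml; lra.
have small (x y : nat) : `|rho * x%:R - rho * y%:R| < rho -> x = y.
  rewrite -mulrBr normrM gtr0_norm // -[X in _ < X]mulr1 ltr_pM2l //.
  exact: natr_dist_lt1.
have lift_eq i : al (lift ord0 i) = be (lift ord0 i).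
  apply/val_inj/small; apply: le_lt_trans Hr2.
  have -> : rho * (al (lift ord0 i))%:R - rho * (be (lift ord0 i))%:R =
      ((thin (p (wf al)) - thin (p (wf be))) *m g2) 0 i.
    rewrite mulmxBl !(wfP _).2 /et -!mulmxA g2V !mulmx1 rowBE !mxE; lra.
  by apply: Hgm => a; rewrite rowBE thinB rowBE.
have eteq : et al = et be.
  by rewrite /et /th; congr (_ *m _); apply/rowP => i; rewrite !mxE lift_eq.
have eq0 : al ord0 = be ord0.
  apply/val_inj/small; apply: le_lt_trans Hr1.
  have := pwf (iota ord0); rewrite !(wfP _).1 /xx eteq !natrD.
  by rewrite !mulrDr !opprD addrACA subrr add0r addrACA subrr add0r.
by apply/ffunP => a; have [->|[b ->]] := iota_cases a.
Qed.

End Fixed.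
End Points.

(** * Estimates for the polynomial F_0 *)

Lemma poly_growth (R : realFieldType) (p : {poly R}) (e : nat) (k M : R) :
  (forall x, M < x -> `|p.[x]| <= k * `|x ^+ e|) -> (size p <= e.+1)%N.
Proof.
move=> pk; rewrite leqNgt; apply/negP => ep.
have [N sp eN] : exists2 N, size p = N.+2 & (e <= N)%N.
  by case: (size p) ep => [|[|N]] // eN; exists N.
pose C := \sum_(i < N.+1) `|p`_i|; pose lc := `|p`_N.+1|.
have lc0 : 0 < lc.
  rewrite normr_gt0; have : lead_coef p != 0 by rewrite lead_coef_eq0 -size_poly_eq0 sp.
  by rewrite /lead_coef sp.
have C0 : 0 <= C by apply: sumr_ge0.
have key x : M < x -> 1 <= x -> lc * x <= C + `|k|.
  move=> Mx x1; have x0 : 0 < x by exact: lt_le_trans x1.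
  have := pk x Mx; rewrite horner_coef sp big_ord_recr /=.
  have low : `|\sum_(i < N.+1) p`_i * x ^+ i| <= C * x ^+ N.
    rewrite (le_trans (ler_norm_sum _ _ _)) // mulr_suml; apply: ler_sum => i _.
    rewrite normrM ler_wpM2l // normrX (ger0_norm (ltW x0)).
    by rewrite ler_weXn2l // -ltnS.
  have hi : k * `|x ^+ e| <= `|k| * x ^+ N.
    rewrite normrX (ger0_norm (ltW x0)).
    apply: (@le_trans _ _ (`|k| * x ^+ e)).
      by rewrite ler_wpM2r ?ler_norm // exprn_ge0 // ltW.
    by rewrite ler_wpM2l // ler_weXn2l.
  set s := \sum_(i < N.+1) _ in low *; set h := p`_N.+1 * x ^+ N.+1 => sh.
  have : `|h| <= (C + `|k|) * x ^+ N.
    rewrite -[h](addKr s) (le_trans (ler_normD _ _)) // normrN mulrDl lerD //.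
    exact: le_trans hi.
  rewrite /h normrM normrX (ger0_norm (ltW x0)) exprS mulrA ler_pM2r //.
  by rewrite exprn_gt0.
pose x := `|M| + 1 + (C + `|k|) / lc.
have Q0 : 0 <= (C + `|k|) / lc by rewrite divr_ge0 ?addr_ge0 // ltW.
have Mx : M < x by rewrite /x; have := ler_norm M; lra.
have x1 : 1 <= x by rewrite /x; have := normr_ge0 M; lra.
have := key x Mx x1; rewrite /x mulrDr [lc * (_ / _)]mulrC divfK ?lt0r_neq0 //.
rewrite gerDr leNgt => /negP; apply; rewrite mulr_gt0 //.
Qed.

(** * Growth and Lipschitz exponents on the regions *)

Section Tame.
Variables (R : realType) (n r : nat) (iota : 'I_r.+1 -> 'I_n) (K2 Z : R).
Hypotheses (K20 : 0 <= K2) (Z0 : 0 <= Z).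
Local Notation reg := (region iota K2 Z).
Implicit Type f g : 'rV[R]_n -> R.

Definition tame_bounded (e : nat) f := exists2 C : R, 0 <= C &
  forall T v, 1 <= T -> reg T v -> `|f v| <= C * T ^+ e.

(* The coordinate [iota ord0] is allowed to vary freely, hence a function with
   this property does not depend on it. *)
Definition tame_lipschitz (e : nat) f := exists2 C : R, 0 <= C &
  forall T v v' (dl : R), 1 <= T -> reg T v -> reg T v' -> 0 <= dl ->
  (forall i, i != iota ord0 -> `|v 0 i - v' 0 i| <= dl) ->
  `|f v - f v'| <= C * T ^+ e * dl.

(** One exponent serves for both size and Lipschitz constant, since variation of a thin coordinate
    does not lower the degree in T. This suffices for P_1, whose degree in T is already at most d -
    1. *)
Definition tame e f := tame_bounded e f /\ tame_lipschitz e f.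

Lemma tame_lipschitzD e f g : tame_lipschitz e f -> tame_lipschitz e g ->
  tame_lipschitz e (fun v => f v + g v).
Proof.
move=> [C C0 fC] [D D0 gD]; exists (C + D); first exact: addr_ge0.
move=> T v v' dl T1 rv rv' dl0 vv; rewrite opprD addrACA (le_trans (ler_normD _ _)) //.
by rewrite !mulrDl lerD ?fC ?gD.
Qed.

Lemma tame_lipschitzN e f : tame_lipschitz e f -> tame_lipschitz e (fun v => - f v).
Proof.
move=> [C C0 fC]; exists C => // T v v' dl T1 rv rv' dl0 vv.
by rewrite -opprD normrN fC.
Qed.

Lemma tame_lipschitz0 e : tame_lipschitz e (fun=> 0).
Proof. by exists 0 => // *; rewrite subrr normr0 !mul0r. Qed.

Lemma tame_lipschitz_sum e (I : Type) (s : seq I) (P : pred I) (f : I -> 'rV[R]_n -> R) :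
  (forall i, P i -> tame_lipschitz e (f i)) ->
  tame_lipschitz e (fun v => \sum_(i <- s | P i) f i v).
Proof.
move=> fP; elim: s => [|i s IH].
  by under [X in tame_lipschitz _ X]eq_fun do rewrite big_nil; exact: tame_lipschitz0.
under [X in tame_lipschitz _ X]eq_fun do rewrite big_cons.
have [Pi|_] := boolP (P i); last exact: IH.
by apply: tame_lipschitzD => //; exact: fP.
Qed.

Lemma tame_boundedD e f g : tame_bounded e f -> tame_bounded e g ->
  tame_bounded e (fun v => f v + g v).
Proof.
move=> [C C0 fC] [D D0 gD]; exists (C + D); first exact: addr_ge0.
move=> T v T1 rv; rewrite (le_trans (ler_normD _ _)) //.
by rewrite mulrDl lerD ?fC ?gD.
Qed.

Lemma tameD e f g : tame e f -> tame e g -> tame e (fun v => f v + g v).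
Proof.
move=> [fb fl] [gb gl]; split; first exact: tame_boundedD.
exact: tame_lipschitzD.
Qed.

Lemma tame_cst (c : R) : tame 0 (fun=> c).
Proof.
split; last by exists 0 => // *; rewrite subrr normr0 !mul0r.
by exists `|c| => // T v T1 _; rewrite expr0 mulr1.
Qed.

Lemma tame_weaken e e' f : (e <= e')%N -> tame e f -> tame e' f.
Proof.
move=> ee [[C C0 fC] [D D0 fD]]; split.
  exists C => // T v T1 rv; rewrite (le_trans (fC _ _ T1 rv)) //.
  by rewrite ler_wpM2l // ler_weXn2l.
exists D => // T v v' dl T1 rv rv' dl0 vv.
rewrite (le_trans (fD _ _ _ _ T1 rv rv' dl0 vv)) // ler_wpM2r //.
by rewrite ler_wpM2l // ler_weXn2l.
Qed.

Lemma tameM e e' f g : tame e f -> tame e' g ->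
  tame (e + e') (fun v => f v * g v).
Proof.
move=> [[C C0 fC] [D D0 fD]] [[C' C'0 gC] [D' D'0 gD]]; split.
  exists (C * C'); first exact: mulr_ge0.
  move=> T v T1 rv; rewrite normrM exprD mulrACA.
  by apply: ler_pM => //; [exact: fC|exact: gC].
exists (C * D' + D * C'); first by rewrite addr_ge0 // mulr_ge0.
move=> T v v' dl T1 rv rv' dl0 vv.
have -> : f v * g v - f v' * g v' = f v * (g v - g v') + (f v - f v') * g v' by ring.
rewrite (le_trans (ler_normD _ _)) // !normrM.
rewrite [leRHS](_ : _ = C * T ^+ e * (D' * T ^+ e' * dl) + D * T ^+ e * dl * (C' * T ^+ e')).
  by apply: lerD; apply: ler_pM; rewrite ?fC ?gC ?fD ?gD.
by rewrite exprD; ring.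
Qed.

Lemma tameX e k f : tame e f -> tame (e * k) (fun v => f v ^+ k).
Proof.
move=> tf; elim: k => [|k IH]; first by rewrite muln0; exact: tame_cst.
rewrite mulnS; under [X in tame _ X]eq_fun do rewrite exprS.
exact: tameM.
Qed.

Lemma tame_prod k (e : 'I_k -> nat) (f : 'I_k -> 'rV[R]_n -> R) :
  (forall i, tame (e i) (f i)) ->
  tame (\sum_i e i) (fun v => \prod_i f i v).
Proof.
elim: k e f => [|k IH] e f tf.
  rewrite big_ord0; under [X in tame _ X]eq_fun do rewrite big_ord0.
  exact: tame_cst.
rewrite big_ord_recl; under [X in tame _ X]eq_fun do rewrite big_ord_recl.
by apply: tameM => //; apply: IH => i; exact: tf.
Qed.

Lemma tame_sum e (I : Type) (s : seq I) (P : pred I) (f : I -> 'rV[R]_n -> R) :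
  (forall i, P i -> tame e (f i)) ->
  tame e (fun v => \sum_(i <- s | P i) f i v).
Proof.
move=> fP; elim: s => [|i s IH].
  under [X in tame _ X]eq_fun do rewrite big_nil.
  by apply: (tame_weaken (leq0n e)); exact: tame_cst.
under [X in tame _ X]eq_fun do rewrite big_cons.
have [Pi|_] := boolP (P i); last exact: IH.
by apply: tameD => //; exact: fP.
Qed.

Lemma tame_coord i : i != iota ord0 -> tame 1 (fun v => v 0 i).
Proof.
move=> i0; split.
  by exists K2 => // T v T1 rv; rewrite expr1; exact: rv.1.
exists 1 => // T v v' dl T1 rv rv' dl0 vv; rewrite mul1r (le_trans (vv _ i0)) //.
by rewrite expr1 ler_peMl.
Qed.

Lemma tame_thin a : injective iota -> tame 0 (fun v => v 0 (iota (lift ord0 a))).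
Proof.
move=> iotaI; split.
  by exists Z => // T v T1 rv; rewrite expr0 mulr1; have := rv.2 a; rewrite mxE.
exists 1 => // T v v' dl T1 rv rv' dl0 vv; rewrite expr0 !mul1r vv //.
by rewrite (inj_eq iotaI).
Qed.

(** The d-th powers have size T^d but Lipschitz constant of order T^(d-1); for this reason the
    Lipschitz property is also treated apart from [tame]. *)
Lemma tame_lipschitz_coordX i d : i != iota ord0 ->
  tame_lipschitz d.-1 (fun v => v 0 i ^+ d).
Proof.
move=> i0; exists (d%:R * K2 ^+ d.-1); first by rewrite mulr_ge0 // exprn_ge0.
move=> T v v' dl T1 rv rv' dl0 vv.
rewrite (le_trans (ler_norm_exprB d (rv.1 i) (rv'.1 i))) //.
rewrite exprMn -!mulrA; do 2! rewrite ler_wpM2l ?exprn_ge0 //.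
by rewrite ler_wpM2l ?vv // exprn_ge0 // (le_trans ler01).
Qed.

End Tame.

(** * Degree of P_1 in the first half of its variables *)

Section P1Growth.
Variables (R : realType) (m : nat) (P : mpoly.mpoly (m + m) R) (e : nat).
Hypothesis HP : first_half_growth P e.

Definition half_degree (mo : mpoly.multinom (m + m)) : nat :=
  (\sum_(i < m) mpoly.fun_of_multinom mo (lshift m i))%N.

Definition monomial_value (mo : mpoly.multinom (m + m)) (y : 'rV[R]_(m + m)) : R :=
  mpoly.mcoeff mo P * \prod_i y 0 i ^+ mpoly.fun_of_multinom mo i.

Lemma pevalE y : peval P y = \sum_(mo <- mpoly.msupp P) monomial_value mo y.
Proof. by rewrite /peval mpoly.mevalE. Qed.

Lemma monomial_value_scale mo y1 y2 T :
  monomial_value mo (row_mx (T *: y1) y2)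
  = monomial_value mo (row_mx y1 y2) * T ^+ half_degree mo.
Proof.
rewrite /monomial_value -mulrA; congr (_ * _).
rewrite !big_split_ord /= mulrAC; congr (_ * _).
  rewrite /half_degree -prodrXr -big_split /=; apply: eq_bigr => i _.
  by rewrite !row_mxEl mxE exprMn mulrC.
by apply: eq_bigr => i _; rewrite !row_mxEr.
Qed.

(* The growth hypothesis does not mention coefficients: the monomials of
   too high degree in the first half cancel out as functions. *)
Lemma peval_low_degree y :
  peval P y = \sum_(mo <- mpoly.msupp P | (half_degree mo <= e)%N) monomial_value mo y.
Proof.
rewrite -[y]hsubmxK; move: (lsubmx y) (rsubmx y) => y1 y2.
set y' := row_mx y1 y2.
pose Q : {poly R} := \sum_(mo <- mpoly.msupp P) monomial_value mo y' *: 'X^(half_degree mo).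
have QE T : Q.[T] = peval P (row_mx (T *: y1) y2).
  rewrite pevalE /Q horner_sum; apply: eq_bigr => mo _.
  by rewrite hornerZ hornerXn monomial_value_scale.
have Qs : (size Q <= e.+1)%N.
  have /eqO_exP [k k0 kP] := HP y1 y2.
  have [M [Mr MP]] := kP.
  apply: (@poly_growth _ Q e k M) => x Mx.
  by rewrite QE; exact: MP.
pose H : {poly R} := \sum_(mo <- mpoly.msupp P | ~~ (half_degree mo <= e)%N)
  monomial_value mo y' *: 'X^(half_degree mo).
have H0 : H = 0.
  apply/polyP => j; rewrite coef0; have [je|ej] := leqP j e.
    rewrite coef_sum big1 // => mo; rewrite -ltnNge => emo.
    by rewrite coefZ coefXn; case: eqP => [jm|_]; [lia|rewrite mulr0].
  have : Q`_j = 0 by rewrite nth_default // (leq_trans Qs).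
  rewrite coef_sum (bigID (fun mo => (half_degree mo <= e)%N)) /= big1 => [|mo emo].
    by rewrite add0r coef_sum.
  by rewrite coefZ coefXn; case: eqP => [jm|_]; [lia|rewrite mulr0].
rewrite pevalE (bigID (fun mo => (half_degree mo <= e)%N)) /= -[RHS]addr0; congr (_ + _).
(* The monomials left out add up to the value at T = 1 of [H], the part of [Q] of degree above
   [e]. *)
transitivity H.[1]; last by rewrite H0 horner0.
rewrite /H horner_sum; apply: eq_bigr => mo _.
by rewrite hornerZ hornerXn expr1n mulr1.
Qed.

End P1Growth.

(** * Special and free coordinates *)

Section Coordinates.
Variables (R : realType) (p q m s : nat) (x1 : 'I_p).
Local Notation n := (dim_n p q m s).
Local Notation r := (dim_r m s).

Definition xindex (i : 'I_(p + q)) : 'I_n := lshift s (lshift (m + m) i).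

Lemma dim_n_split : (p + q + m + r = n)%N.
Proof. by rewrite /dim_n /dim_r; lia. Qed.

(** x_1, followed by the last r coordinates y_(m+1), ..., z_s, which are those read by M_0. *)
Definition special (a : 'I_r.+1) : 'I_n :=
  if unlift ord0 a is Some b then cast_ord dim_n_split (rshift (p + q + m) b)
  else xindex (lshift q x1).

Lemma special0 : special ord0 = xindex (lshift q x1).
Proof. by rewrite /special unlift_none. Qed.

Lemma special_lift b : special (lift ord0 b) = cast_ord dim_n_split (rshift (p + q + m) b).
Proof. by rewrite /special liftK. Qed.

Lemma special_inj : injective special.
Proof.
move=> a b; have [a' ->|->] := unliftP ord0 a; have [b' ->|->] := unliftP ord0 b => //.
- by rewrite !special_lift => /cast_ord_inj/rshift_inj ->.
- rewrite special0 special_lift => /(congr1 val) /=.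
  by have := ltn_ord x1; lia.
- rewrite special0 special_lift => /(congr1 val) /=.
  by have := ltn_ord x1; lia.
Qed.

Lemma thin_special (v : 'rV[R]_n) : thin special v = v *m M0 R p q m s.
Proof.
rewrite M0E; apply/rowP => b; rewrite mxE special_lift.
rewrite -[b in RHS](splitK (m := m)); case: splitP => j jb.
  rewrite [in RHS](_ : unsplit _ = lshift s j) // row_mxEl !mxE.
  by congr (v 0 _); apply/val_inj => /=; rewrite jb; lia.
rewrite [in RHS](_ : unsplit _ = rshift m j) // row_mxEr !mxE.
by congr (v 0 _); apply/val_inj => /=; rewrite jb; lia.
Qed.

Lemma free_indices (l : nat) (j : 'I_q) : (l.+2 + r.+1 <= n)%N ->
  exists phi : 'I_l.+2 -> 'I_n, [/\ injective phi,
    forall e a, phi e != special a & phi ord0 = xindex (rshift p j)].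
Proof.
move=> ln; set j0 := xindex (rshift p j).
have j0s : forall a, j0 != special a.
  move=> a; apply/eqP => /(congr1 val) /=.
  have [b ->|->] := unliftP ord0 a; rewrite ?special0 ?special_lift /=.
    by have := ltn_ord j; lia.
  by have := ltn_ord x1; lia.
pose Fr := [set i | i \notin codom special]%SET.
have j0F : j0 \in Fr.
  by rewrite inE; apply/negP => /codomP[a E]; have := j0s a; rewrite E eqxx.
have cF : (l.+2 <= #|Fr|)%N.
  have -> : #|Fr| = (n - r.+1)%N.
    have -> : Fr = ~: [set i in codom special]%SET by apply/setP => i; rewrite !inE.
    rewrite cardsCs finset.setCK card_ord cardsE; congr (_ - _)%N.
    by rewrite card_codom ?card_ord //; exact: special_inj.
  by rewrite leq_subRL ?(leq_trans _ ln) ?leq_addl // addnC.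
pose sq := j0 :: enum (Fr :\ j0)%SET.
have usq : uniq sq by rewrite /= enum_uniq mem_enum !inE eqxx.
have ssq : size sq = #|Fr| by rewrite /= -cardE [in RHS](cardsD1 j0) j0F.
have sqF i : i \in sq -> i \in Fr.
  by rewrite inE => /orP[/eqP-> //|]; rewrite mem_enum => /setD1P[].
exists (fun e => nth j0 sq e); split=> [e e'|e a|//].
  move/eqP; rewrite nth_uniq ?ssq ?(leq_trans (ltn_ord _)) // => /eqP.
  exact: val_inj.
have : nth j0 sq e \in Fr by rewrite sqF // mem_nth // ssq (leq_trans (ltn_ord _)).
by rewrite inE; apply: contraNneq => ->; exact: codom_f.
Qed.

End Coordinates.

Section F0Estimates.
Variables (R : realType) (p q m s d : nat) (x1 : 'I_p) (xq : 'I_q).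
Variables (P1 : mpoly.mpoly (m + m) R) (P2 : mpoly.mpoly s R) (d' : nat).
Hypotheses (dd' : (d' < d)%N) (HP1 : first_half_growth P1 d').
Local Notation n := (dim_n p q m s).
Local Notation r := (dim_r m s).
Local Notation iota := (@special p q m s x1).
Local Notation F := (@F0 R p q m s d P1 P2).

Lemma zpartE (v : 'rV[R]_n) k : zpart v 0 k = v 0 (iota (lift ord0 (rshift m k))).
Proof.
have /rowP/(_ (rshift m k)) := thin_special x1 v.
by rewrite M0E mxE => ->; rewrite row_mxEr.
Qed.

Lemma ypart_lastE (v : 'rV[R]_n) j :
  ypart v 0 (rshift m j) = v 0 (iota (lift ord0 (lshift s j))).
Proof.
have /rowP/(_ (lshift s j)) := thin_special x1 v.
by rewrite M0E mxE => ->; rewrite row_mxEl [in RHS]mxE.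
Qed.

Lemma ypart_firstE (v : 'rV[R]_n) j :
  ypart v 0 (lshift m j) = v 0 (lshift s (rshift (p + q) (lshift m j))).
Proof. by rewrite !mxE. Qed.

Lemma xpartE (v : 'rV[R]_n) i : xpart v 0 i = v 0 (xindex m s i).
Proof. by rewrite !mxE. Qed.

Lemma yfirst_neq j : lshift s (rshift (p + q) (lshift m j)) != iota ord0 :> 'I_n.
Proof.
rewrite special0; apply/eqP => /(congr1 val) /=.
by have := ltn_ord x1; lia.
Qed.

Variables (K2 Z : R).
Hypotheses (K20 : 0 <= K2) (Z0 : 0 <= Z).
Local Notation tame := (tame iota K2 Z).
Local Notation tame_lipschitz := (tame_lipschitz iota K2 Z).

Lemma tame_P2 : tame 0 (fun v => peval P2 (zpart v)).
Proof.
under [X in tame _ X]eq_fun do rewrite /peval mpoly.mevalE.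
apply: tame_sum => // mo _; apply: (tameM (e := 0) (e' := 0)) => //.
  exact: tame_cst.
rewrite -[X in tame X _](big1 (R := nat) (op := addn) (index_enum 'I_s) xpredT (fun=> 0%N)) //.
apply: (tame_prod (f := fun i v => zpart v 0 i ^+ mpoly.fun_of_multinom mo i)) => i.
apply: (tameX (e := 0)).
under [X in tame _ X]eq_fun do rewrite zpartE.
by apply: tame_thin => //; exact: special_inj.
Qed.

(** By [peval_low_degree] only monomials of degree at most d' in y_1, ..., y_m matter; y_(m+1), ...,
    y_(2m) are thin and contribute no power of T. *)
Lemma tame_P1 : tame d.-1 (fun v => peval P1 (ypart v)).
Proof.
under [X in tame _ X]eq_fun do rewrite (peval_low_degree HP1).
apply: tame_sum => // mo moe; apply: (tame_weaken (e := half_degree mo)).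
  by rewrite (leq_trans moe) // -ltnS (ltn_predK dd').
apply: (tameM (e := 0) (e' := half_degree mo)) => //; first exact: tame_cst.
pose e (i : 'I_(m + m)) : nat := (if fintype.split i is inl _ then 1 else 0)%N.
have -> : half_degree mo = (\sum_i e i * mpoly.fun_of_multinom mo i)%N.
  rewrite big_split_ord /= [X in (_ + X)%N]big1 ?addn0 => [|i _]; last first.
    by rewrite /e (unsplitK (inr i)).
  by apply: eq_bigr => i _; rewrite /e (unsplitK (inl i)) mul1n.
apply: (tame_prod (f := fun i v => ypart v 0 i ^+ mpoly.fun_of_multinom mo i)) => // i.
apply: tameX => //; rewrite /e; case: splitP => j ij.
  have -> : i = lshift m j by exact: val_inj.
  under [X in tame _ X]eq_fun do rewrite ypart_firstE.
  by apply: tame_coord => //; exact: yfirst_neq.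
have -> : i = rshift m j by exact: val_inj.
under [X in tame _ X]eq_fun do rewrite ypart_lastE.
by apply: tame_thin => //; exact: special_inj.
Qed.

Lemma xindex_inj : injective (@xindex p q m s).
Proof. by move=> i j /lshift_inj /lshift_inj. Qed.

Lemma F0_lipschitz : tame_lipschitz d.-1 (fun v => F v - v 0 (iota ord0) ^+ d).
Proof.
have FE v : F v - v 0 (iota ord0) ^+ d =
    \sum_(i < p | i != x1) v 0 (xindex m s (lshift q i)) ^+ d
    + - (\sum_(j < q) v 0 (xindex m s (rshift p j)) ^+ d)
    + peval P1 (ypart v) + peval P2 (zpart v).
  rewrite /F0 special0 (bigD1 x1) //= xpartE.
  rewrite (eq_bigr (fun i => v 0 (xindex m s (lshift q i)) ^+ d)); last first.
    by move=> i _; rewrite xpartE.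
  rewrite [\sum_(j < q) _](eq_bigr (fun j => v 0 (xindex m s (rshift p j)) ^+ d)); last first.
    by move=> i _; rewrite xpartE.
  ring.
under [X in tame_lipschitz _ X]eq_fun do rewrite FE.
apply: tame_lipschitzD; last first.
  by have [_] := tame_weaken (leq0n d.-1) tame_P2.
apply: tame_lipschitzD; last by have [_] := tame_P1.
apply: tame_lipschitzD.
  apply: tame_lipschitz_sum => i ix; apply: tame_lipschitz_coordX => //.
  by rewrite special0 (inj_eq xindex_inj) (inj_eq (@lshift_inj _ _)).
apply: tame_lipschitzN; apply: tame_lipschitz_sum => j _.
apply: tame_lipschitz_coordX => //.
by rewrite special0 (inj_eq xindex_inj) eq_sym eq_lrshift.
Qed.

(** In the factor p + q + 1, the sums of d-th powers account for p + q, and the last unit covers P_1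
    + P_2, which is O(T^(d-1)) and hence at most T^d for large T. *)
Lemma F0_growth : exists T0 : R, forall T v, T0 <= T -> region iota K2 Z T v ->
  (forall i, i != iota ord0 -> i != xindex m s (rshift p xq) -> `|v 0 i| <= 2 * T) ->
  `|F v - v 0 (iota ord0) ^+ d + v 0 (xindex m s (rshift p xq)) ^+ d|
    <= (p + q + 1)%N%:R * (2 * T) ^+ d.
Proof.
have [[C1 C10 P1b] _] := tame_P1; have [[C2 C20 P2b] _] := tame_P2.
exists (C1 + C2 + 1) => T v TT rv vT.
have T1 : 1 <= T by apply: le_trans TT; rewrite lerDr addr_ge0.
have {P1b} P1b := P1b T v T1 rv; have {P2b} P2b := P2b T v T1 rv.
have T0 : 0 < T by exact: lt_le_trans T1.
set Y := (2 * T) ^+ d.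
have Y0 : 0 <= Y by rewrite exprn_ge0 // mulr_ge0 // ltW.
have Pb : `|peval P1 (ypart v)| + `|peval P2 (zpart v)| <= Y.
  apply: (@le_trans _ _ ((C1 + C2) * T ^+ d.-1)).
    rewrite mulrDl lerD // (le_trans P2b) // expr0 mulr1 ler_peMr //.
    by rewrite exprn_ege1.
  apply: (@le_trans _ _ (T ^+ d)).
    rewrite -[in leRHS](ltn_predK dd') exprS ler_wpM2r ?exprn_ge0 ?(ltW T0) //.
    by apply: le_trans TT; rewrite lerDl.
  by rewrite /Y lerXn2r ?nnegrE ?mulr_ge0 ?(ltW T0) // ler_peMl ?(ltW T0) // ler1n.
have FE : F v - v 0 (iota ord0) ^+ d + v 0 (xindex m s (rshift p xq)) ^+ d =
    \sum_(i < p | i != x1) v 0 (xindex m s (lshift q i)) ^+ d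
    - (\sum_(j < q | j != xq) v 0 (xindex m s (rshift p j)) ^+ d)
    + (peval P1 (ypart v) + peval P2 (zpart v)).
  rewrite /F0 special0 (bigD1 x1) //= [\sum_(j < q) _](bigD1 xq) //= !xpartE.
  rewrite (eq_bigr (fun i => v 0 (xindex m s (lshift q i)) ^+ d)); last first.
    by move=> i _; rewrite xpartE.
  rewrite [\sum_(j < q | _) _](eq_bigr (fun j => v 0 (xindex m s (rshift p j)) ^+ d)); last first.
    by move=> i _; rewrite xpartE.
  ring.
have sumb (k : nat) (P : pred 'I_k) (f : 'I_k -> 'I_n) :
    (forall i, P i -> f i != iota ord0 /\ f i != xindex m s (rshift p xq)) ->
    `|\sum_(i < k | P i) v 0 (f i) ^+ d| <= k%:R * Y.
  move=> fP; rewrite big_mkcond /=; apply: ler_norm_sum_const => i.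
  case: ifP => [/fP[f1 f2]|_]; last by rewrite normr0.
  by rewrite normrX lerXn2r ?nnegrE ?mulr_ge0 ?(ltW T0) // vT.
rewrite FE !natrD !mulrDl mul1r (le_trans (ler_normD _ _)) // lerD //; last first.
  by rewrite (le_trans (ler_normD _ _)).
rewrite (le_trans (ler_normB _ _)) // lerD // sumb // => i ix; split.
- by rewrite special0 (inj_eq xindex_inj) (inj_eq (@lshift_inj _ _)).
- by rewrite (inj_eq xindex_inj) eq_lrshift.
- by rewrite special0 (inj_eq xindex_inj) eq_sym eq_lrshift.
- by rewrite (inj_eq xindex_inj) (inj_eq (@rshift_inj _ _)).
Qed.

End F0Estimates.

(** * Translates by unipotent matrices *)

Lemma trunc_ge_half (R : realType) (x : R) : 1 <= x -> x / 2 <= (Num.truncn x)%:R.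
Proof.
move=> x1; have /andP[_ xt] := truncn_itv (le_trans ler01 x1).
have t1 : (1 : R) <= (Num.truncn x)%:R.
  by rewrite ler1n truncn_gt0.
by move: xt; rewrite -natr1; lra.
Qed.

Lemma div_natr_le (R : realType) (x y : R) : 0 <= x -> 0 < y ->
  exists q0 : nat, forall q : nat, (q0 <= q)%N -> (0 < q)%N -> x / q%:R < y.
Proof.
move=> x0 y0; exists (Num.truncn (x / y)).+1 => q qq q0.
have /andP[_ xt] := truncn_itv (divr_ge0 x0 (ltW y0)).
rewrite ltr_pdivrMr ?ltr0n // mulrC -ltr_pdivrMr //.
by apply: lt_le_trans xt _; rewrite ler_nat.
Qed.

Lemma ler_sum5 (R : realDomainType) (a b c d e : R) :
  0 <= a -> 0 <= b -> 0 <= c -> 0 <= d -> 0 <= e ->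
  [/\ a <= a + b + c + d + e, b <= a + b + c + d + e, c <= a + b + c + d + e,
      d <= a + b + c + d + e & e <= a + b + c + d + e].
Proof. by move=> *; split; lra. Qed.

Lemma half_ltr (R : realFieldType) (x y z : R) :
  x < y / 2 -> 0 < y -> y <= z -> x < z /\ x <= z.
Proof. by move=> *; split; lra. Qed.

Lemma half_mulr (R : realFieldType) (a b x y : R) :
  x * (2 * a * b) <= y -> a * (b * x) <= y / 2.
Proof. by move=> *; lra. Qed.

Lemma twice_le (R : realFieldType) (x y z : R) : x < y / 2 -> y <= z -> 2 * x <= z.
Proof. by move=> *; lra. Qed.

Lemma small_sum (R : realFieldType) (g h x y z : R) : 0 < x -> x * (9 + 4 * g * h) = 1 ->
  y <= x -> 1 <= z -> 2 * (4 * y + g * (h * (2 * x))) < z.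
Proof. by move=> *; lra. Qed.

Lemma trunc_div_le (R : realType) (x y : R) : 0 <= x -> 0 < y ->
  (Num.truncn (x / y))%:R * y <= x.
Proof.
move=> x0 y0; have /andP[+ _] := truncn_itv (divr_ge0 x0 (ltW y0)).
by rewrite ler_pdivlMr.
Qed.

(** * Uniform constants for the families of solutions *)

Section Family.
Variables (R : realType) (n r l : nat).
Variables (iota : 'I_r.+1 -> 'I_n) (phi : 'I_l.+2 -> 'I_n).
Hypotheses (iotaI : injective iota) (phiI : injective phi).
Hypothesis phi_iota : forall e a, phi e != iota a.
Variables (F : 'rV[R]_n -> R) (d c : nat).
Hypothesis d0 : (0 < d)%N.
Hypothesis Flip : forall K2 Z, 0 <= K2 -> 0 <= Z ->
  tame_lipschitz iota K2 Z d.-1 (fun v => F v - v 0 (iota ord0) ^+ d).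
Hypothesis Fgrowth : forall K2 Z, 0 <= K2 -> 0 <= Z ->
  exists T0 : R, forall T v, T0 <= T -> region iota K2 Z T v ->
  (forall i, i != iota ord0 -> i != phi ord0 -> `|v 0 i| <= 2 * T) ->
  `|F v - v 0 (iota ord0) ^+ d + v 0 (phi ord0) ^+ d| <= c%:R * (2 * T) ^+ d.
Variables (f0 : R) (g2 : 'M[R]_r) (xi : 'rV[R]_r).
Hypothesis g2u : g2 \in unitmx.

Local Notation K := (4 * c%:R + 5 : R).
Local Notation dim := (l.+2 + r.+1)%:R.

Definition good (T t0 : R) (t : 'I_r -> R) (N2 : R) (A : 'M[R]_(l.+2, n))
    (Bm : 'M[R]_(r.+1, n)) k w :=
  [/\ `|F (pos A Bm k w) - f0| < t0,
      forall i, `|(thin iota (pos A Bm k w) *m g2) 0 i - xi 0 i| < t i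
    & forall a, `|w 0 a| * N2 <= 9 * (K + 2) * T].

(** The order of the quantifiers matters: [e], [del], [lip] precede the scales [N1], [N2], which
    come from the covering of SL_n(R), and q follows T and the thresholds. Divided by q^(r+1), the
    lower bound on the product of the [mm a] bounds below the proportion of classes mod q that lead
    to a solution. *)
Lemma solution_family :
  exists e del lip : R, [/\ 0 < e, e <= 1, 0 < del, del <= 1 & 0 < lip] /\
  forall N1 N2 : R, 1 <= N1 -> 1 <= N2 -> exists C1 T0 : R, 0 < C1 /\
  forall T, T0 <= T -> forall t0 (t : 'I_r -> R),
    0 < t0 <= del -> (forall i, 0 < t i <= del) ->
  exists q0 : nat, forall q, (q0 <= q)%N -> exists (M : nat) (mm : 'I_r.+1 -> nat),
  [/\ forall a, (mm a <= M)%N,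
      (q%:R / C1) ^+ r.+1 * (t0 * \prod_i t i) / (lip * T ^+ d.-1)
        <= (\prod_a mm a)%:R
    & forall A Bm (k : 'rV[R]_l.+2), near_diag iota phi e N1 N2 A Bm ->
      K * T <= k 0 ord0 * N1 <= (K + 1) * T ->
      (forall j, j != ord0 -> 0 <= k 0 j * N1 <= T) ->
      exists C : {ffun 'I_r.+1 -> 'I_M} -> 'rV[int]_r.+1,
        (forall al : {ffun 'I_r.+1 -> 'I_M}, cap mm al -> good T t0 t N2 A Bm k (fracv R q (C al))) /\
        (forall al be, cap mm al -> cap mm be ->
           (forall a, exists z : int, C al 0 a - C be 0 a = z * q) -> al = be)].
Proof.
have [Gm Gm0 Hgm] := mulmx_norm_le g2.
have [Gi Gi0 Hgi] := mulmx_norm_le (invmx g2).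
pose Z := Gi * (\sum_i `|xi 0 i| + 1).
have sx0 : 0 <= \sum_i `|xi 0 i| by apply: sumr_ge0.
have Z0 : 0 <= Z by rewrite mulr_ge0 // addr_ge0.
have HZ (u : 'rV[R]_r) :
    (forall i, `|(u *m g2) 0 i - xi 0 i| <= 1) -> forall a, `|u 0 a| <= Z.
  move=> ub a; rewrite -[u](mulmxK g2u); apply: Hgi => i.
  have := ub i; rewrite (bigD1 i) //=.
  have : 0 <= \sum_(j | j != i) `|xi 0 j| by apply: sumr_ge0.
  have := ler_normD ((u *m g2) 0 i - xi 0 i) (xi 0 i); rewrite subrK; lra.
have c0 : (0 : R) <= c%:R by [].
have K20 : 0 <= 4 * (K + 2) by lra.
have [LG LG0 HLG] := Flip K20 Z0; have [TG HTG] := Fgrowth K20 Z0.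
pose lipf : R := LG + d%:R * (4 * (K + 2)) ^+ d.-1.
have lipf1 : 1 <= lipf.
  have : 1 <= d%:R * (4 * (K + 2)) ^+ d.-1.
    by rewrite mulr_ege1 ?ler1n // exprn_ege1 //; lra.
  by rewrite /lipf; lra.
have lipf0 : 0 < lipf by exact: lt_le_trans lipf1.
have dim0 : (0 : R) < dim by rewrite ltr0n.
(* The three summands serve [eK], [eLG] and [e2], in this order. *)
pose D := 9 * (K + 2) + 4 * LG + 2.
have D1 : 1 <= D by rewrite /D; lra.
pose e := (dim * D)^-1.
have e0 : 0 < e by rewrite invr_gt0 mulr_gt0 // (lt_le_trans _ D1).
have eD : e * dim * D = 1.
  by rewrite /e -mulrA mulVf // mulf_neq0 ?lt0r_neq0 // (lt_le_trans _ D1).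
have ed0 : 0 < e * dim by rewrite mulr_gt0.
have e2 : e * dim <= 1 / 2.
  by have : e * dim * 2 <= e * dim * D by [rewrite ler_pM2l // /D; lra|]; rewrite eD; lra.
have eK : e * dim * (9 * (K + 2)) <= 1.
  by rewrite -[leRHS]eD ler_pM2l // /D; lra.
have eLG : LG * (2 * (e * dim)) <= 1 / 2.
  have : e * dim * (4 * LG) <= e * dim * D by rewrite ler_pM2l // /D; lra.
  by rewrite eD; lra.
have e1 : e <= 1.
  have : e * 1 <= e * dim by rewrite ler_pM2l // ler1n.
  by rewrite mulr1; lra.
(* With thresholds at most 1 / dn, the left side of [tsmall] is at most (8 + 4 (4 LG + 1) Gi) / dn <
   1 <= N2. *)
pose dn := 9 + 4 * (4 * LG + 1) * Gi.
have GG0 : 0 <= (4 * LG + 1) * Gi by rewrite mulr_ge0 // addr_ge0 // mulr_ge0.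
have dn9 : 9 <= dn by rewrite /dn -mulrA; lra.
have dn0 : 0 < dn by lra.
exists e, dn^-1, lipf; split.
  by split=> //; rewrite ?invr_gt0 // invf_le1 //; lra.
move=> N1 N2 N11 N21; have N10 : 0 < N1 by exact: lt_le_trans N11.
have N20 : 0 < N2 by exact: lt_le_trans N21.
pose rN := r.+1%:R * (2 * N2).
have rN0 : 0 < rN by rewrite !mulr_gt0 // ltr0n.
(* The grid step will be C1 / q, and rounding moves a point by at most rN / q; [C1] makes the step
   larger than twice this error, before and after applying [g2]. *)
pose C1 := 2 * rN * (1 + Gm) + 1.
have GrN : 0 <= Gm * rN by rewrite mulr_ge0 // ltW.
have C10 : 0 < C1 by rewrite /C1; lra.
have C1a : 2 * rN < C1 by rewrite /C1; lra.
have C1b : Gm * (2 * rN) < C1 by rewrite /C1; lra.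
(* The 4 collects a factor 2 from halving the thresholds and another from rounding down the numbers
   of steps. *)
exists (4 * C1), (`|TG| + `|f0| + 1 + Z); split; first by rewrite mulr_gt0.
move=> T TT t0 t /andP[t00 t0d] td.
have T1 : 1 <= T.
  by apply: le_trans TT; have := normr_ge0 TG; have := normr_ge0 f0; lra.
have fT : `|f0| < T.
  by apply: lt_le_trans TT; have := normr_ge0 TG; have := normr_ge0 f0; lra.
have ZT : Z <= T.
  by apply: le_trans TT; have := normr_ge0 TG; have := normr_ge0 f0; lra.
have TGT : TG <= T.
  by apply: le_trans TT; have := ler_norm TG; have := normr_ge0 f0; lra.
have T0 : 0 < T by exact: lt_le_trans T1.
have tp i : 0 < t i by case/andP: (td i).
have td' i : t i <= dn^-1 by case/andP: (td i).
have dn1 : dn^-1 <= 1 by rewrite invf_le1 //; lra.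
pose P := \prod_i t i.
have P0 : 0 < P by apply: prodr_gt0.
have Pt i : P <= t i.
  rewrite /P (bigD1 i) //= -[leRHS]mulr1 ler_pM2l // prodr_ile1 // => j _.
  by rewrite ltW //= (le_trans (td' j)).
pose LT := lipf * T ^+ d.-1.
have Td1 : 1 <= T ^+ d.-1 by rewrite exprn_ege1.
have LT1 : 1 <= LT by rewrite mulr_ege1.
have LT0 : 0 < LT by exact: lt_le_trans LT1.
(* The largeness conditions on q have the form x / q < y; [X] dominates all the numerators and [Y]
   lies below the required bounds. *)
pose X := LT * rN + rN + Gm * rN + C1 * (1 + 2 * LT).
pose Y := Num.min (t0 / 2) (P / 2).
have Y0 : 0 < Y by rewrite lt_min !divr_gt0.
have X0 : 0 <= X.
  have := mulr_gt0 C10 LT0; have := mulr_gt0 LT0 rN0.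
  by rewrite /X mulrDr; lra.
have [q1 q1P] := div_natr_le X0 Y0.
exists q1.+1 => q qq.
have q0 : (0 < q)%N by exact: leq_trans qq.
have qR : (0 : R) < q%:R by rewrite ltr0n.
have := q1P q (ltnW qq) q0; rewrite lt_min => /andP[Xt0 XP].
pose rho := C1 / q%:R.
have rho0 : 0 < rho by rewrite divr_gt0.
have dlE : r.+1%:R * (2 * N2 * (q%:R)^-1) = rN / q%:R by rewrite /rN !mulrA.
have small x y : x <= X -> X / q%:R < y -> x / q%:R < y.
  by move=> xX; apply: le_lt_trans; rewrite ler_pM2r ?invr_gt0.
have CL := mulr_gt0 C10 LT0; have Lr := mulr_gt0 LT0 rN0.
have XE : X = LT * rN + rN + Gm * rN + C1 + 2 * (C1 * LT) by rewrite /X; ring.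
have [XL XrN XGm XC XCL] : [/\ LT * rN <= X, rN <= X, Gm * rN <= X, C1 <= X
    & 2 * (C1 * LT) <= X].
  by rewrite XE; apply: ler_sum5 => //; rewrite ltW // mulr_gt0.
have rhoS : rho < t0 / 2 by exact: small Xt0.
(* The number of steps [rho] fitting into half a threshold, with the Lipschitz constant of F taken
   into account for the index 0. *)
pose mm (a : 'I_r.+1) : nat := Num.truncn
  (if unlift ord0 a is Some i then t i / (2 * rho) else t0 / (2 * LT * rho)).
have mm0E : mm ord0 = Num.truncn (t0 / (2 * LT * rho)) by rewrite /mm unlift_none.
have mmiE i : mm (lift ord0 i) = Num.truncn (t i / (2 * rho)) by rewrite /mm liftK.
have LTr : 0 < 2 * LT * rho by apply: mulr_gt0 => //; exact: mulr_gt0.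
have rho2 : 0 < 2 * rho by exact: mulr_gt0.
have big0 : 1 <= t0 / (2 * LT * rho).
  rewrite ler_pdivlMr // mul1r ltW // -mulrA.
  have -> : LT * rho = C1 * LT / q%:R by rewrite /rho mulrA [LT * _]mulrC.
  have : 2 * (C1 * LT) / q%:R < t0 / 2 by exact: small Xt0.
  move=> h; have [h1 h2] := half_ltr h t00 (lexx t0). by rewrite mulrA.
have bigi i : 1 <= t i / (2 * rho).
  rewrite ler_pdivlMr // mul1r.
  have : rho < P / 2 by exact: small XP.
  by move/twice_le; apply.
have mm0le : LT * (rho * (mm ord0)%:R) <= t0 / 2.
  by rewrite mm0E half_mulr // trunc_div_le // ltW.
exists (\max_a mm a)%N, mm; split.
- by move=> a; exact: leq_bigmax.
- rewrite natr_prod big_ord_recl mm0E.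
  rewrite [X in _ <= _ * X](eq_bigr (fun i => (Num.truncn (t i / (2 * rho)))%:R)); last first.
    by move=> i _; rewrite mmiE.
  have h0 := trunc_ge_half big0.
  have hi i := trunc_ge_half (bigi i).
  apply: (@le_trans _ _ (t0 / (2 * LT * rho) / 2 * \prod_i (t i / (2 * rho) / 2))).
    pose u := q%:R / (4 * C1).
    have rhoE : rho = (4 * u)^-1.
      by rewrite /rho /u; field; rewrite !lt0r_neq0.
    have u0 : u != 0 by rewrite /u mulf_neq0 ?invr_eq0 ?lt0r_neq0 // mulr_gt0.
    rewrite [X in _ <= _ * X](eq_bigr (fun i => t i * u)) => [|i _]; last by rewrite rhoE; field.
    rewrite big_split /= prodr_const card_ord -/u -/P -/LT exprS rhoE.
    rewrite le_eqVlt; apply/orP; left; apply/eqP; field.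
    by rewrite u0 (lt0r_neq0 LT0).
  apply: ler_pM => //.
  + by rewrite !divr_ge0 // ltW.
  + by apply: prodr_ge0 => i _; rewrite !divr_ge0 ?(ltW rho2) // ltW.
  by apply: ler_prod => i _; rewrite hi andbT !divr_ge0 ?(ltW rho2) // ltW.
move=> A Bm k nd k0 kj.
have HL v v' (dl : R) : region iota (4 * (K + 2)) Z T v -> region iota (4 * (K + 2)) Z T v' ->
    (forall i, i != iota ord0 -> `|v 0 i - v' 0 i| <= dl) ->
    `|(F v - v 0 (iota ord0) ^+ d) - (F v' - v' 0 (iota ord0) ^+ d)| <= LG * T ^+ d.-1 * dl.
  move=> rv rv' vv; apply: HLG => //.
  by apply: le_trans (vv _ (phi_iota ord0 ord0)).
have HG v (rv : region iota (4 * (K + 2)) Z T v) := HTG T v TGT rv.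
have [C [Csol Cinj]] : exists C : {ffun 'I_r.+1 -> 'I_(\max_a mm a)%N} -> 'rV[int]_r.+1,
    (forall al, cap mm al -> solution iota A Bm F K f0 T k g2 xi t0 t (fracv R q (C al))) /\
    (forall al be, cap mm al -> cap mm be ->
           (forall a, exists z : int, C al 0 a - C be 0 a = z * q) -> al = be).
  have t0T : t0 <= T by rewrite (le_trans t0d) // (le_trans dn1).
  apply: (many_solutions iotaI phiI phi_iota e0 N10 N20 nd e2 d0 (erefl K) T1 fT ZT LG0
    k0 kj eK HL HG (mulmxV g2u) (mulVmx g2u) Gi0 Hgm Hgi HZ t00 td' dn1
    _ eLG _ _ q0 rho0 _ mm0le); rewrite ?dlE.
  - by rewrite invr_ge0 ltW.
  - have : dn^-1 * dn = 1 by rewrite mulVf ?lt0r_neq0.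
    move=> xE; apply: (small_sum _ _ t0d N21); first by rewrite invr_gt0.
    by rewrite -[RHS]xE.
  - by have [] := half_ltr rhoS t00 t0T.
  - move=> i; rewrite mmiE -[leLHS]mul1r half_mulr // mulr1.
    exact: trunc_div_le (ltW (tp i)) rho2.
  - have m0 : 0 <= rho * (mm ord0)%:R by rewrite mulr_ge0 // ltW.
    have := le_trans (ler_wpM2r m0 LT1) mm0le; rewrite mul1r => /le_trans; apply.
    by apply: le_trans t0T; rewrite ler_pdivrMr // ler_peMr ?ler1n // ltW.
  - by rewrite mulrA; apply: small Xt0.
  - apply/ltW/(@small _ T) => //.
    by have [] := half_ltr Xt0 t00 t0T.
  - move=> i; rewrite mulrA; apply: (@lt_le_trans _ _ (P / 2)).
      exact: small XP.
    by rewrite ler_pM2r ?invr_gt0 // Pt.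
  - by rewrite /rho mulrA ltr_pM2r ?invr_gt0 // ?C1a ?C1b.
  - by rewrite /rho [2 * _]mulrA mulrA ltr_pM2r ?invr_gt0 // ?C1a ?C1b.
exists C; split=> // al cal; have sol := Csol al cal.
have [pb _ Ft tht] := sol; split=> //.
have thZ := solution_thin HZ td' dn1 sol.
by have [_ _ _] := pos_region iotaI phiI phi_iota e0 N10 N20 nd e2 (erefl K) T1 ZT k0 kj eK pb thZ.
Qed.

End Family.

Lemma bernoulli_ge (R : realDomainType) (y : R) (m : nat) : 0 <= y ->
  1 + m%:R * y <= (1 + y) ^+ m.
Proof.
move=> y0; elim: m => [|m IH]; first by rewrite mul0r addr0 expr0.
have y1 : 0 <= 1 + y by rewrite addr_ge0.
rewrite exprS; apply: le_trans (ler_wpM2l y1 IH).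
have yy : 0 <= m%:R * y * y by rewrite !mulr_ge0.
by rewrite -natr1; lra.
Qed.

Lemma geometric_small (R : realType) (k : nat) (b : 'I_k -> R) (dl : R) :
  (forall a, 0 < b a < 1) -> 0 < dl ->
  exists i0 : nat, forall i a, (i0 <= i)%N -> b a ^+ i <= dl.
Proof.
move=> b01 dl0.
have one a : exists i0 : nat, b a ^+ i0 <= dl.
  have /andP[b0 b1] := b01 a.
  pose y := (b a)^-1 - 1.
  have y0 : 0 < y by rewrite subr_gt0 invf_gt1.
  have dy0 : 0 <= dl^-1 / y by rewrite divr_ge0 ?invr_ge0 // ltW.
  exists (Num.truncn (dl^-1 / y)).+1; set N := (Num.truncn _).+1.
  have /andP[_] := truncn_itv dy0; rewrite -/N ltr_pdivrMr // => Ny.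
  have := bernoulli_ge N (ltW y0); rewrite (_ : 1 + y = (b a)^-1); last by rewrite /y addrC subrK.
  rewrite exprVn -[dl]invrK => h; rewrite -[b a ^+ N]invrK lef_pV2 ?posrE ?invr_gt0 //.
    by apply: le_trans h; lra.
  by rewrite exprn_gt0.
have [f fP] := choice one.
exists (\sum_a f a)%N => i a fi.
have fa : (f a <= i)%N by apply: leq_trans fi; rewrite (bigD1 a) //= leq_addr.
apply: le_trans (fP a); have /andP[b0 b1] := b01 a.
by rewrite ler_wiXn2l // ltW.
Qed.

(** * Shears and integer vectors *)

Section Avoid.
Variables (R : realType) (n r l : nat).
Variables (iota : 'I_r.+1 -> 'I_n) (phi : 'I_l.+2 -> 'I_n).
Hypotheses (iotaI : injective iota) (phiI : injective phi).
Hypothesis phi_iota : forall e a, phi e != iota a.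

Definition embed (S : pzSemiRingType) k (f : 'I_k -> 'I_n) : 'M[S]_(k, n) :=
  \matrix_(j, i) (f j == i)%:R.

Lemma embed_mulE (S : pzSemiRingType) k (f : 'I_k -> 'I_n) j (h : 'M[S]_n) i :
  (embed S f *m h) j i = h (f j) i.
Proof.
rewrite mxE (bigD1 (f j)) //= mxE eqxx mul1r big1 ?addr0 // => x xf.
by rewrite mxE eq_sym (negPf xf) mul0r.
Qed.

Lemma embed_trmul (S : pzSemiRingType) k k' (f : 'I_k -> 'I_n) (f' : 'I_k' -> 'I_n) :
  embed S f *m (embed S f')^T = \matrix_(j, j') (f j == f' j')%:R.
Proof.
apply/matrixP => j j'; rewrite !mxE (bigD1 (f j)) //= !mxE eqxx mul1r.
rewrite big1 ?addr0 => [|x xf]; first by rewrite eq_sym.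
by rewrite !mxE eq_sym (negPf xf) mul0r.
Qed.

Lemma embed_map (k : nat) (f : 'I_k -> 'I_n) :
  map_mx intr (embed int f) = embed R f.
Proof. by apply/matrixP => j i; rewrite !mxE; case: eqP. Qed.

Definition lift_mx (q : nat) (B : 'M['F_q]_(l.+2, r.+1)) : 'M[int]_(l.+2, r.+1) :=
  \matrix_(j, a) (B j a : nat)%:Z.

(** The matrix u_B, with the entries of B represented in [0, q), so that those of B / q lie in [0,
    1). *)
Definition shear (q : nat) (B : 'M['F_q]_(l.+2, r.+1)) : 'M[R]_n :=
  1%:M + (embed R phi)^T *m (q%:R^-1 *: map_mx intr (lift_mx B)) *m embed R iota.

Lemma embed_phi_shear q (B : 'M['F_q]_(l.+2, r.+1)) :
  embed R phi *m shear B
  = embed R phi + (q%:R^-1 *: map_mx intr (lift_mx B)) *m embed R iota.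
Proof.
rewrite /shear mulmxDr mulmx1 !mulmxA embed_trmul.
have -> : \matrix_(j, j') (phi j == phi j')%:R = 1%:M :> 'M[R]_l.+2.
  by apply/matrixP => j j'; rewrite !mxE (inj_eq phiI).
by rewrite mul1mx.
Qed.

Lemma embed_iota_shear q (B : 'M['F_q]_(l.+2, r.+1)) :
  embed R iota *m shear B = embed R iota.
Proof.
rewrite /shear mulmxDr mulmx1 !mulmxA embed_trmul.
have -> : \matrix_(j, j') (iota j == phi j')%:R = 0 :> 'M[R]_(r.+1, l.+2).
  by apply/matrixP => j j'; rewrite !mxE eq_sym (negPf (phi_iota _ _)).
by rewrite !mul0mx addr0.
Qed.

(** The shear turns the pair (k, w) into (k, w + k B / q). A numerator vector [cc] thus comes from
    an integer [ww] exactly when it is congruent to k B mod q. *)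
Lemma shear_pos q (B : 'M['F_q]_(l.+2, r.+1)) (kk : 'rV[int]_l.+2)
    (ww cc : 'rV[int]_r.+1) (h : 'M[R]_n) : (0 < q)%N ->
  cc = kk *m lift_mx B + q%:Z *: ww ->
  map_mx intr (kk *m embed int phi + ww *m embed int iota) *m (shear B *m h)
  = pos (embed R phi *m h) (embed R iota *m h) (map_mx intr kk) (fracv R q cc).
Proof.
move=> q0 ->; have qR : (q%:R : R) != 0 by rewrite pnatr_eq0 -lt0n.
rewrite map_mxD !map_mxM !embed_map mulmxA mulmxDl -!(mulmxA _ _ (shear B)).
rewrite embed_phi_shear embed_iota_shear /pos !mulmxA -mulmxDl; congr (_ *m h).
rewrite mulmxDr -addrA; congr (_ + _).
rewrite mulmxA -mulmxDl; congr (_ *m _).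
rewrite -scalemxAr; apply/rowP => a.
have fE cc' : fracv R q cc' 0 a = (cc' 0 a)%:~R / q%:R by rewrite mxE.
rewrite fE -map_mxM.
set M := kk *m lift_mx B; rewrite !mxE intrD intrM mulrDl mulrC; congr (_ + _).
by rewrite -pmulrn mulrC mulKf.
Qed.

End Avoid.

Lemma intr_Fp_eq (q : nat) (x y : int) : prime q ->
  x%:~R = y%:~R :> 'F_q -> exists z : int, x - y = z * q.
Proof.
move=> pq /eqP; rewrite -subr_eq0 -intrB => /eqP xy0.
suff : (q %| `|x - y|)%N by move=> /dvdnP[k kE]; exists (sgz (x - y) * k%:Z);
  rewrite {1}[x - y]intEsg -mulrA kE.
have : (`|x - y|%N)%:R = 0 :> 'F_q.
  move: (x - y) xy0 => [k|k] //.
  by rewrite NegzE mulrNz => /eqP; rewrite oppr_eq0 => /eqP.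
by move=> /(congr1 val); rewrite /= val_Fp_nat // => /eqP.
Qed.

Lemma card_cap (r M : nat) (mm : 'I_r.+1 -> nat) : (forall a, (mm a <= M)%N) ->
  #|[set al : {ffun 'I_r.+1 -> 'I_M} | cap mm al]%SET| = (\prod_a mm a)%N.
Proof.
move=> mmM.
pose Fe (a : 'I_r.+1) : {pred 'I_M} := [pred x : 'I_M | (x < mm a)%N].
have -> : #|[set al : {ffun 'I_r.+1 -> 'I_M} | cap mm al]%SET|
     = #|(family Fe : pred {ffun 'I_r.+1 -> 'I_M})|.
  apply: eq_card => al; rewrite inE; apply/forallP/familyP => h a; have := h a.
    by rewrite inE.
  by rewrite inE.
rewrite card_family foldrE big_map big_enum /=; apply: eq_bigr => a _.
rewrite -(card_ord (mm a)) -(card_codom (f := widen_ord (mmM a))); last first.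
  by move=> x y /(congr1 val) /= xy; exact: val_inj.
apply: eq_card => x; rewrite !inE; apply/idP/codomP => [xm|[y ->]] /=.
  by exists (Ordinal xm); exact: val_inj.
exact: ltn_ord.
Qed.

(** * Counting the shears without a solution *)

Section AvoidBound.
Variables (R : realType) (n r l : nat).
Variables (iota : 'I_r.+1 -> 'I_n) (phi : 'I_l.+2 -> 'I_n).
Hypotheses (iotaI : injective iota) (phiI : injective phi).
Hypothesis phi_iota : forall e a, phi e != iota a.
Variables (F : 'rV[R]_n -> R) (d c : nat).
Hypothesis d0 : (0 < d)%N.
Hypothesis Flip : forall K2 Z, 0 <= K2 -> 0 <= Z ->
  tame_lipschitz iota K2 Z d.-1 (fun v => F v - v 0 (iota ord0) ^+ d).
Hypothesis Fgrowth : forall K2 Z, 0 <= K2 -> 0 <= Z ->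
  exists T0 : R, forall T v, T0 <= T -> region iota K2 Z T v ->
  (forall i, i != iota ord0 -> i != phi ord0 -> `|v 0 i| <= 2 * T) ->
  `|F v - v 0 (iota ord0) ^+ d + v 0 (phi ord0) ^+ d| <= c%:R * (2 * T) ^+ d.
Variables (lam xi0 : R) (g2 : 'M[R]_r) (xi : 'rV[R]_r) (N : 'rV[R]_n -> R) (CN : R).
Hypotheses (lam0 : lam != 0) (g2u : g2 \in unitmx) (CN0 : 0 <= CN).
Hypothesis HN : forall (v : 'rV[R]_n) b, (forall i, `|v 0 i| <= b) -> N v <= CN * b.
Variable b : 'I_r.+1 -> R.
Hypothesis b01 : forall a, 0 < b a < 1.
Local Notation beta := (\prod_a b a).
(** Ratio between consecutive levels: a level multiplies the number of vectors k by 2^(l+2) and the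
    proportion of suitable classes by beta / 2^(d-1). *)
Local Notation z0 := (2 ^+ d.-1 / (2 ^+ l.+2 * beta)).

(* The thresholds are those of t = 2 ^ j.+1, whereas the size is at most 2 ^ j:
   a solution serves for all t in between. *)
Definition hits (j : nat) (sig : 'M[int]_n) (h : 'M[R]_n) :=
  exists v : 'rV[int]_n, let v' := map_mx intr v *m h in
  [/\ `|lam * F v' - xi0| < b ord0 ^+ j.+1,
      forall i, `|(thin iota v' *m g2) 0 i - xi 0 i| < b (lift ord0 i) ^+ j.+1
    & N (map_mx intr (v *m sig)) <= 2 ^+ j].

(** A fixed shift of the level absorbs the constants of [sig] and of the norm; it costs only a power
    of [beta] in the final constant. *)
Lemma shift_exists (sig : 'M[int]_n) (N1 K : R) : 0 <= N1 -> 0 <= K ->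
  exists sh : nat, forall (i : nat) (v : 'rV[int]_n),
    (forall x, `|(v 0 x)%:~R : R| <= K * 2 ^+ i) ->
    N (map_mx intr (v *m sig)) <= 2 ^+ (i + sh).
Proof.
move=> N10 K0; have [C C0 HC] := mulmx_norm_le (map_mx intr sig : 'M[R]_n).
have CC0 : 0 <= CN * C * K by rewrite !mulr_ge0.
exists (Num.truncn (CN * C * K)).+1 => i v vb.
set sh := (Num.truncn _).+1.
have h : CN * C * K <= 2 ^+ sh.
  have /andP[_ /ltW/le_trans] := truncn_itv CC0; apply.
  by rewrite -/sh -natrX ler_nat ltnW // ltn_expl.
have vb' x : `|(map_mx intr v : 'rV[R]_n) 0 x| <= K * 2 ^+ i by rewrite mxE.
rewrite map_mxM; apply: le_trans (HN (HC _ _ vb')) _.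
by rewrite exprD [leRHS]mulrC !mulrA ler_wpM2r ?exprn_ge0.
Qed.

(* If [hits] fails for [B], then for no [k] in the cone the class of [k *m B]
   is one of those produced by [solution_family]. *)
Lemma avoid_bound : exists2 e : R, 0 < e <= 1 &
  forall N1 N2 : R, 1 <= N1 -> 1 <= N2 -> forall sig : 'M[int]_n,
  exists (sh : nat) (C : R), 0 <= C /\ exists i0 : nat, forall i, (i0 <= i)%N ->
  exists2 q, prime q & forall h,
    near_diag iota phi e N1 N2 (embed R phi *m h) (embed R iota *m h) ->
    #|[set B : 'M['F_q]_(l.+2, r.+1) | `[< ~ hits (i + sh) sig (shear R iota phi B *m h) >]]%SET|%:R
      <= C * i.+1%:R * z0 ^+ i * (q ^ (l.+2 * r.+1))%:R.
Proof.
have [e [del [lip [[e0 e1 del0 del1 lip0] fam]]]] :=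
  solution_family iotaI phiI phi_iota d0 Flip Fgrowth (xi0 / lam) xi g2u.
exists e => [|N1 N2 N11 N21 sig]; first by rewrite e0.
have [C1 [T0 [C10 {}fam]]] := fam _ _ N11 N21.
pose K := (4 * c + 5)%N.
have KE : 4 * c%:R + 5 = K%:R :> R by rewrite /K natrD natrM.
have N10 : 0 <= N1 by apply: le_trans N11.
(* [W] bounds the entries of the integer part [ww] in units of 2^i: the first summand stems from
   [good], the second from k B / q. [V] does the same for the whole integer vector. *)
pose W : R := 9 * (K%:R + 2) * N1 + l.+2%:R * (K.+1)%:R.
have W0 : 0 <= W by rewrite addr_ge0 // !mulr_ge0 // addr_ge0.
pose V : R := l.+2%:R * K.+1%:R + r.+1%:R * W.
have V0 : 0 <= V by rewrite addr_ge0 // mulr_ge0.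
have [sh shP] := shift_exists sig N10 V0.
have beta0 : 0 < beta by apply: prodr_gt0 => a _; case/andP: (b01 a).
have nlam0 : 0 < `|lam| by rewrite normr_gt0.
pose C := 4 * C1 ^+ r.+1 * lip * N1 ^+ d.-1 * `|lam| / beta ^+ sh.+1.
exists sh, C; split.
  apply: divr_ge0; last by rewrite exprn_ge0 // ltW.
  by do 3! [apply: mulr_ge0; last by rewrite ?exprn_ge0 // ltW];
    rewrite mulr_ge0 // exprn_ge0 // ltW.
have dl0 : 0 < Num.min del (del * `|lam|) by rewrite lt_min del0 mulr_gt0.
have [i1 i1P] := geometric_small b01 dl0.
exists (i1 + Num.truncn `|T0|).+1%N => i ii.
(* The vectors k have size about 2^i, and the rows indexed by [phi] have length about [N1]. *)
pose T := N1 * 2 ^+ i.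
have TT : T0 <= T.
  apply: le_trans (ler_norm T0) _.
  have /andP[_ /ltW/le_trans] := truncn_itv (normr_ge0 T0); apply.
  apply: (@le_trans _ _ (2 ^+ i)); last by rewrite ler_peMl // exprn_ge0.
  rewrite -natrX ler_nat (leq_trans _ (ltnW (ltn_expl i (ltnSn 1)))) //.
  by apply: leq_trans ii; rewrite ltnS leq_addl.
pose t0 := b ord0 ^+ (i + sh).+1 / `|lam|.
pose t j := b (lift ord0 j) ^+ (i + sh).+1.
have bsmall a : b a ^+ (i + sh).+1 <= del /\ b a ^+ (i + sh).+1 <= del * `|lam|.
  have : b a ^+ (i + sh).+1 <= Num.min del (del * `|lam|).
    by apply: i1P; apply/leqW/(leq_trans (leq_trans (leqW (leq_addr _ _)) ii))/leq_addr.
  by rewrite le_min => /andP[].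
have bp a : 0 < b a ^+ (i + sh).+1 by rewrite exprn_gt0 //; case/andP: (b01 a).
have t0d : 0 < t0 <= del.
  by rewrite /t0 divr_gt0 //= ler_pdivrMr // (bsmall _).2.
have td j : 0 < t j <= del by rewrite /t bp (bsmall _).1.
have [q0 q0P] := fam T TT t0 t t0d td.
have [q] := prime_above (q0 + (K.+1 * 2 ^ i) ^ 2); move=> qgt pq.
have qq0 : (q0 <= q)%N by rewrite (leq_trans (leq_addr _ _) (ltnW qgt)).
have qK : ((K.+1 * 2 ^ i) ^ 2 < q)%N by rewrite (leq_ltn_trans _ qgt) // leq_addl.
exists q => // h nd; have q_gt0 := prime_gt0 pq.
have [M [mm [mmM mmge sol]]] := q0P q qq0.
pose kk (a : {ffun 'I_l.+2 -> 'I_(2 ^ i)}) : 'rV[int]_l.+2 := \row_e (kvec K a e)%:Z.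
have kkR a j : (map_mx intr (kk a) : 'rV[R]_l.+2) 0 j = (kvec K a j)%:R.
  by rewrite !mxE.
have two : (2 ^ i)%:R = 2 ^+ i :> R by rewrite natrX.
have kk0 a : (4 * c%:R + 5) * T <= (map_mx intr (kk a) : 'rV[R]_l.+2) 0 ord0 * N1
    <= (4 * c%:R + 5 + 1) * T.
  rewrite kkR KE /T [N1 * _]mulrC !mulrA natr1 !ler_pM2r ?(lt_le_trans ltr01) //.
  rewrite -two -!natrM !ler_nat; apply/andP; split.
    by rewrite /kvec eqxx mul1n -addnA addnCA leq_addr.
  by rewrite mulSn; have := kvec_le K a ord0; rewrite eqxx mul1n.
have kkj a j : j != ord0 -> 0 <= (map_mx intr (kk a) : 'rV[R]_l.+2) 0 j * N1 <= T.
  move=> j0; rewrite kkR mulr_ge0 //= /T mulrC ler_wpM2l // -two ler_nat.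
  by have := kvec_le K a j; rewrite (negPf j0) mul0n addn0.
have [Cf CfP] := choice (fun a => sol _ _ _ nd (kk0 a) (kkj a)).
pose modq (cc : 'rV[int]_r.+1) : 'rV['F_q]_r.+1 := \row_a (cc 0 a)%:~R.
(* By injectivity mod q these sets all have the same number of elements, as the second moment bound
   requires. *)
pose S a := [set modq (Cf a al) | al in [set al | cap mm al]]%SET.
have Scard a : #|S a| = (\prod_a mm a)%N.
  rewrite card_in_imset ?card_cap // => al be; rewrite !inE => cal cbe /rowP eqm.
  apply: (CfP a).2 => // x; have := eqm x; rewrite !mxE; exact: intr_Fp_eq.
have K0 : (0 < K)%N by rewrite /K addn_gt0 orbT.
have key := card_avoid_kvec_le K0 pq qK Scard.
have sub : (#|[set B : 'M['F_q]_(l.+2, r.+1) |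
      `[< ~ hits (i + sh) sig (shear R iota phi B *m h) >]]%SET|
    <= #|[set B : 'M['F_q]_(l.+2, r.+1) |
      [forall a, kvecF q K a *m B \notin S a]]%SET|)%N.
  apply/subset_leq_card/fintype.subsetP => B; rewrite !inE => nh.
  apply/forallP => a; apply/negP => /imsetP[al]; rewrite inE => cal kE.
  apply: nh.
  have [Fgood tgood wgood] := (CfP a).1 al cal.
  (* The class of k B is that of [Cf a al], so the difference of the two integer vectors is
     divisible by q. *)
  have [ww wwE] : exists ww : 'rV[int]_r.+1, Cf a al = kk a *m lift_mx B + q%:Z *: ww.
    have ex x : exists z : int, (Cf a al) 0 x - (kk a *m lift_mx B) 0 x = z * q.
      apply: intr_Fp_eq => //; have /rowP/(_ x) := kE; rewrite !mxE => <-.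
      rewrite raddf_sum /=; apply: eq_bigr => j _; rewrite !mxE intrM; congr (_ * _).
      by rewrite -[in LHS](natr_Zp (B j x)).
    have [z zE] := choice ex; exists (\row_x z x); apply/rowP => x.
    have addE (u v : 'rV[int]_r.+1) y : (u + q%:Z *: v) 0 y = u 0 y + q%:Z * v 0 y.
      by rewrite !mxE.
    have rowE y : (\row_x z x) 0 y = z y by rewrite mxE.
    by rewrite addE rowE mulrC -zE addrC subrK.
  pose vv : 'rV[int]_n := kk a *m embed int phi + ww *m embed int iota.
  exists vv; cbv zeta.
  rewrite (shear_pos phiI phi_iota h q_gt0 wwE).
  set v' := pos _ _ _ _ in Fgood tgood *; split=> //.
    have -> : lam * F v' - xi0 = lam * (F v' - xi0 / lam).
      by rewrite mulrBr mulrCA divff // mulr1.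
    by rewrite normrM mulrC -ltr_pdivlMr.
  apply: shP => x.
  have qR : (0 : R) < q%:R by rewrite ltr0n.
  have kb j : `|(kk a 0 j)%:~R : R| <= K.+1%:R * 2 ^+ i.
    rewrite mxE -pmulrn ger0_norm // -two -natrM ler_nat mulSn.
    apply: leq_trans (kvec_le K a j) _; rewrite leq_add2l.
    by case: (j == ord0); rewrite ?mul1n ?mul0n.
  have Bq j y : (lift_mx B j y)%:~R <= q%:R :> R.
    rewrite mxE -pmulrn ler_nat ltnW //.
    by have := ltn_ord (B j y); rewrite [X in (_ < X)%N -> _]Fp_cast.
  have wb y : `|(ww 0 y)%:~R : R| <= W * 2 ^+ i.
    have wE : (ww 0 y)%:~R = fracv R q (Cf a al) 0 y
        - (\sum_j (kk a 0 j)%:~R * (lift_mx B j y)%:~R) / q%:R :> R.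
      rewrite [fracv _ _ _ _ _]mxE wwE; set M' := kk a *m lift_mx B.
      have -> : (M' + q%:Z *: ww) 0 y = M' 0 y + q%:Z * ww 0 y by rewrite !mxE.
      have -> : M' 0 y = \sum_j kk a 0 j * lift_mx B j y by rewrite mxE.
      rewrite intrD intrM raddf_sum /= mulrDl.
      under eq_bigr do rewrite intrM.
      by rewrite addrAC subrr add0r mulrAC mulfV ?mul1r // lt0r_neq0.
    rewrite wE /W mulrDl (le_trans (ler_normB _ _)) // lerD //.
      apply: le_trans (le_trans (ler_peMr _ N21) (wgood y)) _ => //.
      by rewrite KE /T mulrA.
    rewrite normrM normfV (gtr0_norm qR) ler_pdivrMr // -!mulrA.
    apply: ler_norm_sum_const => j; rewrite normrM mulrA ler_pM //.
    by rewrite ger0_norm ?Bq // mxE -pmulrn.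
  have -> : (kk a *m embed int phi + ww *m embed int iota) 0 x
      = \sum_j kk a 0 j * (phi j == x)%:R + \sum_y ww 0 y * (iota y == x)%:R.
    by rewrite mxE; congr (_ + _); rewrite mxE; apply: eq_bigr => j _; rewrite [embed _ _ _ _]mxE.
  rewrite intrD !raddf_sum /= /V mulrDl (le_trans (ler_normD _ _)) // lerD //.
    rewrite -mulrA; apply: ler_norm_sum_const => j; rewrite intrM normrM.
    by case: eqP => _; rewrite ?normr1 ?normr0 ?mulr1 ?mulr0 ?kb // mulr_ge0 // exprn_ge0.
  rewrite -mulrA; apply: ler_norm_sum_const => j; rewrite intrM normrM.
  by case: eqP => _; rewrite ?normr1 ?normr0 ?mulr1 ?mulr0 ?wb // mulr_ge0 // exprn_ge0.
have {}key := leq_trans (leq_mul sub (leqnn _)) key.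
move: key; set bd := #|_| => key.
have T1 : 0 < T by rewrite mulr_gt0 ?exprn_gt0 // (lt_le_trans ltr01).
have tE : t0 * \prod_j t j = beta ^+ (i + sh).+1 / `|lam|.
  by rewrite /t0 /t mulrAC big_ord_recl exprMn prodrXl.
rewrite {}tE in mmge.
have {key} : bd%:R * ((2 ^+ i) ^+ l.+2 * (\prod_a mm a)%:R)
    <= 4 * i.+1%:R * q%:R ^+ r.+1 * (q ^ (l.+2 * r.+1))%:R :> R.
  rewrite -!natrX -!natrM ler_nat; exact: key.
move=> key; have {key} : bd%:R * ((2 ^+ i) ^+ l.+2 *
   ((q%:R / C1) ^+ r.+1 * (beta ^+ (i + sh).+1 / `|lam|) / (lip * T ^+ d.-1)))
    <= 4 * i.+1%:R * q%:R ^+ r.+1 * (q ^ (l.+2 * r.+1))%:R :> R.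
  apply: le_trans key; rewrite ler_wpM2l // ler_wpM2l // exprn_ge0 // exprn_ge0 //.
set Q := (q ^ _)%:R; set G := _ ^+ l.+2 * _ => key.
have qR : (0 : R) < q%:R by rewrite ltr0n.
have G0 : 0 < G.
  rewrite /G mulr_gt0 ?exprn_gt0 // divr_gt0 ?mulr_gt0 ?invr_gt0 ?exprn_gt0 //.
  by rewrite divr_gt0.
rewrite -(ler_pM2r G0); apply: le_trans key _.
rewrite le_eqVlt; apply/orP; left; apply/eqP.
rewrite /G /C /T -addnS exprD.
have -> : (2 ^+ i) ^+ l.+2 = (2 ^+ l.+2) ^+ i :> R by rewrite -!exprM mulnC.
have P20 : (2 ^+ l.+2 : R) != 0 by rewrite expf_neq0.
move: (2 ^+ l.+2 : R) P20 => P2 P20.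
rewrite !expr_div_n !exprMn -!exprM [(d.-1 * i)%N]mulnC.
set t2d := 2 ^+ (i * d.-1); set t2l := P2 ^+ i.
have x1 : t2d != 0 by rewrite expf_neq0.
have x2 : t2l != 0 by rewrite expf_neq0.
have x3 : beta ^+ i != 0 by rewrite expf_neq0 // lt0r_neq0.
have x4 : beta ^+ sh.+1 != 0 by rewrite expf_neq0 // lt0r_neq0.
have x5 : C1 ^+ r.+1 != 0 by rewrite expf_neq0 // lt0r_neq0.
have x6 : q%:R ^+ r.+1 != 0 :> R by rewrite expf_neq0 // lt0r_neq0.
have x7 : N1 ^+ d.-1 != 0 by rewrite expf_neq0 // lt0r_neq0 // (lt_le_trans ltr01).
have x8 : `|lam| != 0 by rewrite lt0r_neq0.
have x9 : lip != 0 by rewrite lt0r_neq0.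
move: t2d t2l (beta ^+ i) (beta ^+ sh.+1) (C1 ^+ r.+1) (q%:R ^+ r.+1) (N1 ^+ d.-1) x1 x2 x3 x4 x5 x6 x7.
move=> t2d t2l y1 y2 y3 y4 y5 x1 x2 x3 x4 x5 x6 x7.
by field; rewrite ?x1 ?x2 ?x3 ?x4 ?x5 ?x6 ?x7 ?x8 ?x9.
Qed.

End AvoidBound.

(** * Borel measures on matrix spaces *)

Lemma measurable_borel (S T : ptopologicalType) (f : S -> T) : continuous f ->
  measurable_fun [set: borel S] (f : borel S -> borel T).
Proof.
move=> cf; apply: (@measurability _ _ (borel S) (borel T) setT f (@open T)) => //.
move=> _ [B oB <-]; rewrite setTI; apply: sub_sigma_algebra.
by apply: open_comp => // x _; exact: cf.
Qed.

Lemma measurable_borel_real (R : realType) (T : ptopologicalType) (f : T -> R) :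
  continuous f -> measurable_fun [set: borel T] (f : borel T -> R).
Proof.
move=> cf; apply: (@measurability _ _ (borel T) R setT f _ (RGenOInfty.measurableE R)).
move=> _ [_ [x ->] <-]; rewrite setTI; apply: sub_sigma_algebra.
by apply: open_comp => [? _|]; [exact: cf|exact: rray_open].
Qed.

Lemma continuous_mx (S : topologicalType) (T : ptopologicalType) (k j : nat)
    (f : S -> 'M[T]_(k, j)) :
  (forall a c, continuous (fun x => f x a c)) -> continuous f.
Proof.
move=> cf x A [P Pn PA].
apply: (@filterS _ (nbhs x) _ (fun y => forall a c, P a c (f y a c))).
  by move=> y Py; apply: PA.
by apply: filter_forall => a; apply: filter_forall => c; exact: (cf a c x _ (Pn a c)).
Qed.

Lemma continuous_sum (R : realType) (T : topologicalType) (I : Type) (s : seq I)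
    (P : pred I) (f : I -> T -> R) : (forall i, continuous (f i)) ->
  continuous (fun x => \sum_(i <- s | P i) f i x).
Proof.
move=> cf; elim: s => [|i s IH].
  by under eq_fun do rewrite big_nil; move=> x; exact: cvg_cst.
under eq_fun do rewrite big_cons; case: (P i) => // x.
by apply: continuousD; [exact: cf|exact: IH].
Qed.

Lemma continuous_prod (R : realType) (T : topologicalType) (I : Type) (s : seq I)
    (f : I -> T -> R) : (forall i, continuous (f i)) ->
  continuous (fun x => \prod_(i <- s) f i x).
Proof.
move=> cf; elim: s => [|i s IH].
  by under eq_fun do rewrite big_nil; move=> x; exact: cvg_cst.
under eq_fun do rewrite big_cons; move=> x.
by apply: continuousM; [exact: cf|exact: IH].
Qed.

Lemma continuous_scale (R : realType) (T : topologicalType) (c : R) (f : T -> R) :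
  continuous f -> continuous (fun x => c * f x).
Proof. by move=> cf x; apply: (@continuousM R T (cst c) f x); [exact: cvg_cst|exact: cf]. Qed.

Lemma continuous_det (R : realType) (n : nat) : continuous (fun A : 'M[R]_n => \det A).
Proof.
apply: continuous_sum => s; apply: continuous_scale.
by apply: continuous_prod => i; exact: coord_continuous.
Qed.

Lemma continuous_mulmxl (R : realType) (m n k : nat) (u : 'M[R]_(m, n)) :
  continuous (fun A : 'M[R]_(n, k) => u *m A).
Proof.
apply: continuous_mx => a c; under eq_fun do rewrite mxE.
apply: continuous_sum => i; apply: continuous_scale.
exact: coord_continuous.
Qed.

Lemma closed_SL (R : realType) (n : nat) : closed (@SL R n).
Proof.
apply: (@preimage_closed _ _ (fun A : 'M[R]_n => \det A) [set 1]) => [x _|].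
  exact: continuous_det.
exact: closed_eq.
Qed.

Lemma compact_SL_box (R : realType) (n : nat) (C : R) :
  compact [set A : 'M[R]_n | SL A /\ forall i j, `|A i j| <= C].
Proof.
have box : compact [set A : 'M[R]_n | forall i j, `|A i j| <= C].
  have -> : [set A : 'M[R]_n | forall i j, `|A i j| <= C] =
      @vec_mx R n n @` [set v : 'rV[R]_(n * n) | forall i, `[- C, C]%classic (v ord0 i)].
    apply/seteqP; split=> [A AC|_ [v vC <-] i j].
      exists (mxvec A) => [i|]; last by rewrite mxvecK.
      by case/mxvec_indexP: i => i j; rewrite mxvecE /= in_itv /= -ler_norml.
    by have := vC (mxvec_index i j); rewrite /= in_itv /= -ler_norml mxE.
  apply: continuous_compact; last first.
    by apply: (@rV_compact R (n * n)%N (fun=> `[- C, C]%classic)) => i; exact: segment_compact.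
  apply: continuous_subspaceT; apply: continuous_mx => i j.
  by under eq_fun do rewrite mxE; exact: coord_continuous.
apply: (subclosed_compact _ box); last by move=> A [].
apply: (@closedI _ (@SL R n)); first exact: closed_SL.
exact: compact_closed.
Qed.

(** Integration of the number of sets [A i] containing a point. It turns the count of bad B for each
    fixed matrix into a bound on measures. *)
Lemma sum_measure_le d (T : measurableType d) (R : realType)
    (mu : {measure set T -> \bar R}) (I : finType) (A : I -> set T) (D : set T) (c : R) :
  (forall i, measurable (A i)) -> measurable D -> (forall i, A i `<=` D) ->
  (forall x, D x -> #|[set i | `[< A i x >]]%SET|%:R <= c) ->
  (\sum_i mu (A i) <= c%:E * mu D)%E.
Proof.
move=> mA mD AD Ac.
have -> : (\sum_i mu (A i) = \int[mu]_(x in D) (\sum_i (\1_(A i) x)%:E))%E.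
  rewrite ge0_integral_sum //.
  - by apply: eq_bigr => i _; rewrite integral_indic // setIidl.
  - by move=> i; apply/measurable_EFinP; exact: measurable_indic.
have -> : (c%:E * mu D = \int[mu]_(x in D) (cst c%:E x))%E by rewrite integral_cst.
apply: ge0_le_integral => //.
- by move=> x _; apply: sume_ge0 => i _; rewrite lee_fin.
- by apply: emeasurable_sum => i; apply/measurable_EFinP; exact: measurable_indic.
move=> x Dx; rewrite sumEFin lee_fin; apply: le_trans (Ac x Dx).
rewrite -sum1_card natr_sum [leRHS]big_mkcond /=; apply: ler_sum => i _.
rewrite indicE; have [Aix|Aix] := pselect (A i x).
  by rewrite mem_set // finset.in_set asboolT.
by rewrite memNset // finset.in_set asboolF.
Qed.

Lemma sum_geometric_le (R : realFieldType) (w : R) (m : nat) : 0 < w < 1 ->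
  \sum_(k < m) w ^+ k <= (1 - w)^-1.
Proof.
move=> /andP[w0 w1]; have w1' : 0 < 1 - w by rewrite subr_gt0.
rewrite -(ler_pM2l w1') mulfV ?lt0r_neq0 //.
have -> : (1 - w) * \sum_(k < m) w ^+ k = 1 - w ^+ m.
  elim: m => [|m IH]; first by rewrite big_ord0 mulr0 expr0 subrr.
  by rewrite big_ord_recr /= mulrDr IH exprS; ring.
by rewrite gerBl exprn_ge0 // ltW.
Qed.

(** Borel-Cantelli; the linear factor is absorbed by enlarging the ratio from [z] to
    [w = (1 + z) / 2], using Bernoulli's inequality. *)
Lemma limsup_null d (T : measurableType d) (R : realType)
    (mu : {measure set T -> \bar R}) (A : nat -> set T) (C z : R) (i0 : nat) :
  0 <= C -> 0 < z < 1 -> (forall k, measurable (A k)) ->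
  (forall k, (i0 <= k)%N -> (mu (A k) <= (C * k.+1%:R * z ^+ k)%:E)%E) ->
  mu (lim_sup_set (fun k => A (k + i0)%N)) = 0%E.
Proof.
move=> C0 /andP[z0 z1] mA muA.
pose y := (z^-1 - 1) / 2; pose w := (1 + y) * z.
have zi : 1 < z^-1 by rewrite invf_gt1.
have y0 : 0 < y by rewrite divr_gt0 // subr_gt0.
have w01 : 0 < w < 1.
  rewrite /w mulr_gt0 ?addr_gt0 //=.
  have -> : (1 + y) * z = (1 + z) / 2 by rewrite /y; field; exact: lt0r_neq0.
  by lra.
pose D := C * (1 + y^-1).
have D0 : 0 <= D by rewrite mulr_ge0 // addr_ge0 // invr_ge0 ltW.
have bound k : C * k.+1%:R * z ^+ k <= D * w ^+ k.
  have kb : k.+1%:R <= (1 + y^-1) * (1 + y) ^+ k.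
    have h := bernoulli_ge k (ltW y0); have y1 : 0 <= y^-1 by rewrite invr_ge0 ltW.
    have := ler_wpM2l y1 h; rewrite mulrDr mulr1 mulrCA mulVf ?lt0r_neq0 // mulr1.
    have : 1 <= (1 + y) ^+ k by rewrite exprn_ege1 // lerDl ltW.
    by rewrite -natr1; lra.
  rewrite /w exprMn /D mulrA -!mulrA ler_wpM2l // !mulrA ler_wpM2r //.
  by rewrite exprn_ge0 // ltW.
apply: lim_sup_set_cvg0 => [k|]; first exact: mA.
have mu0 k : (0 <= mu (A (k + i0)%N))%E by exact: measure_ge0.
apply: (@le_lt_trans _ _ (D * (1 - w)^-1)%:E); last exact: ltry.
apply: lime_le; first by apply: is_cvg_nneseries => n _ _; exact: mu0.
apply: nearW => m; rewrite big_mkord.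
apply: (@le_trans _ _ (\sum_(k < m) (D * w ^+ k)%:E)%E).
  apply: lee_sum => k _; apply: (le_trans (muA _ (leq_addl _ _))).
  rewrite lee_fin; apply: le_trans (bound _) _; rewrite ler_wpM2l // exprD.
  case/andP: w01 => w0 w1.
  by rewrite ler_piMr ?exprn_ge0 ?exprn_ile1 // ltW.
rewrite sumEFin lee_fin -mulr_sumr ler_wpM2l //; exact: sum_geometric_le.
Qed.

Lemma ysection_null d1 d2 (T1 : measurableType d1) (T2 : measurableType d2)
    (R : realType) (mu1 : {sigma_finite_measure set T1 -> \bar R})
    (mu2 : {sigma_finite_measure set T2 -> \bar R}) (A : set (T1 * T2)) :
  measurable A -> (forall b, mu1 (ysection A b) = 0%E) -> (mu1 \x mu2)%E A = 0%E.
Proof.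
move=> mA A0.
have E B C : measurable B -> measurable C ->
    (mu1 \x^ mu2)%E (B `*` C) = (mu1 B * mu2 C)%E by exact: product_measure2E.
rewrite (product_measure_unique E) // /product_measure2.
by apply: integral0_eq => b _ /=.
Qed.

(** Tonelli's theorem, applied twice so that the middle variable is integrated innermost: the outer
    two are lambda and g_2. *)
Lemma product_null d1 d2 d3 (T1 : measurableType d1) (T2 : measurableType d2)
    (T3 : measurableType d3) (R : realType)
    (mu1 : {sigma_finite_measure set T1 -> \bar R})
    (mu2 : {sigma_finite_measure set T2 -> \bar R})
    (mu3 : {sigma_finite_measure set T3 -> \bar R}) (A : set (T1 * T2 * T3)) :
  measurable A -> (forall a c, mu2 [set b | A (a, b, c)] = 0%E) ->
  ((mu1 \x mu2) \x mu3)%E A = 0%E.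
Proof.
move=> mA A0.
rewrite [LHS](fubini_tonelli1 (mu3 \o xsection A)) //; last first.
  exact: measurable_fun_xsection.
apply: integral0_eq => a _; pose Aa := [set bc : T2 * T3 | A (a, bc.1, bc.2)].
have mAa : measurable Aa.
  pose f := fun bc : T2 * T3 => (a, bc.1, bc.2).
  have mf : measurable_fun setT f.
    apply: measurable_fun_pair; last exact: measurable_snd.
    apply: measurable_fun_pair; [exact: measurable_cst|exact: measurable_fst].
  by rewrite -[Aa]setTI; exact: mf.
rewrite -[RHS](@ysection_null _ _ _ _ _ mu2 mu3 _ mAa) => [|c].
  by apply: eq_integral => b _ /=; congr (mu3 _).
rewrite -[RHS](A0 a c); congr (mu2 _).
by apply/seteqP; split => b; rewrite /ysection /= ?in_setE /= ?in_setE.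
Qed.

(** * Covering of SL_n and Borel-Cantelli *)

(** Sylvester's identity, read off from two triangular factorizations of one block matrix. *)
Lemma det_mx1D (S : comPzRingType) (n k : nat) (X : 'M[S]_(n, k)) (Y : 'M[S]_(k, n)) :
  \det (1%:M + X *m Y) = \det (1%:M + Y *m X).
Proof.
have E : block_mx 1%:M 0 X 1%:M *m block_mx 1%:M (- Y) 0 (1%:M + X *m Y)
       = block_mx (1%:M + Y *m X) (- Y) 0 1%:M *m block_mx 1%:M 0 X 1%:M.
  rewrite !mulmx_block !mul1mx !mulmx1 !mul0mx !mulmx0 !addr0 !add0r mulmxN.
  by rewrite mulNmx addrK addrCA addNr addr0.
have := congr1 determinant E.
by rewrite !det_mulmx !det_lblock !det_ublock !det1 !mul1r !mulr1.
Qed.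

Lemma row_abs_bound (R : realDomainType) (n : nat) (g : 'M[R]_n) :
  exists2 G : R, 0 <= G & forall k : nat, forall v : 'M[R]_(k, n),
    (forall i j, `|v i j| <= 1) -> forall i j, `|(v *m g) i j| <= G.
Proof.
exists (\sum_i \sum_j `|g i j|) => [|k v v1 i j].
  by apply: sumr_ge0 => i _; exact: sumr_ge0.
rewrite mxE; apply: le_trans (ler_norm_sum _ _ _) _; apply: ler_sum => x _.
rewrite normrM (bigD1 j) //= -[leLHS]addr0 lerD //; last exact: sumr_ge0.
by rewrite -[leRHS]mul1r ler_wpM2r.
Qed.

Section Cover.
Variables (R : realType) (n r l : nat).
Variables (iota : 'I_r.+1 -> 'I_n) (phi : 'I_l.+2 -> 'I_n).
Hypotheses (iotaI : injective iota) (phiI : injective phi).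
Hypothesis phi_iota : forall e a, phi e != iota a.
Hypothesis dim_split : (l.+2 + r.+1 = n)%N.

Definition diagonal_like (e N1 N2 : R) (h : 'M[R]_n) :=
  near_diag iota phi e N1 N2 (embed R phi *m h) (embed R iota *m h).

Lemma det_shear q (B : 'M['F_q]_(l.+2, r.+1)) : \det (shear R iota phi B) = 1.
Proof.
rewrite /shear det_mx1D mulmxA embed_trmul.
have -> : \matrix_(j, j') (iota j == phi j')%:R = 0 :> 'M[R]_(r.+1, l.+2).
  by apply/matrixP => j j'; rewrite !mxE eq_sym (negPf (phi_iota _ _)).
by rewrite mul0mx addr0 det1.
Qed.

Lemma index_cases i : (exists j, phi j = i) \/ (exists a, iota a = i).
Proof.
pose f (x : 'I_l.+2 + 'I_r.+1) := match x with inl j => phi j | inr a => iota a end.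
have fI : injective f.
  move=> [j|a] [j'|a'] //=; first by move=> /phiI ->.
  - by move=> /eqP; rewrite (negPf (phi_iota _ _)).
  - by move=> /esym/eqP; rewrite (negPf (phi_iota _ _)).
  - by move=> /iotaI ->.
have fc : (#|'I_n| <= #|{: 'I_l.+2 + 'I_r.+1}|)%N by rewrite card_sum !card_ord dim_split.
have [g _ gK] := inj_card_bij fI fc.
rewrite -(gK i); case: (g i) => [j|a]; [by left; exists j|by right; exists a].
Qed.

Lemma diagonal_likeP e N1 N2 h : 0 < N1 -> 0 < N2 -> diagonal_like e N1 N2 h ->
  exists D : 'I_n -> R, forall i, (0 < D i <= N1 + N2) /\
    forall k, `|h i k - D i *+ (i == k)| <= e * D i.
Proof.
move=> N10 N20 [nd1 nd2].
suff /choice [D DP] : forall i : 'I_n, exists D : R, (0 < D <= N1 + N2) /\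
    forall k, `|h i k - D *+ (i == k)| <= e * D by exists D.
move=> i.
case: (index_cases i) => -[j <-]; [exists N1|exists N2].
  split=> [|k]; first by rewrite N10 lerDl ltW.
  by have := nd1 j k; rewrite embed_mulE.
split=> [|k]; first by rewrite N20 lerDr ltW.
by have := nd2 j k; rewrite embed_mulE.
Qed.

(** Diagonal dominance: for [v] in the kernel, the sum S of the |v_i| D_i satisfies S <= e n S, so
    it vanishes. This yields the invertibility of s over R. *)
Lemma diagonal_like_unit e N1 N2 h : 0 < N1 -> 0 < N2 -> e * n%:R < 1 ->
  diagonal_like e N1 N2 h -> h \in unitmx.
Proof.
move=> N10 N20 en /(diagonal_likeP N10 N20) [D DP].
rewrite unitmxE unitfE; apply/negP => /det0P [v v0 vh].
have D0 i : 0 < D i by have [/andP[]] := DP i.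
pose S := \sum_i `|v 0 i| * D i.
have term i : `|v 0 i| * D i <= e * S.
  have /rowP/(_ i) := vh; rewrite [RHS]mxE => vhi.
  have E : v 0 i * D i = - (\sum_k v 0 k * (h k i - D k *+ (k == i))).
    move: vhi; rewrite mxE => vhi.
    under eq_bigr do rewrite mulrBr.
    rewrite sumrB vhi sub0r opprK (bigD1 i) //= eqxx mulr1n big1 ?addr0 // => k ki.
    by rewrite (negPf ki) mulr0n mulr0.
  rewrite -[D i]gtr0_norm // -normrM E normrN.
  apply: le_trans (ler_norm_sum _ _ _) _; rewrite /S mulr_sumr; apply: ler_sum => k _.
  by rewrite normrM mulrCA ler_wpM2l //; have [_] := DP k; exact.
have S0 : 0 <= S by apply: sumr_ge0 => i _; rewrite mulr_ge0 // ltW.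
have : S <= e * n%:R * S.
  rewrite {1}/S; apply: le_trans (ler_sum _ (fun i _ => term i)) _.
  by rewrite sumr_const card_ord -[leLHS]mulr_natr mulrAC.
have [S00 _|Sn] := eqVneq S 0; last first.
  have S1 : 0 < S by rewrite lt_def Sn.
  by move=> h1; have := en; rewrite -(ltr_pM2r S1) mul1r ltNge h1.
move/eqP: v0; apply; apply/rowP => i; rewrite mxE; apply/eqP.
have := S00; move/eqP; rewrite psumr_eq0 => [/allP/(_ i (mem_index_enum _))|k _].
  by rewrite mulf_eq0 normr_eq0 (gt_eqF (D0 i)) orbF => /eqP ->.
by rewrite mulr_ge0 // ltW.
Qed.

Lemma diagonal_like_bounded e N1 N2 h : 0 < N1 -> 0 < N2 -> e <= 1 ->
  diagonal_like e N1 N2 h -> forall i k, `|h i k| <= 2 * (N1 + N2).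
Proof.
move=> N10 N20 e1 /(diagonal_likeP N10 N20) [D DP] i k.
have [/andP[D0 DN] /(_ k) hik] := DP i.
have e1D : e * D i <= D i by rewrite ger_pMl.
have : `|h i k| <= `|h i k - D i *+ (i == k)| + `|D i *+ (i == k)|.
  by rewrite -[h i k in leLHS](subrK (D i *+ (i == k))) ler_normD.
have : `|D i *+ (i == k)| <= D i.
  by case: eqP => _; rewrite ?mulr1n ?mulr0n ?normr0 ?gtr0_norm // ltW.
by move: hik; lra.
Qed.

(** Undoing the shear adds multiples at most 1 of the [iota] rows, of entries at most 2 N2, to the
    [phi] rows. The latter are chosen so much longer that this fits into the relative error e /
    2. *)
Lemma diagonal_like_shear e' e N1 N2 q (B : 'M['F_q]_(l.+2, r.+1)) h :
  prime q -> 0 < N1 -> 0 < N2 -> e' <= e / 2 -> e <= 1 ->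
  r.+1%:R * (2 * N2) <= e / 2 * N1 ->
  diagonal_like e' N1 N2 (shear R iota phi B *m h) -> diagonal_like e N1 N2 h.
Proof.
move=> pq N10 N20 e'e e1 N12.
have e0 : 0 < e / 2.
  rewrite -(pmulr_lgt0 _ N10); apply: lt_le_trans N12.
  by rewrite !mulr_gt0 // ltr0n.
rewrite /diagonal_like !mulmxA embed_phi_shear // embed_iota_shear // => -[nd1 nd2].
have N2e : e' * N2 <= e * N2 by rewrite ler_wpM2r ?(ltW N20) //; lra.
split=> [j i|a i]; last exact: le_trans (nd2 a i) N2e.
have q0 : (0 : R) < q%:R by rewrite ltr0n prime_gt0.
pose b a := (B j a : nat)%:R / q%:R : R.
have b1 a : `|b a| <= 1.
  rewrite ger0_norm ?divr_ge0 // ?ler0n // ler_pdivrMr // mul1r ler_nat ltnW //.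
  by have := ltn_ord (B j a); rewrite [X in (_ < X)%N -> _](Fp_cast pq).
have E : (embed R phi *m h) j i
    = ((embed R phi + (q%:R^-1 *: map_mx intr (lift_mx B)) *m embed R iota) *m h) j i
      - \sum_a b a * (embed R iota *m h) a i.
  rewrite mulmxDl -mulmxA [in RHS]mxE [X in _ + X - _]mxE -addrA -[LHS]addr0; congr (_ + _).
  apply/esym/eqP; rewrite subr_eq0; apply/eqP; apply: eq_bigr => a _.
  by congr (_ * _); rewrite !mxE mulrC.
have sb : `|\sum_a b a * (embed R iota *m h) a i| <= r.+1%:R * (2 * N2).
  apply: le_trans (ler_norm_sum _ _ _) _.
  rewrite -[r.+1 in leRHS]card_ord mulr_natl -sumr_const; apply: ler_sum => a _.
  rewrite normrM; apply: (@le_trans _ _ `|(embed R iota *m h) a i|).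
    by rewrite -[leRHS]mul1r ler_wpM2r.
  have := nd2 a i; set y := (_ *m _) a i; set w := _ *+ _ => yw.
  have : `|y| <= `|y - w| + `|w| by rewrite -[y in leLHS](subrK w) ler_normD.
  have : `|w| <= N2.
    by rewrite /w; case: eqP => _; rewrite ?mulr1n ?mulr0n ?normr0 ?gtr0_norm // ltW.
  have : e' * N2 <= N2 by rewrite ger_pMl //; lra.
  by lra.
have := nd1 j i; rewrite E; set y := (_ *m h) j i; set w := _ *+ _; set S := \sum_a _ => yw.
have : `|y - S - w| <= `|y - w| + `|S| by rewrite addrAC ler_normB.
have : e' * N1 <= e / 2 * N1 by rewrite ler_pM2r.
by move: sb; rewrite -/S; lra.
Qed.

(** Rounding D g^-1 to an integer matrix and multiplying back by g costs an error bounded in terms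
    of g alone, which is below e N2 once [N2] is large. *)
Lemma diagonal_like_cover (e : R) (M : nat) (g : 'M[R]_n) : 0 < e -> (0 < M)%N ->
  g \in unitmx -> exists (sig : 'M[int]_n) (N2 : nat), (0 < N2)%N /\
    diagonal_like e (M * N2)%:R N2%:R (map_mx intr sig *m g).
Proof.
move=> e0 M0 gu; have [G G0 HG] := row_abs_bound g.
pose N2 := (Num.truncn (G / e)).+1.
have N2G : G <= e * N2%:R.
  have /andP[_] := truncn_itv (divr_ge0 G0 (ltW e0)).
  by rewrite -/N2 ltr_pdivrMr // mulrC => /ltW.
pose D : 'M[R]_n := \matrix_(i, k)
  ((if i \in codom iota then N2%:R else (M * N2)%:R) *+ (i == k)).
pose W := D *m invmx g.
pose sig : 'M[int]_n := \matrix_(i, k) Num.floor (W i k).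
exists sig, N2; split => //.
have E : map_mx intr sig *m g = D + (map_mx intr sig - W) *m g.
  by rewrite mulmxBl mulmxKV // addrC subrK.
have err i k : `|(map_mx intr sig *m g) i k - D i k| <= G.
  rewrite E [(D + _) i k]mxE addrAC subrr add0r; apply: HG => {}i {}k.
  rewrite mxE [map_mx _ _ _ _]mxE [sig _ _]mxE [(- W) _ _]mxE.
  have /andP[h1] := floor_itv (W i k).
  by rewrite intrD1 => h2; rewrite ler_norml; lra.
split=> [j i|a i]; rewrite embed_mulE.
  have := err (phi j) i; rewrite [D _ _]mxE.
  case: ifPn => [/codomP[a /eqP]|_ /le_trans]; first by rewrite (negPf (phi_iota _ _)).
  by apply; apply: le_trans N2G _; rewrite ler_pM2l // ler_nat leq_pmull.
have := err (iota a) i; rewrite [D _ _]mxE.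
by case: ifPn => [_ /le_trans|/negP[]]; [exact|exact: codom_f].
Qed.

End Cover.

Lemma open_abs_sub_lt (R : realType) (T : topologicalType) (f : T -> R) (a c : R) :
  continuous f -> open [set x | `|f x - a| < c].
Proof.
move=> cf; apply: (@open_comp _ _ (fun x => `|f x - a|) [set y | y < c]).
  move=> x _; apply: cvg_norm; apply: cvgB; [exact: cf|exact: cvg_cst].
exact: open_lt.
Qed.

Lemma open_abs_sub_gt (R : realType) (T : topologicalType) (f : T -> R) (a c : R) :
  continuous f -> open [set x | c < `|f x - a|].
Proof.
move=> cf; apply: (@open_comp _ _ (fun x => `|f x - a|) [set y | c < y]).
  move=> x _; apply: cvg_norm; apply: cvgB; [exact: cf|exact: cvg_cst].
exact: open_gt.
Qed.

Lemma open_forall_fin (T : topologicalType) (I : finType) (P : I -> set T) :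
  (forall i, open (P i)) -> open [set x | forall i, P i x].
Proof.
move=> oP; rewrite openE => x Px; apply: filter_forall => i.
by apply: open_nbhs_nbhs; split.
Qed.

Lemma open_ex (T : topologicalType) (I : Type) (P : I -> set T) :
  (forall i, open (P i)) -> open [set x | exists i, P i x].
Proof.
move=> oP; have -> : [set x | exists i, P i x] = \bigcup_i P i.
  by apply/seteqP; split=> x [i]; [exists i|move=> _ Px; exists i].
exact: bigcup_open.
Qed.

Lemma measurable_open (T : ptopologicalType) (A : set T) : open A -> measurable (A : set (borel T)).
Proof. exact: sub_sigma_algebra. Qed.

Lemma continuous_mulmx_coord (R : realType) (k n m : nat) (u : 'M[R]_(k, n)) a i :
  continuous (fun x : 'M[R]_(n, m) => (u *m x) a i).
Proof.
under eq_fun do rewrite mxE; apply: continuous_sum => j; apply: continuous_scale.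
exact: coord_continuous.
Qed.

(** * Null sections for fixed lambda and g_2 *)

Section SectionNull.
Variables (R : realType) (n r l : nat).
Variables (iota : 'I_r.+1 -> 'I_n) (phi : 'I_l.+2 -> 'I_n).
Hypotheses (iotaI : injective iota) (phiI : injective phi).
Hypothesis phi_iota : forall e a, phi e != iota a.
Hypothesis dim_split : (l.+2 + r.+1 = n)%N.
Variables (F : 'rV[R]_n -> R) (d c : nat).
Hypothesis Fc : continuous F.
Hypothesis d0 : (0 < d)%N.
Hypothesis Flip : forall K2 Z, 0 <= K2 -> 0 <= Z ->
  tame_lipschitz iota K2 Z d.-1 (fun v => F v - v 0 (iota ord0) ^+ d).
Hypothesis Fgrowth : forall K2 Z, 0 <= K2 -> 0 <= Z ->
  exists T0 : R, forall T v, T0 <= T -> region iota K2 Z T v ->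
  (forall i, i != iota ord0 -> i != phi ord0 -> `|v 0 i| <= 2 * T) ->
  `|F v - v 0 (iota ord0) ^+ d + v 0 (phi ord0) ^+ d| <= c%:R * (2 * T) ^+ d.
Variables (lam xi0 : R) (g2 : 'M[R]_r) (xi : 'rV[R]_r) (N : 'rV[R]_n -> R) (CN : R).
Hypotheses (lam0 : lam != 0) (g2u : g2 \in unitmx) (CN0 : 0 <= CN).
Hypothesis HN : forall (v : 'rV[R]_n) b, (forall i, `|v 0 i| <= b) -> N v <= CN * b.
Variable b : 'I_r.+1 -> R.
Hypothesis b01 : forall a, 0 < b a < 1.
Local Notation z0 := (2 ^+ d.-1 / (2 ^+ l.+2 * \prod_a b a)).
Hypothesis z01 : z0 < 1.
Local Notation T := (borel 'M[R]_n).
Local Notation hit := (hits iota F lam xi0 g2 xi N b).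

Lemma measurable_hits j sig : measurable ([set x | hit j sig x] : set T).
Proof.
apply: measurable_open; apply: open_ex => v.
pose P1 := [set x : 'M[R]_n | `|lam * F (map_mx intr v *m x) - xi0| < b ord0 ^+ j.+1].
pose P2 := [set x : 'M[R]_n | forall i, `|(thin iota (map_mx intr v *m x) *m g2) 0 i - xi 0 i|
  < b (lift ord0 i) ^+ j.+1].
have o1 : open P1.
  apply: open_abs_sub_lt; apply: continuous_scale => x.
  apply: (@continuous_comp _ _ _ (fun x : 'M[R]_n => map_mx intr v *m x) F).
    exact: continuous_mulmxl.
  exact: Fc.
have o2 : open P2.
  apply: open_forall_fin => i; apply: open_abs_sub_lt.
  under eq_fun do rewrite mxE; apply: continuous_sum => a.
  under eq_fun do rewrite mxE mulrC; apply: continuous_scale; exact: continuous_mulmx_coord.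
(* The norm condition does not involve the matrix variable, so it either holds throughout or empties
   the set. *)
have [h|h] := pselect (N (map_mx intr (v *m sig)) <= 2 ^+ j).
  rewrite [X in open X](_ : _ = P1 `&` P2); first exact: openI.
  by apply/seteqP; split=> x /= [].
rewrite [X in open X](_ : _ = set0); first exact: open0.
by apply/seteqP; split=> x //= [].
Qed.

Lemma measurable_diagonal_like e N1 N2 sig :
  measurable ([set x | diagonal_like iota phi e N1 N2 (sig *m x)] : set T).
Proof.
have cl k (f : 'I_k -> 'I_n) N0 :
    closed [set x : 'M[R]_n | forall j i, `|(embed R f *m (sig *m x)) j i - N0 *+ (f j == i)| <= e * N0].
  have -> : [set x : 'M[R]_n | forall j i, `|(embed R f *m (sig *m x)) j i - N0 *+ (f j == i)| <= e * N0]
      = ~` [set x | exists j, exists i, `|(embed R f *m (sig *m x)) j i - N0 *+ (f j == i)| > e * N0].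
    apply/seteqP; split=> x /=.
      by move=> h [j [i]]; rewrite ltNge h.
    by move=> h j i; rewrite leNgt; apply/negP => hl; apply: h; exists j, i.
  apply: open_closedC; apply: open_ex => j; apply: open_ex => i.
  have cc : continuous (fun x : 'M[R]_n => (embed R f *m (sig *m x)) j i).
    by under eq_fun do rewrite mulmxA; exact: continuous_mulmx_coord.
  exact: open_abs_sub_gt.
rewrite -[X in measurable X]setCK; apply: measurableC; apply: measurable_open.
by apply: closed_openC; apply: closedI; exact: cl.
Qed.

Variable mu : {sigma_finite_measure set T -> \bar R}.
Hypothesis haar : is_haar (@SL R n) mulmx mu.

(** Within SL_n(R) the entries are bounded, so up to the null complement of SL_n(R) the set lies in
    a compact subset of the group. *)
Lemma diagonal_like_finite e N1 N2 (sig : 'M[R]_n) : 0 < N1 -> 0 < N2 -> e <= 1 ->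
  sig \in unitmx ->
  (mu ([set x | diagonal_like iota phi e N1 N2 (sig *m x)] : set T) < +oo)%E.
Proof.
move=> N10 N20 e1 su; case: haar => mu0 _ mufin _.
have [G G0 HG] := mulmx_norm_le (invmx sig)^T.
set K := [set x | _] : set T; pose C := G * (2 * (N1 + N2)).
pose L := [set A : 'M[R]_n | SL A /\ forall i j, `|A i j| <= C].
have KL : K `<=` ~` @SL R n `|` L.
  move=> x Kx; have [Sx|Sx] := pselect (SL x); [right|by left].
  split=> // i j.
  have -> : x i j = (row j (sig *m x)^T *m (invmx sig)^T) 0 i.
    by rewrite -row_mul -trmx_mul mulKmx // !mxE.
  apply: HG => a; rewrite mxE [_^T _ _]mxE.
  exact: (diagonal_like_bounded iotaI phiI phi_iota dim_split N10 N20 e1 Kx).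
have cL : compact L by exact: compact_SL_box.
have mL : measurable (L : set T).
  rewrite -[X in measurable X]setCK; apply: measurableC; apply: measurable_open.
  by apply: closed_openC; exact: compact_closed.
have mS : measurable (~` @SL R n : set T).
  by apply: measurable_open; apply: closed_openC; exact: closed_SL.
apply: (@le_lt_trans _ _ (mu (~` @SL R n `|` L : set T))).
  apply: le_measure => //; rewrite inE; first exact: measurable_diagonal_like.
  exact: measurableU.
apply: (@le_lt_trans _ _ (mu (~` @SL R n : set T) + mu (L : set T))%E).
  exact: measureU2.
by rewrite mu0 add0e; apply: mufin => // x [].
Qed.

Definition ever_missed : set T :=
  [set x | SL x /\ forall J, exists2 j, (J <= j)%N & ~ hit j 1%:M x].

Lemma section_null : mu.-negligible ever_missed.
Proof.
have [e /andP[e0 e1] avoid] :=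
  avoid_bound iotaI phiI phi_iota d0 Flip Fgrowth xi0 xi lam0 g2u CN0 HN b01.
have n0 : (0 < n)%N by rewrite -dim_split.
have nR : (0 : R) < n%:R by rewrite ltr0n.
(* Small enough both for invertibility, e' n < 1, and for stability under shears, e' <= e / 2. *)
pose e' := e / (2 * n%:R).
have e'0 : 0 < e' by rewrite divr_gt0 // mulr_gt0.
have e'n : e' * n%:R = e / 2 by rewrite /e'; field; rewrite lt0r_neq0.
have e'e : e' <= e / 2 by rewrite -e'n ler_peMr ?ler1n // ltW.
have e'n1 : e' * n%:R < 1 by rewrite e'n; lra.
(* The ratio N1 / N2 required by [diagonal_like_shear]. *)
pose M := (Num.truncn (4 * r.+1%:R / e)).+1.
have Me : 4 * r.+1%:R <= e * M%:R.
  have /andP[_] := truncn_itv (divr_ge0 (mulr_ge0 (ler0n R 4) (ler0n R r.+1)) (ltW e0)).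
  by rewrite -/M ltr_pdivrMr // [M%:R * e]mulrC => /ltW.
pose K (sN : 'M[int]_n * nat) : set T := [set x | (0 < sN.2)%N /\
  diagonal_like iota phi e' (M * sN.2)%:R sN.2%:R (map_mx intr sN.1 *m x)].
have cover : ever_missed `<=` \bigcup_k
    (if unpickle k is Some sN then ever_missed `&` K sN else set0).
  move=> x bx; have xu : (x : 'M[R]_n) \in unitmx by rewrite unitmxE (bx.1 : \det _ = 1) unitr1.
  have [sig [N2 [N20 dl]]] := @diagonal_like_cover _ _ _ _ iota phi phi_iota _ M x e'0 isT xu.
  by exists (pickle (sig, N2)) => //; rewrite pickleK; split.
apply: (negligibleS cover); apply: negligible_bigcup => k.
case: (unpickle k) => {k} [[sig N2]|]; last exact: negligible_set0.
have [N20|N20] := posnP N2.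
  rewrite (_ : _ `&` _ = set0); first exact: negligible_set0.
  by apply/seteqP; split=> x //= [_ []]; rewrite /= N20.
pose N1 := (M * N2)%N; have N10 : (0 < N1)%N by rewrite muln_gt0 N20.
have N1R : (0 : R) < N1%:R by rewrite ltr0n.
have N2R : (0 : R) < N2%:R by rewrite ltr0n.
pose S : 'M[R]_n := map_mx intr sig.
have [Su|Su] := boolP (S \in unitmx); last first.
  rewrite (_ : _ `&` _ = set0); first exact: negligible_set0.
  apply/seteqP; split=> x //= [[Sx _] [_ dl]].
  have := diagonal_like_unit iotaI phiI phi_iota dim_split N1R N2R e'n1 dl.
  by rewrite unitmx_mul (negPf Su).
have N12 : r.+1%:R * (2 * N2%:R) <= e / 2 * N1%:R :> R.
  rewrite natrM mulrA [leRHS]mulrA ler_pM2r //.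
  by have := Me; lra.
pose Kp : set T := [set x | diagonal_like iota phi e' N1%:R N2%:R (S *m x)].
pose Kb : set T := [set x | diagonal_like iota phi e N1%:R N2%:R (S *m x)].
have mKp : measurable Kp by exact: measurable_diagonal_like.
have mKb : measurable Kb by exact: measurable_diagonal_like.
have Kbf : (mu Kb < +oo)%E by exact: diagonal_like_finite.
have Kbn : mu Kb \is a fin_num by rewrite ge0_fin_numE.
have [sh [C [C0 [i0 bnd]]]] := avoid N1%:R N2%:R (ltac:(by rewrite ler1n)) (ltac:(by rewrite ler1n)) sig.
pose A k : set T := Kp `&` ~` [set x | hit (k + sh)%N 1%:M x].
have mA k : measurable (A k).
  by apply: measurableI => //; apply: measurableC; exact: measurable_hits.
have muA k : (i0 <= k)%N -> (mu (A k) <= (C * fine (mu Kb) * k.+1%:R * z0 ^+ k)%:E)%E.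
  move=> /bnd [q pq cnt].
  (* Conjugation puts the shear on the left of S x: S (u_B x) = shear (S x). By left invariance all
     the preimages of [A k] have its measure, and by stability they lie in [Kb]. *)
  pose u (B : 'M['F_q]_(l.+2, r.+1)) : 'M[R]_n := invmx S *m shear R iota phi B *m S.
  have SLu B : SL (u B).
    rewrite /SL /= !det_mulmx det_shear // mulr1 -det_mulmx mulVmx // det1 //.
  have Su' B x : S *m (u B *m x) = shear R iota phi B *m (S *m x).
    by rewrite /u !mulmxA mulmxV // mul1mx.
  have [_ _ _ inv] := haar.
  have H := @sum_measure_le _ T R mu 'M['F_q]_(l.+2, r.+1)
    (fun B => mulmx (u B) @^-1` A k) Kb (C * k.+1%:R * z0 ^+ k * (q ^ (l.+2 * r.+1))%:R).
  have {}H : (\sum_(B : 'M['F_q]_(l.+2, r.+1)) mu (A k)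
      <= (C * k.+1%:R * z0 ^+ k * (q ^ (l.+2 * r.+1))%:R)%:E * mu Kb)%E.
    rewrite -[X in (X <= _)%E](eq_bigr _ (fun B _ => inv _ _ (SLu B) (mA k))).
    apply: H => //.
    - move=> B; rewrite -[X in measurable X]setTI.
      by apply: measurable_borel => //; exact: continuous_mulmxl.
    - move=> B x [/= Kx _]; move: Kx; rewrite /Kp /= Su'.
      exact: (diagonal_like_shear phiI phi_iota pq).
    - move=> x Kx; apply: le_trans (cnt _ Kx).
      rewrite ler_nat; apply: subset_leq_card; apply/fintype.subsetP => B.
      rewrite !finset.in_set => /asboolP [_ nh]; apply/asboolP => h; apply: nh.
      (* An integer vector v solving for S u_B x yields the integer vector v s solving for u_B x;
         the norm in [hits] was measured after multiplication by [sig] for this purpose. *)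
      case: h => v; rewrite /= -Su' => -[h1 h2 h3].
      exists (v *m sig); rewrite /= mulmx1 map_mxM -/S -mulmxA; split=> //.
      by move: h3; rewrite map_mxM.
  have q0 : (0 : R) < (q ^ (l.+2 * r.+1))%:R by rewrite ltr0n expn_gt0 prime_gt0.
  have fin : (mu (A k) < +oo)%E.
    apply: le_lt_trans (le_lt_trans H _).
      by rewrite (bigD1 0) //= leeDl // sume_ge0.
    by rewrite -(fineK Kbn) ltry.
  have fE : mu (A k) = (fine (mu (A k)))%:E by rewrite fineK // ge0_fin_numE.
  move: H; rewrite -{1}(fineK Kbn) fE; move: (fine _) => f.
  rewrite sumEFin !lee_fin sumr_const card_mx card_Fp // -[leLHS]mulr_natr.
  rewrite mulrAC ler_pM2r // => /le_trans; apply.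
  rewrite le_eqVlt; apply/orP; left; apply/eqP; ring.
have z00 : 0 < z0.
  rewrite divr_gt0 ?exprn_gt0 // mulr_gt0 ?exprn_gt0 // prodr_gt0 // => a _.
  by have /andP[] := b01 a.
have := @limsup_null _ T R mu A (C * fine (mu Kb)) z0 i0 _ _ mA muA.
rewrite z00 z01 => /(_ _ isT) L0.
have {}L0 : mu (lim_sup_set (fun k => A (k + i0)%N)) = 0%E.
  by apply: L0; rewrite mulr_ge0 // fine_ge0.
exists (lim_sup_set (fun k => A (k + i0)%N)); split=> //.
  by apply: bigcapT_measurable => k; apply: bigcup_measurable => j _.
move=> x [[Sx miss] [_ Kx]] J _ /=.
have [j Jj nh] := miss (J + i0 + sh)%N.
have Jj' : (J + (i0 + sh) <= j)%N by rewrite addnA.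
exists (j - (i0 + sh))%N; first by rewrite /= leq_subRL ?(leq_trans (leq_addl _ _) Jj') // addnC.
by rewrite /A -addnA subnK ?(leq_trans (leq_addl _ _) Jj') //.
Qed.

End SectionNull.

(** * Exceptional set in the product of groups *)

Lemma is_norm_bound (R : realType) (n : nat) (N : 'rV[R]_n -> R) : is_norm N ->
  exists2 C : R, 0 <= C & forall (v : 'rV[R]_n) b, (forall i, `|v 0 i| <= b) -> N v <= C * b.
Proof.
move=> [ND NZ _].
have N0 : N 0 = 0 by rewrite -(scale0r (0 : 'rV[R]_n)) NZ normr0 mul0r.
have Nge0 v : 0 <= N v.
  have := ND v (- v); rewrite subrr N0 -scaleN1r NZ normrN normr1 mul1r; lra.
exists (\sum_i N (delta_mx 0 i)) => [|v b vb]; first by apply: sumr_ge0.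
rewrite {1}(row_sum_delta v) mulr_suml.
apply: (@le_trans _ _ (\sum_i N (v 0 i *: delta_mx 0 i))).
  elim/big_rec2: _ => [|i y x _ h]; first by rewrite N0.
  by apply: le_trans (ND _ _) _; rewrite lerD2l.
by apply: ler_sum => i _; rewrite NZ mulrC ler_wpM2l.
Qed.

Lemma continuous_exp (R : realType) (T : topologicalType) (k : nat) (f : T -> R) :
  continuous f -> continuous (fun x => f x ^+ k).
Proof.
by move=> cf x; apply: (@continuous_comp _ _ _ f (fun y => y ^+ k)); [exact: cf|exact: exprn_continuous].
Qed.

Lemma continuous_meval (R : realType) (T : topologicalType) (k : nat)
    (P : mpoly.mpoly k R) (f : 'I_k -> T -> R) : (forall i, continuous (f i)) ->
  continuous (fun x => mpoly.meval (fun i => f i x) P).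
Proof.
move=> cf; under eq_fun do rewrite mpoly.mevalE.
apply: continuous_sum => mo; apply: continuous_scale; apply: continuous_prod => i.
exact: continuous_exp.
Qed.

Lemma continuous_F0 (R : realType) (p q m s d : nat)
    (P1 : mpoly.mpoly (m + m) R) (P2 : mpoly.mpoly s R) :
  continuous (@F0 R p q m s d P1 P2).
Proof.
have cx i : continuous (fun v => @xpart R p q m s v 0 i).
  by under eq_fun do rewrite !mxE; exact: coord_continuous.
have cp k (P : mpoly.mpoly k R) (f : 'rV[R]_(dim_n p q m s) -> 'rV[R]_k) :
    (forall i, continuous (fun v => f v 0 i)) -> continuous (fun v => peval P (f v)).
  by move=> cf; exact: (continuous_meval (f := fun i v => f v 0 i)).
have cs k (f : 'I_k -> 'I_(p + q)) :
    continuous (fun v => \sum_i @xpart R p q m s v 0 (f i) ^+ d).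
  by apply: continuous_sum => i; apply: continuous_exp; exact: cx.
have c1 : continuous (fun v => peval P1 (@ypart R p q m s v)).
  by apply: cp => i; under eq_fun do rewrite !mxE; exact: coord_continuous.
have c2 : continuous (fun v => peval P2 (@zpart R p q m s v)).
  by apply: cp => i; under eq_fun do rewrite !mxE; exact: coord_continuous.
move=> v; exact: (cvgD (cvgD (cvgB (cs p _ v) (cs q _ v)) (c1 v)) (c2 v)).
Qed.

Lemma dyadic_level (R : realType) (J : nat) (t : R) : 2 ^+ J <= t ->
  exists j, [/\ (J <= j)%N, 2 ^+ j <= t & t <= 2 ^+ j.+1].
Proof.
move=> Jt; have t1 : 1 <= t by apply: le_trans Jt; rewrite exprn_ege1 // ler1n.
have /andP[tt tT] := truncn_itv (le_trans ler01 t1).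
have T0 : (0 < Num.truncn t)%N by rewrite truncn_gt0.
have /andP[lo hi] := trunc_log_bounds (isT : (1 < 2)%N) T0.
set j := trunc_log 2 _ in lo hi; exists j.
have t2 : t < 2 ^+ j.+1 by apply: lt_le_trans tT _; rewrite -natrX ler_nat.
split; last exact: ltW.
  have := le_lt_trans Jt t2.
  by rewrite -!natrX ltr_nat ltn_exp2l.
by apply: le_trans tt; rewrite -natrX ler_nat.
Qed.

Lemma gt1_ltr_powR (R : realType) (a : R) : 1 < a -> {homo powR a : x y / x < y}.
Proof.
move=> a1 x y xy; have a0 : 0 < a by exact: lt_trans a1.
by rewrite /powR gt_eqF // ltr_expR ltr_pM2r // ln_gt0.
Qed.

(** * Powers of t at dyadic levels *)

Section Thresholds.
Variables (R : realType) (r : nat) (kap : 'I_r.+1 -> R).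
Hypothesis kap0 : forall a, 0 < kap a.

Definition decay (a : 'I_r.+1) : R := 2 `^ (- kap a).

Lemma decay01 a : 0 < decay a < 1.
Proof.
rewrite /decay powR_gt0 //= -[ltRHS](powRr0 2); apply: gt1_ltr_powR; first by rewrite ltr1n.
by rewrite oppr_lt0.
Qed.

Lemma decay_level a j (t : R) : 0 < t -> t <= 2 ^+ j.+1 -> decay a ^+ j.+1 <= t `^ (- kap a).
Proof.
move=> t0 tj; rewrite /decay -powR_mulrn ?powR_ge0 // -powRrM mulrC powRrM powR_mulrn //.
rewrite !powRN lef_pV2 ?posrE ?powR_gt0 ?exprn_gt0 //.
by apply: ge0_ler_powR; rewrite ?nnegrE ?exprn_ge0 // ltW.
Qed.

Lemma decay_prod : \prod_a decay a = 2 `^ (- \sum_a kap a).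
Proof.
elim/big_rec2: _ => [|a x y _ ->]; first by rewrite oppr0 powRr0.
by rewrite opprD powRD // pnatr_eq0 implybT.
Qed.

(** The hypothesis kappa < n - r - d enters here: with k = n - r - 1 the ratio equals 2^(kappa + d -
    (n - r)). *)
Lemma decay_exponent d k : (0 < d)%N -> \sum_a kap a + d%:R < k%:R + 1 ->
  2 ^+ d.-1 / (2 ^+ k * \prod_a decay a) < 1.
Proof.
move=> d0 h; rewrite decay_prod powRN ltr_pdivrMr ?divr_gt0 ?powR_gt0 ?exprn_gt0 //.
rewrite mul1r ltr_pdivlMr ?powR_gt0 // -!powR_mulrn // -powRD ?pnatr_eq0 ?implybT //.
apply: gt1_ltr_powR; first by rewrite ltr1n.
by move: h; case: d d0 => // d _; rewrite -natr1 /=; lra.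
Qed.

End Thresholds.

Section JointMeasurability.
Variables (R : realType) (n r : nat) (iota : 'I_r.+1 -> 'I_n).
Variables (F : 'rV[R]_n -> R) (xi0 : R) (xi : 'rV[R]_r) (N : 'rV[R]_n -> R).
Variable b : 'I_r.+1 -> R.
Hypothesis Fc : continuous F.
Local Notation T := (borel R * borel 'M[R]_n * borel 'M[R]_r)%type.

Lemma measurable_abs_sub_lt d (S : measurableType d) (f : S -> R) (a c : R) :
  measurable_fun setT f -> measurable [set x | `|f x - a| < c].
Proof.
move=> mf; rewrite -[X in measurable X]setTI.
apply: (mf measurableT [set y | `|y - a| < c]).
apply: open_measurable; apply: (open_abs_sub_lt (f := id)).
by move=> x; exact: cvg_id.
Qed.

(** The sigma-algebra is the product of three Borel ones, so the inequalities are assembled from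
    functions of a single factor, and integer vectors are handled by a countable union. *)
Lemma measurable_joint_hits j :
  measurable [set x : T | hits iota F x.1.1 xi0 x.2 xi N b j 1%:M x.1.2].
Proof.
have m1 : measurable_fun setT (fun x : T => (x.1.1 : R)).
  apply: (measurableT_comp (f := (id : borel R -> R))).
    by apply: measurable_borel_real => x; exact: cvg_id.
  exact: (measurableT_comp measurable_fst measurable_fst).
have m12 (f : 'M[R]_n -> R) : continuous f -> measurable_fun setT (fun x : T => f x.1.2).
  move=> cf; apply: (measurableT_comp (f := (f : borel 'M[R]_n -> R))).
    exact: measurable_borel_real.
  exact: (measurableT_comp measurable_snd measurable_fst).
have m2 (f : 'M[R]_r -> R) : continuous f -> measurable_fun setT (fun x : T => f x.2).
  move=> cf; apply: (measurableT_comp (f := (f : borel 'M[R]_r -> R))).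
    exact: measurable_borel_real.
  exact: measurable_snd.
pose P1 (v : 'rV[int]_n) : set T :=
  [set x | `|x.1.1 * F (map_mx intr v *m x.1.2) - xi0| < b ord0 ^+ j.+1].
pose P2 (v : 'rV[int]_n) i : set T :=
  [set x | `|(thin iota (map_mx intr v *m x.1.2) *m x.2) 0 i - xi 0 i| < b (lift ord0 i) ^+ j.+1].
have mP1 v : measurable (P1 v).
  apply: measurable_abs_sub_lt; apply: measurable_funM => //.
  apply: (m12 (fun g => F (map_mx intr v *m g))) => g.
  apply: (@continuous_comp _ _ _ (fun g : 'M[R]_n => map_mx intr v *m g) F).
    exact: continuous_mulmxl.
  exact: Fc.
have mP2 v i : measurable (P2 v i).
  apply: measurable_abs_sub_lt; under eq_fun do rewrite mxE.
  apply: measurable_sum => a; apply: measurable_funM.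
    under eq_fun do rewrite mxE.
    apply: (m12 (fun g => (map_mx intr v *m g) 0 (iota (lift ord0 a)))).
    exact: continuous_mulmx_coord.
  apply: (m2 (fun g => g a i)); exact: coord_continuous.
rewrite [X in measurable X](_ : _ = \bigcup_(v : 'rV[int]_n)
    if `[< N (map_mx intr (v *m 1%:M)) <= 2 ^+ j >] then
    P1 v `&` \bigcap_(i in [set: 'I_r]) P2 v i else set0); last first.
  apply/seteqP; split=> x.
    by move=> [v [h1 h2 h3]]; exists v => //; rewrite asboolT //; split=> // i _; exact: h2.
  move=> [v _]; case: asboolP => // h3 [h1 h2]; exists v; split=> // i.
  exact: (h2 i).
apply: countable_bigcupT_measurable; first exact: countableP.
move=> v; case: ifP => // _; apply: measurableI => //.
by apply: fin_bigcap_measurable => // i _; exact: mP2.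
Qed.

(** A measurable set, described by integer levels, that covers the exceptional set described by real
    t; Fubini is applied to this cover. *)
Definition missed : set T := [set x | [/\ Runits x.1.1, SL x.1.2, GL x.2 &
  forall J, exists2 j, (J <= j)%N & ~ hits iota F x.1.1 xi0 x.2 xi N b j 1%:M x.1.2]].

Lemma measurable_missed : measurable missed.
Proof.
have mr : measurable ([set a | a != 0] : set (borel R)).
  apply: measurable_open; exact: open_neq.
have ms : measurable (@SL R n : set (borel 'M[R]_n)).
  rewrite -[X in measurable X]setCK; apply: measurableC; apply: measurable_open.
  by apply: closed_openC; exact: closed_SL.
have mg : measurable (@GL R r : set (borel 'M[R]_r)).
  apply: measurable_open.
  rewrite [X in open X](_ : _ = (fun g : 'M[R]_r => \det g) @^-1` [set y | y != 0]).
    by apply: open_comp => [g _|]; [exact: continuous_det|exact: open_neq].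
  by apply/seteqP; split=> g; rewrite /GL /= unitmxE unitfE.
rewrite [X in measurable X](_ : _ =
  ((fun x : T => x.1.1) @^-1` [set a | a != 0] `&` (fun x : T => x.1.2) @^-1` @SL R n `&`
    (fun x : T => x.2) @^-1` @GL R r) `&`
  \bigcap_J \bigcup_(j in [set j | (J <= j)%N])
    ~` [set x : T | hits iota F x.1.1 xi0 x.2 xi N b j 1%:M x.1.2]); last first.
  apply/seteqP; split=> x.
    by move=> [h1 h2 h3 h4]; split=> // J _; have [j Jj hj] := h4 J; exists j.
  by move=> [[[h1 h2] h3] h4]; split=> // J; have [j Jj hj] := h4 J I; exists j.
apply: measurableI; last first.
  apply: bigcapT_measurable => J; apply: bigcup_measurable => j _; apply: measurableC.
  exact: measurable_joint_hits.
apply: measurableI; [apply: measurableI|].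
- rewrite -[X in measurable X]setTI.
  exact: (measurableT_comp measurable_fst measurable_fst).
- rewrite -[X in measurable X]setTI.
  exact: (measurableT_comp measurable_snd measurable_fst).
- rewrite -[X in measurable X]setTI; exact: measurable_snd.
Qed.

End JointMeasurability.

Theorem corollary1p2 (R : realType) (p q m s d : nat)
  (hr : (1 <= dim_r m s < dim_n p q m s)%N)
  (hd2 : (2 <= d)%N) (hdeven : ~~ odd d)
  (P1 : mpoly.mpoly (m + m) R) (P2 : mpoly.mpoly s R)
  (hP1 : exists d' : nat, (0 < d' < d)%N /\ first_half_growth P1 d')
  (N : 'rV[R]_(dim_n p q m s) -> R) (hN : is_norm N)
  (hp : (1 <= p)%N) (hq : (1 <= q)%N)
  (hpq : (d + 1 <= p + q <= dim_n p q m s - dim_r m s)%N)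
  (kappa : R)
  (hkappa : 0 <= kappa < (dim_n p q m s)%:R - (dim_r m s)%:R - d%:R)
  (kap : 'I_(dim_r m s).+1 -> R)
  (hkap_gt0 : forall i, 0 < kap i)
  (hkap_sum : \sum_i kap i = kappa)
  (xi : 'I_(dim_r m s).+1 -> R) :
  ae_in_orbit (@F0 R p q m s d P1 P2) (M0 R p q m s)
    (fun F M => \forall t \near +oo,
       exists v : 'rV[int]_(dim_n p q m s),
         solves N kap xi F M t (map_mx intr v)).
Proof.
move=> mu0 mu1 mu2 _ haar _.
have d0 : (0 < d)%N by apply: ltnW.
have [d' [/andP[_ dd'] HP1]] := hP1.
(* There are n - r - 1 free indices, and at least two of them because n - r >= d + 1 >= 3. *)
have [l ln] : exists l, (l.+2 + (dim_r m s).+1 = dim_n p q m s)%N.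
  by exists (dim_n p q m s - (dim_r m s).+3)%N; lia.
pose x1 : 'I_p := Ordinal hp; pose xq : 'I_q := Ordinal hq.
pose iota := @special p q m s x1.
have [phi [phiI phi_iota phi0]] := free_indices x1 xq (eq_leq ln).
have [CN CN0 HN] := is_norm_bound hN.
pose xi' : 'rV[R]_(dim_r m s) := \row_i xi (lift ord0 i).
pose F := @F0 R p q m s d P1 P2.
have Fc : continuous F by exact: continuous_F0.
have z01 : 2 ^+ d.-1 / (2 ^+ l.+2 * \prod_a decay kap a) < 1.
  apply: decay_exponent => //; rewrite hkap_sum.
  case/andP: hkappa => _; rewrite -ln natrD -[(dim_r m s).+1%:R]natr1; lra.
pose B := missed iota F (xi ord0) xi' N (decay kap).
have mB : measurable B by exact: measurable_missed.
exists B; split=> //.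
  apply: product_null => // lam g2.
  have mA : measurable ([set g | B (lam, g, g2)] : set (borel 'M[R]_(dim_n p q m s))).
    rewrite -[X in measurable X]setTI.
    apply: (_ : measurable_fun setT (fun g : borel 'M[R]_(dim_n p q m s) =>
      (lam, g, g2) : borel R * borel 'M[R]_(dim_n p q m s) * borel 'M[R]_(dim_r m s))) => //.
    apply: measurable_fun_pair; last exact: measurable_cst.
    by apply: measurable_fun_pair; [exact: measurable_cst|exact: measurable_id].
  have [l0|l0] := eqVneq (lam : R) 0.
    rewrite [X in mu1 X](_ : _ = set0) ?measure0 //.
    by apply/seteqP; split=> g //= [+ _ _ _]; rewrite /Runits /= l0 eqxx.
  have [gu|gu] := boolP ((g2 : 'M[R]_(dim_r m s)) \in unitmx); last first.
    rewrite [X in mu1 X](_ : _ = set0) ?measure0 //.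
    by apply/seteqP; split=> g //= [_ _ + _]; rewrite /GL /= (negPf gu).
  apply: (iffLR (@negligibleP _ _ _ mu1 _ mA)).
  apply: negligibleS (section_null (special_inj (x1 := x1)) phiI phi_iota ln Fc d0
    (c := (p + q + 1)%N) _ _ (xi ord0) xi' l0 gu CN0 HN (decay01 hkap_gt0) z01 haar).
  - by move=> g [].
  - move=> K2 Z K20 Z0; exact: (F0_lipschitz q x1 P2 dd' HP1).
  - move=> K2 Z K20 Z0; rewrite phi0; exact: (F0_growth x1 xq P2 dd' HP1).
(* By contraposition: if all levels from [J] on are hit, every t beyond 2^J lies between two
   consecutive powers of 2 and inherits a solution. *)
move=> x [[h1 h2 h3] [_ bad]]; split=> // J; apply: contrapT => hit; apply: bad => /=.
exists (2 ^+ J); split; first by rewrite num_real.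
move=> t /ltW Jt; have [j [Jj lo hi]] := dyadic_level Jt.
have t0 : 0 < t by apply: lt_le_trans Jt; rewrite exprn_gt0.
have [v [v1 v2 v3]] : hits iota F x.1.1 (xi ord0) x.2 xi' N (decay kap) j 1%:M x.1.2.
  by apply: contrapT => h; apply: hit; exists j.
exists v; split.
- by move: v1 => /= /lt_le_trans; apply; exact: decay_level.
- move=> i; have := v2 i; rewrite thin_special /= !mulmxA [xi' _ _]mxE.
  by move=> /= /lt_le_trans; apply; exact: decay_level.
- by apply: le_trans lo; rewrite mulmx1 in v3.
Qed.
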